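(* Let $\lambda=\sum_{r=1}^l a_r\lambda_r\in\Lambda^+$ be a dominant integral weight and let $\mu\in\Lambda$ be such that $\mu=\lambda-\sum_{r=1}^l c_r\alpha_r$ for some $c_1,\ldots,c_l\in\mathbb{Z}_{\geqslant 0}$. Assume that there is a non-empty subset $J$ of $\{1,\ldots,l\}$ such that $0\leqslant c_j\leqslant a_j$ for every $j\in J$, and set $\lambda'=\lambda+\sum_{j\in J}(c_j-a_j)\lambda_j$ and $\mu'=\lambda'-(\lambda-\mu)$. Then $$\operatorname{m}_{L(\lambda)}(\mu)=\operatorname{m}_{L(\lambda')}(\mu').$$
   Context: $\mathfrak{g}$ is a finite-dimensional semisimple Lie algebra over $\mathbb{C}$ of rank $l$ with Cartan subalgebra $\mathfrak{h}$, root system $\Phi=\Phi^+\sqcup\Phi^-$ and ordered base of simple roots $\Pi=\{\alpha_1,\ldots,\alpha_l\}$. $\lambda_1,\ldots,\lambda_l$ are the corresponding fundamental weights, characterized by $\langle\lambda_i,\alpha_j\rangle=2(\lambda_i,\alpha_j)/(\alpha_j,\alpha_j)=\delta_{ij}$, where $(-,-)$ is the inner product induced by the Killing form. $\Lambda=\mathbb{Z}\lambda_1+\cdots+\mathbb{Z}\lambda_l$ is the integral weight lattice and $\Lambda^+=\{\lambda\in\Lambda:\langle\lambda,\alpha_r\rangle\geqslant 0 \text{ for all } 1\leqslant r\leqslant l\}$ is the set of dominant integral weights. For $\lambda\in\Lambda^+$, $L(\lambda)$ denotes the irreducible finite-dimensional $\mathfrak{g}$-module of highest weight $\lambda$. For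 a $\mathfrak{g}$-module $V$ and $\mu\in\mathfrak{h}^*$, $\operatorname{m}_V(\mu)=\dim V_\mu$, where $V_\mu=\{v\in V: hv=\mu(h)v \text{ for all } h\in\mathfrak{h}\}$ (so $\operatorname{m}_V(\mu)=0$ if $\mu$ is not a weight of $V$). *)

(* Defs.v *)
From HB Require Import structures.
From mathcomp Require Import all_boot all_order all_algebra.
From mathcomp Require Export complex.
From mathcomp Require Export reals.

Set Implicit Arguments.
Unset Strict Implicit.
Unset Printing Implicit Defensive.

Import Order.TTheory GRing.Theory Num.Theory passmx.
Local Open Scope ring_scope.

HB.mixin Record isLieAlgebra (F : fieldType) L of Vector F L := {
  bracket : L -> L -> L;
  bracket_linearl : forall y, linear (bracket^~ y);
  bracket_linearr : forall x, linear (bracket x);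
  bracketxx : forall x, bracket x x = 0;
  jacobi : forall x y z,
    bracket x (bracket y z) + bracket y (bracket z x)
      + bracket z (bracket x y) = 0
}.

#[short(type="lieAlgType")]
HB.structure Definition LieAlgebra (F : fieldType) :=
  {L of isLieAlgebra F L & Vector F L}.

(* Finite dimensionality is built into vectType, for modules as for L. *)
Record lieModule (F : fieldType) (L : lieAlgType F) := LieModule {
  module_space :> vectType F;
  act : 'Hom(L, 'End(module_space));
  act_bracket : forall (x y : L) (v : module_space),
    act (bracket x y) v = act x (act y v) - act y (act x v)
}.

Section LieTheory.
Variables (F : fieldType) (L : lieAlgType F).
Implicit Types (x y : L) (U W H I : {vspace L}).

HB.instance Definition _ x :=
  GRing.isLinear.Build F L L *:%R (bracket x) (bracket_linearr x).

Definition ad_lfun : 'Hom(L, 'End(L)) := linfun (fun x => linfun (bracket x)).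

Lemma ad_lfunE x y : ad_lfun x y = bracket x y.
Proof.
pose f x := linfun (bracket x).
have f_lin : linear f.
  move=> a u v; apply/lfunP => w.
  by rewrite add_lfunE scale_lfunE !lfunE /= bracket_linearl.
pose f' := HB.pack_for {linear L -> 'End(L)} f
  (GRing.isLinear.Build F L 'End(L) *:%R f f_lin).
by rewrite /ad_lfun -/f (lfunE f') /= lfunE.
Qed.

Lemma bracketC x y : bracket x y = - bracket y x.
Proof.
have DL : bracket (x + y) (x + y) = bracket x (x + y) + bracket y (x + y).
  by have := bracket_linearl (x + y) 1 x y; rewrite !scale1r.
apply/eqP; rewrite -addr_eq0 -(bracketxx (x + y)) DL !linearD /=.
by rewrite !bracketxx add0r addr0.
Qed.

Lemma ad_bracket x y z :
  ad_lfun (bracket x y) z = ad_lfun x (ad_lfun y z) - ad_lfun y (ad_lfun x z).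
Proof.
rewrite !ad_lfunE; have := jacobi x y z.
rewrite [bracket z (bracket x y)]bracketC [bracket z x]bracketC linearN /=.
by move/eqP; rewrite subr_eq0 => /eqP.
Qed.

Definition adjoint : lieModule L := LieModule ad_bracket.

Definition bracketv U W : {vspace L} :=
  <<[seq bracket x y | x <- vbasis U, y <- vbasis W]>>%VS.

Definition ideal I := (bracketv fullv I <= I)%VS.

Definition solvable I :=
  exists n, iter n (fun U => bracketv U U) I = 0%VS.

Definition nilpotent H := exists n, iter n (bracketv H) H = 0%VS.

(* The radical is zero. *)
Definition semisimple := forall I, ideal I -> solvable I -> I = 0%VS.

Definition self_normalizing H :=
  forall x, (forall y, y \in H -> bracket x y \in H) -> x \in H.

Definition cartan_subalgebra H :=
  [/\ (bracketv H H <= H)%VS, nilpotent H & self_normalizing H].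

Definition lfun_trace (V : vectType F) (f : 'End(V)) : F :=
  \tr (mxof (vbasis {:V}) (vbasis {:V}) f).

Definition killing x y : F := lfun_trace (ad_lfun x \o ad_lfun y)%VF.

End LieTheory.

Section Weights.
Variables (F : fieldType) (L : lieAlgType F) (H : {vspace L}).
Local Notation dual := ('Hom(subvs_of H, F^o)).
Implicit Types (mu alpha beta : dual) (V : lieModule L).

Definition weight_space V mu : {vspace V} :=
  (\bigcap_(t <- vbasis {:subvs_of H}) leigenspace (act V (vsval t)) (mu t))%VS.

Lemma weight_spaceP V mu (v : V) :
  reflect (forall t : subvs_of H, act V (vsval t) v = mu t *: v)
          (v \in weight_space V mu).
Proof.
have memE (t : subvs_of H) :
    (v \in leigenspace (act V (vsval t)) (mu t))
    = (act V (vsval t) v == mu t *: v).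
  by rewrite memv_ker !lfun_simp subr_eq0.
have big_mem (s : seq (subvs_of H)) :
  (v \in (\bigcap_(t <- s) leigenspace (act V (vsval t)) (mu t))%VS)
  = all (fun t => act V (vsval t) v == mu t *: v) s.
  elim: s => [|t s IHs]; first by rewrite big_nil memvf.
  by rewrite big_cons memv_cap IHs memE.
rewrite /weight_space big_mem; apply: (iffP allP) => [vP t|vP t _]; last exact/eqP.
rewrite (coord_vbasis (memvf t)) !linear_sum /= scaler_suml sum_lfunE.
apply: eq_bigr => i _; rewrite !linearZ /= scale_lfunE -scalerA.
by congr (_ *: _); apply/eqP/vP/mem_nth; rewrite size_tuple.
Qed.

Definition weight_mult V mu := \dim (weight_space V mu).

Definition is_root alpha :=
  (alpha != 0) && (weight_space (adjoint L) alpha != 0%VS).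

(* The form on the dual of H induced by the Killing form: (alpha, beta) is
   kappa(t_alpha, t_beta), where t_alpha in H represents alpha. *)
Definition killing_flat : 'Hom(subvs_of H, dual) :=
  linfun (fun s : subvs_of H =>
    (linfun (fun t => @killing F L (vsval s) (vsval t) : F^o) : dual)).

Lemma killing_flatE (s t : subvs_of H) : killing_flat s t = killing (vsval s) (vsval t).
Proof.
have trD a (f g : 'End(L)) :
    lfun_trace (a *: f + g) = a * lfun_trace f + lfun_trace g.
  by rewrite /lfun_trace linearP linearD linearZ.
pose k (s t : subvs_of H) : F^o := @killing F L (vsval s) (vsval t).
have k_linr u : linear (k u).
  move=> a v w.
  have E : (ad_lfun L (vsval u) \o ad_lfun L (vsval (a *: v + w)))%VF
     = a *: (ad_lfun L (vsval u) \o ad_lfun L (vsval v))%VF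
       + (ad_lfun L (vsval u) \o ad_lfun L (vsval w))%VF.
    by apply/lfunP => z; rewrite !(add_lfunE, scale_lfunE, comp_lfunE, linearP).
  exact: etrans (congr1 (@lfun_trace F L) E) (trD _ _ _).
have k_linl u : linear (k^~ u).
  move=> a v w.
  have E : (ad_lfun L (vsval (a *: v + w)) \o ad_lfun L (vsval u))%VF
     = a *: (ad_lfun L (vsval v) \o ad_lfun L (vsval u))%VF
       + (ad_lfun L (vsval w) \o ad_lfun L (vsval u))%VF.
    by apply/lfunP => z; rewrite !(add_lfunE, scale_lfunE, comp_lfunE, linearP).
  exact: etrans (congr1 (@lfun_trace F L) E) (trD _ _ _).
pose kr u := HB.pack_for {linear subvs_of H -> F^o} (k u)
  (GRing.isLinear.Build F (subvs_of H) F^o *:%R (k u) (k_linr u)).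
have krE u v : linfun (k u) v = k u v by rewrite (lfunE (kr u)).
have kf_lin : linear (fun u => linfun (k u)).
  move=> a u v; apply/lfunP => w.
  by rewrite add_lfunE scale_lfunE !krE k_linl.
pose kf := HB.pack_for {linear subvs_of H -> dual} (fun u => linfun (k u))
  (GRing.isLinear.Build F (subvs_of H) dual *:%R _ kf_lin).
by rewrite /killing_flat (lfunE kf) /= krE.
Qed.

Definition killing_sharp : 'Hom(dual, subvs_of H) := (killing_flat^-1)%VF.

Definition weight_form alpha beta : F :=
  killing (vsval (killing_sharp alpha)) (vsval (killing_sharp beta)).

Definition pairing mu alpha : F :=
  2 * weight_form mu alpha / weight_form alpha alpha.

Variables (l : nat) (Pi : l.-tuple dual).

Definition nneg_combination beta :=
  exists k : 'I_l -> nat, beta = \sum_(i < l) tnth Pi i *+ k i.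

Definition root_base :=
  [/\ basis_of fullv Pi,
      forall i, is_root (tnth Pi i)
    & forall beta, is_root beta ->
        nneg_combination beta \/ nneg_combination (- beta)].

Definition positive_root beta := is_root beta /\ nneg_combination beta.

Definition fundamental_weights (fw : l.-tuple dual) :=
  forall i j, pairing (tnth fw i) (tnth Pi j) = (i == j)%:R.

Definition integral_weight (fw : l.-tuple dual) mu :=
  exists z : 'I_l -> int, mu = \sum_(i < l) (z i)%:~R *: tnth fw i.

Definition irreducible V :=
  {:V}%VS != 0%VS /\
  forall U : {vspace V},
    (forall x, (act V x @: U <= U)%VS) -> U = 0%VS \/ U = fullv.

Definition has_highest_weight V mu :=
  exists v : V,
    [/\ v != 0, v \in weight_space V mu
      & forall beta x, positive_root beta ->
          x \in weight_space (adjoint L) beta -> act V x v = 0].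

(* V is a model of L(mu), which is unique up to isomorphism. *)
Definition irreducible_highest V mu := irreducible V /\ has_highest_weight V mu.

End Weights.

Definition dominant_integral (F : numFieldType) (L : lieAlgType F)
    (H : {vspace L}) (l : nat) (Pi fw : l.-tuple 'Hom(subvs_of H, F^o))
    (mu : 'Hom(subvs_of H, F^o)) :=
  integral_weight fw mu /\ forall r, 0 <= pairing mu (tnth Pi r).

(* Main.v *)
From HB Require Import structures.
Require Import Defs.
From mathcomp Require Import all_boot all_order all_algebra.
From mathcomp Require Import complex reals ring.

Set Implicit Arguments.
Unset Strict Implicit.
Unset Printing Implicit Defensive.

Import Order.TTheory GRing.Theory Num.Theory passmx.
Local Open Scope ring_scope.

(** Write the weight [lambda - delta'] space of [L(lambda)] as the space of words
    of weight [- delta'] in the lowering operators, modulo the relations satisfied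
    by the highest weight vector.  Both sides of the theorem use the same words,
    so it is enough that [L(lambda)] and [L(lambda')] have the same relations in
    degree [delta' = sum_r c_r alpha_r].  Intuitively, all relations come from the
    Serre relations and from [f_i^(a_i + 1) v = 0]; the two weights differ only at
    the indices [j] of [J], where these generators have degree larger than [c_j].
    A Casimir argument inside finite-dimensional modules takes the place of this
    presentation of [L(lambda)].

    _Persistence_ ([relations_persist]).  Let [v] be a highest weight vector of
    weight [lam], and let [tau] vanish on the coroots outside [J].  A relation [u]
    of [v] in degree [beta], with [beta_j <= lam(h_j)] for [j] in [J], is a relation
    of every highest weight vector of weight [lam + m tau].  By induction on the
    height of [beta] this is known for the raised words [x u].  On weight
    [lam + n tau] the Casimir operator expresses [c(n) u] through lowerings of the
    [x u] ([casimir_relation]), where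
      [c(n) = 2 (lam + n tau + rho, beta) - (beta, beta)].
    The expression is polynomial in [n] ([normal_form]).  Tensoring with modules of
    highest weight [(n - m) tau] and contracting again ([eval_contract]) shows that
    it holds on the given vector for all [n >= m], hence also for [n = 0], where
    every raised word vanishes.  So [c(0) u = 0], and [c(0)] is positive
    ([casimir_scalar_gt0]): at [i] outside [J] because [u], if nonzero, would be
    a highest weight vector for the [i]-th copy of [sl2] in a finite-dimensional
    module, and at [j] in [J] because of the bound on [beta_j].

    _Interpolation_ ([relations_interpolate]).  If [u] is a relation for all the
    weights [lam + n tau], then every raising of [u] to degree zero is a scalar,
    polynomial in [n], with infinitely many zeros.  So [u] is a relation in the
    irreducible module of any highest weight [lam + s tau].  The difference of
    [lambda] and [lambda'] has a positive integral multiple [tau] that can be used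
    here: the top wedge of the nilradical of a maximal parabolic subalgebra gives
    finite-dimensional modules with highest weight a multiple of any fundamental
    weight ([admissible_fw]).  Going from [lambda] to [lambda'] and back gives the
    equality.

    The structure of [g] enters in the form of [split_setting]: a
    basis of weight vectors and a nondegenerate Killing form.  The existence of
    fundamental weights makes the Killing form nondegenerate on [H]; then [H] is
    abelian ([cartan_abelian]), the radical of the Killing form has no zero weight
    and is therefore zero by Engel's argument ([killing_nondegenerate]), and [H]
    acts diagonalisably because the nilpotent part of [ad h] is an inner derivation
    orthogonal to [H] ([ad_semisimple]). *)

(** * Subspaces and generalised eigenvectors *)

Section Subspaces.
Variables (F : fieldType) (vT : vectType F).
Implicit Types (U W T N : {vspace vT}) (f g : 'End(vT)) (x y : vT) (a : F).

(** Replaces the choice of a maximal subspace with a given property, by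
    induction on the codimension. *)
Lemma vspace_grow (P : {vspace vT} -> Prop) U0 T :
  P U0 -> (U0 <= T)%VS ->
  (forall U, P U -> (U <= T)%VS -> U != T ->
     exists W, [/\ P W, (U <= W)%VS, (W <= T)%VS & W != U]) ->
  P T.
Proof.
move=> PU0 U0T grow.
have [k] := ubnP (\dim T - \dim U0); elim: k U0 PU0 U0T => // k IHk U PU UT.
rewrite ltnS => le_k; have [->//|UnT] := eqVneq T U; rewrite 1?eq_sym in UnT.
have [W [PW UW WT WU]] := grow U PU UT UnT.
apply: (IHk W PW WT).
have ltUW : (\dim U < \dim W)%N.
  by rewrite ltn_neqAle dimvS // andbT; apply: contraNneq WU => e;
    rewrite eq_sym eqEdim UW e /=.
apply: leq_trans le_k; apply: ltn_sub2l => //.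
by apply: leq_trans ltUW _; apply: dimvS.
Qed.

Lemma subvPn U W : ~~ (U <= W)%VS -> exists2 x, x \in U & x \notin W.
Proof.
move=> nUW; have /allPn[x xU xW] : ~~ all (fun x => x \in W) (vbasis U).
  by apply: contra nUW => /allP sUW; rewrite -(span_basis (vbasisP U)); apply/span_subvP.
by exists x => //; apply: vbasis_mem.
Qed.

Lemma neqv_sub U W : (U <= W)%VS -> U != W -> exists2 x, x \in W & x \notin U.
Proof. by move=> UW nUW; apply: subvPn; apply: contra nUW => WU; rewrite eqEsubv UW. Qed.

Lemma addv_line_neq U x : x \notin U -> (U + <[x]>)%VS != U.
Proof.
move=> xU; apply: contra xU => /eqP <-.
by rewrite (subvP (addvSr _ _)) ?memv_line.
Qed.

Lemma span_extract (P : vT -> Prop) :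
  (forall x, exists2 s : seq vT, (forall y, y \in s -> P y) & x = \sum_(y <- s) y) ->
  exists2 X : (\dim {:vT}).-tuple vT,
    basis_of fullv X & forall i, P (tnth X i).
Proof.
move=> decP.
have [s [/andP[/eqP s_span s_free] sP]] :
    exists s : seq vT, basis_of fullv s /\ (forall y, y \in s -> P y).
  pose Q U := exists s : seq vT, basis_of U s /\ (forall y, y \in s -> P y).
  apply: (@vspace_grow Q 0%VS) => [|| U [s [sU sP]] _ UnT].
  - by exists [::]; split; rewrite ?basisEfree ?span_nil ?nil_free ?subvv ?dimv0.
  - exact: subvf.
  have [x _ xU] := neqv_sub (subvf U) UnT.
  have [r rP xE] := decP x.
  have /allPn[y yr yU] : ~~ all (fun y => y \in U) r.
    apply: contra xU => /allP rU; rewrite xE big_seq.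
    by apply: memv_suml => y /rU.
  exists (U + <[y]>)%VS; split; rewrite ?addvSl ?subvf ?addv_line_neq //.
  exists (y :: s); split; last by move=> z /predU1P[->|/sP //]; apply: rP.
  rewrite /basis_of span_cons (span_basis sU) addvC eqxx /=.
  by rewrite free_cons (span_basis sU) yU (basis_free sU).
have sz : size s == \dim {:vT} by rewrite -s_span (eqP s_free).
exists (Tuple sz) => [|i]; first by rewrite /basis_of s_span eqxx.
by apply: sP; rewrite (tnth_nth 0) mem_nth // (eqP sz).
Qed.

Definition lfpow f k : 'End(vT) := iter k (fun u => f \o u)%VF \1%VF.

Lemma lfpow0 f x : lfpow f 0 x = x.
Proof. by rewrite /lfpow /= id_lfunE. Qed.

Lemma lfpowS f k x : lfpow f k.+1 x = f (lfpow f k x).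
Proof. by rewrite /lfpow /= comp_lfunE. Qed.

Lemma lfpowSr f k x : lfpow f k.+1 x = lfpow f k (f x).
Proof. by elim: k => [|k IHk]; rewrite !(lfpowS, lfpow0) // -IHk -lfpowS. Qed.

Lemma lfpowD f j k x : lfpow f (j + k) x = lfpow f j (lfpow f k x).
Proof. by elim: j => [|j IHj]; rewrite ?lfpow0 // addSn !lfpowS IHj. Qed.

Lemma lfpow_comm f g k : (forall x, f (g x) = g (f x)) ->
  forall x, lfpow f k (g x) = g (lfpow f k x).
Proof. by move=> fg; elim: k => [|k IHk] x; rewrite ?lfpow0 // !lfpowS IHk fg. Qed.

Definition shift f a : 'End(vT) := f - a *: \1%VF.

Lemma shiftE f a x : shift f a x = f x - a *: x.
Proof. by rewrite /shift !lfun_simp. Qed.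

Lemma shift_comm f g a : (forall x, f (g x) = g (f x)) ->
  forall x, shift f a (g x) = g (shift f a x).
Proof. by move=> fg x; rewrite !shiftE fg [g (_ - _)]linearB /= [g (_ *: _)]linearZ. Qed.

(** Membership in the generalised eigenspace of [f] for [a]; the exponent is
    left unbounded, so that sums and brackets need no bookkeeping. *)
Definition geig f a x := exists k, lfpow (shift f a) k x = 0.

Lemma lfpow_le0 f j k x : (j <= k)%N -> lfpow f j x = 0 -> lfpow f k x = 0.
Proof. by move=> /subnK <- fx0; rewrite lfpowD fx0 linear0. Qed.

Lemma geig0 f a : geig f a 0.
Proof. by exists 0%N; rewrite linear0. Qed.

Lemma geigD f a x y : geig f a x -> geig f a y -> geig f a (x + y).
Proof.
move=> [j xj] [k yk]; exists (maxn j k).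
rewrite linearD /= (lfpow_le0 (leq_maxl j k) xj) (lfpow_le0 (leq_maxr j k) yk).
by rewrite addr0.
Qed.

Lemma geigZ f a c x : geig f a x -> geig f a (c *: x).
Proof. by case=> k xk; exists k; rewrite linearZ /= xk scaler0. Qed.

Lemma geig_sum f a (I : eqType) (s : seq I) (P : pred I) (x : I -> vT) :
  (forall i, i \in s -> P i -> geig f a (x i)) -> geig f a (\sum_(i <- s | P i) x i).
Proof.
move=> sx; rewrite big_seq_cond; elim/big_rec: _ => [|i y /andP[/sx Hi /Hi Hx] Hy];
  first exact: geig0.
exact: geigD.
Qed.

Lemma geig_shift f a b x : geig f a x -> geig f a (shift f b x).
Proof.
case=> k xk; exists k; rewrite lfpow_comm ?xk ?linear0 // => y.
by apply: shift_comm => {}y; rewrite (shift_comm (f := f)).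
Qed.

Lemma lfpow_stable f N k x : (forall y, y \in N -> f y \in N) -> x \in N -> lfpow f k x \in N.
Proof. by move=> sN xN; elim: k => [|k IHk]; rewrite ?lfpow0 // lfpowS sN. Qed.

Lemma shift_stable f a N : (forall y, y \in N -> f y \in N) ->
  forall y, y \in N -> shift f a y \in N.
Proof. by move=> sN y yN; rewrite shiftE rpredB ?rpredZ ?sN. Qed.

(** The last power of a nilpotent shift that stays outside [T] gives an honest
    eigenvector modulo [T]. *)
Lemma geig_last f a T x : geig f a x -> x \notin T ->
  exists k, lfpow (shift f a) k x \notin T /\ shift f a (lfpow (shift f a) k x) \in T.
Proof.
case=> k xk; elim: k x xk => [|k IHk] x; first by rewrite lfpow0 => ->; rewrite mem0v.
rewrite lfpowSr => xk xT.
have [sT|/(IHk _ xk)[j [jT jS]]] := boolP (shift f a x \in T).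
  by exists 0%N; rewrite lfpow0.
by exists j.+1; rewrite lfpowSr.
Qed.

(** On the generalised eigenspace of [a], the operator [f - b] is the sum of the
    nilpotent [f - a] and of the nonzero scalar [a - b]; the equation is solved by
    induction on the nilpotency index. *)
Lemma geig_solve f a b N x : (forall y, y \in N -> f y \in N) -> a != b ->
  x \in N -> geig f a x ->
  exists y, [/\ y \in N, geig f a y & shift f b y = x].
Proof.
move=> sN ab xN [k xk]; elim: k x xN xk => [|k IHk] x xN.
  by rewrite lfpow0 => ->; exists 0; split; rewrite ?mem0v ?linear0 //; apply: geig0.
rewrite lfpowSr => xk.
have [y [yN gy yE]] := IHk _ (shift_stable a sN xN) xk.
have ab' : b - a != 0 by rewrite subr_eq0 eq_sym.
exists ((b - a)^-1 *: (y - x)); split.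
- by rewrite rpredZ ?rpredB.
- by apply/geigZ/geigD => //; rewrite -scaleN1r; apply/geigZ; exists k.+1; rewrite lfpowSr.
have sE : shift f b (y - x) = (b - a) *: x.
  by rewrite linearB /= yE !shiftE opprB addrC addrA subrK scalerBl.
by rewrite linearZ /= sE scalerA mulVf ?scale1r.
Qed.

Lemma geig_inj f a b x : a != b -> geig f a x -> f x = b *: x -> x = 0.
Proof.
move=> ab [k xk] fx; have H j : lfpow (shift f a) j x = (b - a) ^+ j *: x.
  elim: j => [|j IHj]; rewrite ?lfpow0 ?expr0 ?scale1r //.
  by rewrite lfpowS IHj linearZ /= shiftE fx -scalerBl scalerA exprSr.
move/eqP: xk; rewrite H scaler_eq0 expf_eq0 subr_eq0 eq_sym (negPf ab) andbF /=.
by move/eqP.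
Qed.

End Subspaces.
Arguments lfpow : simpl never.

(** * Eigenvalues over a closed field *)
Section ClosedField.
Variable F : numClosedFieldType.

(** Cayley-Hamilton, with the characteristic polynomial split into linear
    factors. *)
Lemma split_annihilator_mx n (A : 'M[F]_n) :
  exists rs : seq F, forall v : 'rV_n, foldl (fun u r => u *m A - r *: u) v rs = 0.
Proof.
case: n => [|n] in A *; first by exists [::] => v; apply/rowP => -[].
have [rs pE] := closed_field_poly_normal (char_poly A).
rewrite (monicP (char_poly_monic A)) scale1r in pE.
have H (s : seq F) (v : 'rV_n.+1) : foldl (fun u r => u *m A - r *: u) v s
    = v *m horner_mx A (\prod_(z <- s) ('X - z%:P)).
  elim: s v => [|r s IHs] v; first by rewrite big_nil rmorph1 mulmx1.
  rewrite /= IHs big_cons rmorphM rmorphB /= horner_mx_X horner_mx_C.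
  by rewrite -mul_mx_scalar -mulmxBr -mulmxA mulmxE.
by exists rs => v; rewrite H -pE Cayley_Hamilton mulmx0.
Qed.

(** Commuting matrices are simultaneously triangular in some basis; [d] and [b]
    are the two diagonals. *)
Lemma tr_commuting n (A B : 'M[F]_n) : A *m B = B *m A ->
  exists d b : 'I_n -> F,
    [/\ forall k, \tr (iter k (mulmx A) 1%:M) = \sum_i d i ^+ k,
        forall k, iter k (mulmx A) 1%:M = 0 -> forall i, d i ^+ k = 0
      & \tr (A *m B) = \sum_i d i * b i].
Proof.
move=> AB; have [P Pu /andP[]] := cotrigonalization2 AB.
have {}Pu := unitarymx_unit Pu.
rewrite /mxred.similar_to !mxred.conjumx // => SA SB.
set S := P *m A *m _ in SA; set T := P *m B *m _ in SB.
have diagM (C D : 'M[F]_n) : is_trig_mx C -> is_trig_mx D ->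
    (is_trig_mx (C *m D)) /\ (forall i, (C *m D) i i = C i i * D i i).
  move=> /is_trig_mxP tC /is_trig_mxP tD; split.
    apply/is_trig_mxP => i j ltij; rewrite mxE big1 // => k _.
    have [/tC->|lek] := ltnP i k; first by rewrite mul0r.
    by rewrite tD ?mulr0 //; apply: leq_ltn_trans ltij.
  move=> i; rewrite mxE (bigD1 i) //= big1 ?addr0 // => k nki.
  have [/tC->|lek] := ltnP i k; first by rewrite mul0r.
  by rewrite tD ?mulr0 // ltn_neqAle; apply/andP.
have trP C : \tr (P *m C *m invmx P) = \tr C.
  by rewrite mxtrace_mulC mulmxA mulVmx // mul1mx.
have powE k : P *m iter k (mulmx A) 1%:M *m invmx P = iter k (mulmx S) 1%:M.
  elim: k => [|k IHk] /=; first by rewrite mulmx1 mulmxV.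
  by rewrite -IHk /S !mulmxA mulmxKV.
have powD k : is_trig_mx (iter k (mulmx S) 1%:M) /\
    (forall i, (iter k (mulmx S) 1%:M) i i = S i i ^+ k).
  elim: k => [|k [tk dk]] /=.
    split=> [|i]; last by rewrite mxE eqxx expr0.
    by apply/is_trig_mxP => i j ltij; rewrite mxE -val_eqE /= (ltn_eqF ltij).
  have [tS dS] := diagM _ _ SA tk; split=> // i.
  by rewrite dS dk exprS.
exists (fun i => S i i), (fun i => T i i); split=> [k|k Ak i|].
- by rewrite -trP powE; apply: eq_bigr => i _; case: (powD k).
- by case: (powD k) => _ <-; rewrite -powE Ak mulmx0 mul0mx mxE.
rewrite -trP.
have -> : P *m (A *m B) *m invmx P = S *m T by rewrite /S /T !mulmxA mulmxKV.
by apply: eq_bigr => i _; case: (diagM _ _ SA SB).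
Qed.

(** Power sums detect zero in characteristic zero: apply the hypothesis to a
    polynomial without constant term that isolates one of the values. *)
Lemma power_sums0 n (d : 'I_n -> F) :
  (forall k, \sum_i d i ^+ k.+1 = 0) -> forall i, d i = 0.
Proof.
move=> sum0 i0; apply/eqP; apply/negPn/negP => nz.
pose p := 'X * \prod_(i | d i != d i0) ('X - (d i)%:P).
have p_sum0 (q : {poly F}) : \sum_i ('X * q).[d i] = 0.
  under eq_bigr => i _ do rewrite hornerM hornerX horner_coef mulr_sumr.
  rewrite exchange_big big1 // => k _ /=.
  under eq_bigr => i _ do rewrite mulrCA -exprS.
  by rewrite -mulr_sumr sum0 mulr0.
have pE i : p.[d i] = if d i == d i0 then p.[d i0] else 0.
  case: eqP => [->//|/eqP ni].
  by rewrite /p hornerM horner_prod (bigD1 i) //= hornerXsubC subrr mul0r mulr0.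
have := p_sum0 (\prod_(i | d i != d i0) ('X - (d i)%:P)); rewrite -/p.
under eq_bigr => i _ do rewrite pE.
rewrite -big_mkcond /= sumr_const => /eqP.
rewrite mulrn_eq0 => /orP[/eqP/card0_eq/(_ i0) e|]; first by move: e;
  rewrite -[LHS]/(d i0 == d i0) eqxx inE.
rewrite /p hornerM hornerX mulf_eq0 (negPf nz) /= horner_prod.
apply/negP/prodf_neq0 => i ni; rewrite !hornerE subr_eq0 eq_sym //.
Qed.

Variable vT : vectType F.
Implicit Types (U W T N : {vspace vT}) (f g : 'End(vT)) (x y : vT) (a : F).

Lemma split_annihilator f :
  exists rs : seq F, forall x, foldl (fun y r => shift f r y) x rs = 0.
Proof.
pose e := vbasis {:vT}; have e_basis : basis_of {:vT} e by exact: vbasisP.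
have [rs rsP] := split_annihilator_mx (mxof e e f).
exists rs => x; apply/eqP; rewrite -(rVof_eq0 e_basis).
suff -> : rVof e (foldl (fun y r => shift f r y) x rs)
    = foldl (fun u r => u *m mxof e e f - r *: u) (rVof e x) rs by rewrite rsP.
elim: rs {rsP} x => //= r rs IHrs x.
by rewrite IHrs shiftE linearB linearZ /= mul_mxof rVofK.
Qed.

(** Induction on a product of shifts [f - r] killing [x]: decompose [(f - r) x],
    and solve for the components whose eigenvalue is not [r]. What is left of [x]
    is a generalised eigenvector for [r].  Everything stays in [N]. *)
Lemma geig_decomp f N x : (forall y, y \in N -> f y \in N) -> x \in N ->
  exists2 s : seq vT, (forall y, y \in s -> y \in N /\ exists a, geig f a y)
    & x = \sum_(y <- s) y.
Proof.
move=> sN xN; have [rs] := split_annihilator f; move/(_ x).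
elim: rs x xN => [|r rs IHrs] x xN /=.
  by move->; exists [::]; rewrite ?big_nil.
move/(IHrs _ (shift_stable r sN xN)) => [s sP sE].
have [t tP [e [eN ge teE]]] : exists2 t : seq vT,
    (forall y, y \in t -> y \in N /\ exists a, geig f a y)
    & exists e, [/\ e \in N, geig f r e & shift f r (\sum_(y <- t) y) + e = \sum_(y <- s) y].
  elim: s {sE} sP => [|z s IHs] sP.
    exists [::] => //; exists 0; rewrite !big_nil linear0 addr0; split=> //.
      exact: mem0v.
    exact: geig0.
  have [y ys|t tP [e [eN ge teE]]] := IHs; first by apply: sP; rewrite inE ys orbT.
  have [zN [a ga]] := sP z (mem_head _ _).
  have [ar|nar] := eqVneq a r.
    exists t => //; exists (z + e); rewrite big_cons -teE addrCA; split=> //.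
      exact: rpredD.
    by apply: geigD => //; rewrite -ar.
  have [y [yN gy yE]] := geig_solve sN nar zN ga.
  exists (y :: t) => [w /predU1P[->|/tP //]|]; first by split=> //; exists a.
  by exists e; rewrite !big_cons linearD /= yE -addrA teE.
exists (x - \sum_(y <- t) y :: t) => [w /predU1P[->|/tP //]|]; last by rewrite big_cons subrK.
split.
  by rewrite rpredB // big_seq rpred_sum // => y /tP[].
exists r; case: ge => k ek; exists k.+1; rewrite lfpowSr.
by rewrite linearB /= sE -teE [_ + e]addrC addrK.
Qed.

(** An eigenspace of the first operator is stable under the others. *)
Lemma joint_eigenvector (fs : seq 'End(vT)) N x :
  (forall f, f \in fs -> forall y, y \in N -> f y \in N) ->
  (forall f g, f \in fs -> g \in fs -> forall y, f (g y) = g (f y)) ->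
  x \in N -> x != 0 ->
  exists y, [/\ y \in N, y != 0 & forall f, f \in fs -> exists a, f y = a *: y].
Proof.
elim: fs N x => [|f fs IHfs] N x sN comm xN xn0; first by exists x.
have [a [y [yN yn0 fy]]] : exists a y, [/\ y \in N, y != 0 & f y = a *: y].
  have sf := sN f (mem_head _ _).
  have [s sP xE] := geig_decomp sf xN.
  have /hasP[z zs zn0] : has (fun z => z != 0) s.
    apply: contraNT xn0 => /hasPn s0; rewrite xE big_seq big1 // => z /s0.
    by rewrite negbK => /eqP.
  have [zN [a ga]] := sP z zs.
  have [|k [kn0 k0]] := @geig_last F vT f a 0%VS z ga; first by rewrite memv0.
  exists a, (lfpow (shift f a) k z); split.
  - by apply: lfpow_stable => //; apply: shift_stable.
  - by rewrite -memv0.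
  by move: k0; rewrite memv0 shiftE subr_eq0 => /eqP.
have [||||z [zN zn0 zP]] := IHfs (N :&: leigenspace f a)%VS y.
- move=> g gfs z; rewrite !memv_cap => /andP[zN]; rewrite !memv_ker !lfun_simp => fz.
  rewrite sN ?inE ?gfs ?orbT //= comm ?inE ?gfs ?eqxx ?orbT //.
  by move: fz; rewrite !subr_eq0 => /eqP->; rewrite linearZ.
- by move=> g h gfs hfs; apply: comm; rewrite inE ?gfs ?hfs orbT.
- by rewrite memv_cap yN memv_ker !lfun_simp fy subrr eqxx.
- by [].
move: zN; rewrite memv_cap memv_ker !lfun_simp subr_eq0 => /andP[zN /eqP fz].
by exists z; split=> // g /predU1P[->|/zP //]; exists a.
Qed.

(** Each operator preserves the eigenspaces of the previous ones, so the
    decompositions can be refined one operator at a time. *)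
Lemma joint_decomp (fs : seq 'End(vT)) N x :
  (forall f, f \in fs -> forall y, y \in N -> f y \in N) ->
  (forall f g, f \in fs -> g \in fs -> forall y, f (g y) = g (f y)) ->
  (forall f a y, f \in fs -> geig f a y -> f y = a *: y) -> x \in N ->
  exists2 s : seq vT,
    (forall y, y \in s -> y \in N /\ forall f, f \in fs -> exists a, f y = a *: y)
    & x = \sum_(y <- s) y.
Proof.
elim: fs N x => [|f fs IHfs] N x sN comm ss xN.
  by exists [:: x]; rewrite ?big_seq1 // => y; rewrite inE => /eqP->.
have sf := sN f (mem_head _ _).
have [s sP xE] := geig_decomp sf xN.
have {xE} : x = \sum_(y <- s) y by [].
elim: s x {xN} sP => [|z s IHs] x sP ->; first by exists [::].
have [y ys|t tP tE] := IHs _ _ erefl; first by apply: sP; rewrite inE ys orbT.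
have [zN [a /ss fz]] := sP z (mem_head _ _); move/(_ (mem_head _ _)) in fz.
have [||||r rP rE] := IHfs (N :&: leigenspace f a)%VS z.
- move=> g gfs w; rewrite !memv_cap => /andP[wN]; rewrite !memv_ker !lfun_simp => fw.
  rewrite sN ?inE ?gfs ?orbT //= comm ?inE ?gfs ?eqxx ?orbT //.
  by move: fw; rewrite !subr_eq0 => /eqP->; rewrite linearZ.
- by move=> g h gfs hfs; apply: comm; rewrite inE ?gfs ?hfs orbT.
- by move=> g b y gfs; apply: ss; rewrite inE gfs orbT.
- by rewrite memv_cap zN memv_ker !lfun_simp fz subrr eqxx.
exists (r ++ t); last by rewrite big_cons big_cat /= -rE tE.
move=> y; rewrite mem_cat => /orP[/rP[]|/tP //].
rewrite memv_cap memv_ker !lfun_simp subr_eq0 => /andP[yN /eqP fy] yP.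
by split=> // g /predU1P[->|/yP //]; exists a.
Qed.

End ClosedField.

(** * Traces, brackets and the Killing form *)
Section Trace.
Variables (F : fieldType) (vT : vectType F).
Implicit Types (f h : 'End(vT)).

Lemma lfun_traceP a f h : lfun_trace (a *: f + h) = a * lfun_trace f + lfun_trace h.
Proof. by rewrite /lfun_trace linearP linearD linearZ. Qed.

Lemma lfun_trace0 : lfun_trace (0 : 'End(vT)) = 0.
Proof. by rewrite /lfun_trace linear0 mxtrace0. Qed.

Lemma lfun_traceD f h : lfun_trace (f + h) = lfun_trace f + lfun_trace h.
Proof. by rewrite -[f in LHS]scale1r lfun_traceP mul1r. Qed.

Lemma lfun_traceZ a f : lfun_trace (a *: f) = a * lfun_trace f.
Proof. by rewrite -[_ *: _]addr0 lfun_traceP lfun_trace0 addr0. Qed.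

Lemma lfun_traceB f h : lfun_trace (f - h) = lfun_trace f - lfun_trace h.
Proof. by rewrite lfun_traceD -scaleN1r lfun_traceZ mulN1r. Qed.

Lemma lfun_trace_comp f h : lfun_trace (f \o h)%VF = lfun_trace (h \o f)%VF.
Proof.
by rewrite /lfun_trace !(mxof_comp _ _ (vbasisP _)) mxtrace_mulC.
Qed.

Lemma lfun_trace_basis (X : (\dim {:vT}).-tuple vT) f : basis_of fullv X ->
  lfun_trace f = \sum_i coord X i (f (tnth X i)).
Proof.
move=> Xb; pose e := vbasis {:vT}; have eb : basis_of fullv e := vbasisP _.
have fE : mxof e e f = mxof e X \1 *m (mxof X X f *m mxof X e \1).
  by rewrite -!mxof_comp // comp_lfun1l comp_lfun1r.
rewrite /lfun_trace fE mxtrace_mulC -mulmxA -mxof_comp // comp_lfun1l.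
rewrite mxof1 ?(basis_free Xb) // mulmx1; apply: eq_bigr => i _.
by rewrite !mxE /= vecof_delta (tnth_nth 0).
Qed.

End Trace.

Section CommutingTrace.
Variables (F : numClosedFieldType) (vT : vectType F).
Implicit Types (f h : 'End(vT)).

Let e := vbasis {:vT}.
Let e_basis : basis_of fullv e := vbasisP _.

Lemma mxof_lfpow f k : mxof e e (lfpow f k) = iter k (mulmx (mxof e e f)) 1%:M.
Proof.
elim: k => [|k IHk]; first by rewrite mxof1 ?(basis_free e_basis).
have -> : lfpow f k.+1 = (lfpow f k \o f)%VF.
  by apply/lfunP => x; rewrite lfpowSr comp_lfunE.
by rewrite (mxof_comp _ _ e_basis) IHk.
Qed.

Lemma lfun_trace_commuting f h : (forall x, f (h x) = h (f x)) ->
  exists d b : 'I_(\dim {:vT}) -> F,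
    [/\ forall k, lfun_trace (lfpow f k) = \sum_i d i ^+ k,
        forall k, lfpow f k = 0 -> forall i, d i ^+ k = 0
      & lfun_trace (f \o h)%VF = \sum_i d i * b i].
Proof.
move=> fh; have [|d [b [d1 d2 d3]]] := @tr_commuting F _ (mxof e e h) (mxof e e f).
  rewrite -!(mxof_comp _ _ e_basis); congr (mxof _ _ _).
  by apply/lfunP => x; rewrite !comp_lfunE.
have [|{d1 d2 d3}d [{}b [d1 d2 d3]]] := @tr_commuting F _ (mxof e e f) (mxof e e h).
  rewrite -!(mxof_comp _ _ e_basis); congr (mxof _ _ _).
  by apply/lfunP => x; rewrite !comp_lfunE.
exists d, b; split=> [k|k fk0 i|].
- by rewrite -d1 /lfun_trace mxof_lfpow.
- by apply: d2; rewrite -mxof_lfpow fk0 linear0.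
by rewrite lfun_trace_comp /lfun_trace (mxof_comp _ _ e_basis).
Qed.

(** In a common triangular form the nilpotent factor has zero diagonal. *)
Lemma lfun_trace_nilp f h k : (forall x, f (h x) = h (f x)) ->
  (forall x, lfpow f k x = 0) -> lfun_trace (f \o h)%VF = 0.
Proof.
move=> /lfun_trace_commuting[d [b [_ d0 ->]]] fk0.
have fk : lfpow f k = 0 by apply/lfunP => x; rewrite fk0 lfunE.
rewrite big1 // => i _; have /eqP := d0 k fk i.
by rewrite expf_eq0 => /andP[_ /eqP->]; rewrite mul0r.
Qed.

Lemma lfun_trace_powers0 f h : (forall x, f (h x) = h (f x)) ->
  (forall k, lfun_trace (lfpow f k.+1) = 0) -> lfun_trace (f \o h)%VF = 0.
Proof.
move=> /lfun_trace_commuting[d [b [dk _ ->]]] fk0.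
by rewrite big1 // => i _; rewrite (power_sums0 (d := d)) ?mul0r // => k; rewrite -dk.
Qed.

End CommutingTrace.

Section Bracket.
Variables (F : fieldType) (g : lieAlgType F).
Implicit Types (x y z : g) (a : F).

Lemma bracketDl x y z : bracket (x + y) z = bracket x z + bracket y z.
Proof. by have := bracket_linearl z 1 x y; rewrite !scale1r. Qed.

Lemma bracketDr x y z : bracket x (y + z) = bracket x y + bracket x z.
Proof. by rewrite linearD. Qed.

Lemma bracket0l x : bracket 0 x = 0.
Proof. by apply: (addrI (bracket 0 x)); rewrite -bracketDl !addr0. Qed.

Lemma bracket0r x : bracket x 0 = 0.
Proof. by rewrite linear0. Qed.

Lemma bracketZl a x y : bracket (a *: x) y = a *: bracket x y.
Proof. by have := bracket_linearl y a x 0; rewrite !addr0 bracket0l addr0. Qed.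

Lemma bracketZr a x y : bracket x (a *: y) = a *: bracket x y.
Proof. by rewrite linearZ. Qed.

Lemma bracketNl x y : bracket (- x) y = - bracket x y.
Proof. by rewrite -scaleN1r bracketZl scaleN1r. Qed.

Lemma bracketNr x y : bracket x (- y) = - bracket x y.
Proof. by rewrite -scaleN1r bracketZr scaleN1r. Qed.

Lemma bracketBl x y z : bracket (x - y) z = bracket x z - bracket y z.
Proof. by rewrite bracketDl bracketNl. Qed.

Lemma bracketBr x y z : bracket x (y - z) = bracket x y - bracket x z.
Proof. by rewrite bracketDr bracketNr. Qed.

Lemma bracket_suml (I : Type) (r : seq I) (P : pred I) (x : I -> g) y :
  bracket (\sum_(i <- r | P i) x i) y = \sum_(i <- r | P i) bracket (x i) y.
Proof.
by apply: (big_morph (fun x => bracket x y)) => [u v|]; rewrite ?bracketDl ?bracket0l.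
Qed.

Lemma bracket_sumr (I : Type) (r : seq I) (P : pred I) (x : I -> g) y :
  bracket y (\sum_(i <- r | P i) x i) = \sum_(i <- r | P i) bracket y (x i).
Proof. by rewrite linear_sum. Qed.

Lemma bracket_der x y z :
  bracket x (bracket y z) = bracket (bracket x y) z + bracket y (bracket x z).
Proof.
have := ad_bracket x y z; rewrite !ad_lfunE => ->.
by rewrite subrK.
Qed.

Lemma mem_bracketv (U W : {vspace g}) x y : x \in U -> y \in W -> bracket x y \in bracketv U W.
Proof.
move=> xU yW; rewrite (coord_vbasis xU) (coord_vbasis yW) bracket_suml.
apply: rpred_sum => i _; rewrite bracketZl rpredZ // bracket_sumr.
apply: rpred_sum => j _; rewrite bracketZr rpredZ // memv_span //.
by apply: allpairs_f; apply: mem_nth; rewrite size_tuple.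
Qed.

Lemma bracketv_sub (U W T : {vspace g}) :
  (forall x y, x \in U -> y \in W -> bracket x y \in T) -> (bracketv U W <= T)%VS.
Proof.
move=> sT; apply/span_subvP => _ /allpairsP[[x y] /= [xU yW ->]].
by apply: sT; apply: vbasis_mem.
Qed.

Definition ad x : 'End(g) := ad_lfun g x.

Lemma adE x y : ad x y = bracket x y.
Proof. exact: ad_lfunE. Qed.

Lemma killing_trace x y : killing x y = lfun_trace (ad x \o ad y)%VF.
Proof. by []. Qed.

Lemma killingC x y : killing x y = killing y x.
Proof. exact: lfun_trace_comp. Qed.

Lemma killingDl x y z : killing (x + y) z = killing x z + killing y z.
Proof.
rewrite !killing_trace -lfun_traceD; congr lfun_trace; apply/lfunP => w.
by rewrite !(add_lfunE, comp_lfunE) !adE bracketDl.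
Qed.

Lemma killingZl a x y : killing (a *: x) y = a * killing x y.
Proof.
rewrite !killing_trace -lfun_traceZ; congr lfun_trace; apply/lfunP => w.
by rewrite !(scale_lfunE, comp_lfunE) !adE bracketZl.
Qed.

Lemma killingDr x y z : killing x (y + z) = killing x y + killing x z.
Proof. by rewrite killingC killingDl !(killingC x). Qed.

Lemma killingZr a x y : killing x (a *: y) = a * killing x y.
Proof. by rewrite killingC killingZl killingC. Qed.

Lemma killing0l x : killing 0 x = 0.
Proof. by rewrite -(scale0r (0 : g)) killingZl mul0r. Qed.

Lemma killing0r x : killing x 0 = 0.
Proof. by rewrite killingC killing0l. Qed.

Lemma killing_suml (I : Type) (r : seq I) (P : pred I) (x : I -> g) y :
  killing (\sum_(i <- r | P i) x i) y = \sum_(i <- r | P i) killing (x i) y.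
Proof.
by apply: (big_morph (fun x => killing x y)) => [u v|]; rewrite ?killingDl ?killing0l.
Qed.

Lemma killing_sumr (I : Type) (r : seq I) (P : pred I) (x : I -> g) y :
  killing y (\sum_(i <- r | P i) x i) = \sum_(i <- r | P i) killing y (x i).
Proof.
by rewrite killingC killing_suml; apply: eq_bigr => i _; rewrite killingC.
Qed.

(** Invariance is needed for operators [f] other than [ad x]: powers of [ad z]
    for the commutativity of [H], and derivations for their innerness. *)
Lemma trace_ad_inv (f : 'End(g)) y z :
  lfun_trace (f \o ad (bracket y z))%VF
  = lfun_trace ((f \o ad y) \o ad z)%VF - lfun_trace ((ad y \o f) \o ad z)%VF.
Proof.
have -> : (f \o ad (bracket y z))%VF = (f \o ad y \o ad z)%VF - ((f \o ad z) \o ad y)%VF.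
  apply/lfunP => w; rewrite !(add_lfunE, opp_lfunE, comp_lfunE) !adE -linearB; congr (f _).
  by have := ad_bracket y z w; rewrite !ad_lfunE.
by rewrite lfun_traceB [lfun_trace (_ \o ad y)%VF]lfun_trace_comp comp_lfunA.
Qed.

Lemma killing_inv x y z : killing (bracket x y) z = killing x (bracket y z).
Proof.
rewrite [RHS]trace_ad_inv -lfun_traceB killing_trace; congr lfun_trace.
apply/lfunP => w; rewrite !(add_lfunE, opp_lfunE, comp_lfunE) !adE.
by have := ad_bracket x y (bracket z w); rewrite !ad_lfunE.
Qed.

End Bracket.

(** * The Killing form on a Cartan subalgebra *)
Section CartanForm.
Variables (F : numClosedFieldType) (g : lieAlgType F) (H : {vspace g}).
Variables (l : nat) (Pi fw : l.-tuple 'Hom(subvs_of H, F^o)).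
Hypotheses (Pi_basis : basis_of fullv Pi) (fw_fund : fundamental_weights Pi fw).
Local Notation dual := 'Hom(subvs_of H, F^o).
Implicit Types (alpha beta mu : dual) (s t : subvs_of H).

Lemma weight_formC alpha beta : weight_form alpha beta = weight_form beta alpha.
Proof. exact: killingC. Qed.

Lemma weight_formDl alpha beta mu :
  weight_form (alpha + beta) mu = weight_form alpha mu + weight_form beta mu.
Proof. by rewrite /weight_form !linearD /= killingDl. Qed.

Lemma weight_formZl a alpha mu : weight_form (a *: alpha) mu = a * weight_form alpha mu.
Proof. by rewrite /weight_form !linearZ /= killingZl. Qed.

Lemma weight_formDr alpha beta mu :
  weight_form mu (alpha + beta) = weight_form mu alpha + weight_form mu beta.
Proof. by rewrite weight_formC weight_formDl !(weight_formC mu). Qed.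

Lemma weight_form0l mu : weight_form 0 mu = 0.
Proof. by rewrite -(scale0r 0) weight_formZl mul0r. Qed.

Lemma weight_form_suml (I : Type) (r : seq I) (P : pred I) (b : I -> dual) mu :
  weight_form (\sum_(i <- r | P i) b i) mu = \sum_(i <- r | P i) weight_form (b i) mu.
Proof.
by apply: (big_morph (fun x => weight_form x mu)) => [u v|];
  rewrite ?weight_formDl ?weight_form0l.
Qed.

Lemma weight_form_simple_neq0 i : weight_form (tnth Pi i) (tnth Pi i) != 0.
Proof.
have := fw_fund i i; rewrite /pairing eqxx; case: eqP => // ->.
by rewrite invr0 mulr0 => /eqP; rewrite eq_sym oner_eq0.
Qed.

Lemma weight_form_fw i j :
  weight_form (tnth fw i) (tnth Pi j)
  = (i == j)%:R * weight_form (tnth Pi j) (tnth Pi j) / 2.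
Proof.
rewrite -fw_fund /pairing divfK ?weight_form_simple_neq0 //.
by rewrite mulrC mulKf // pnatr_eq0.
Qed.

Lemma sum_coord_simple beta : beta = \sum_(i < l) coord Pi i beta *: tnth Pi i.
Proof.
rewrite {1}(coord_basis Pi_basis (memvf beta)).
by apply: eq_bigr => i _; rewrite (tnth_nth 0).
Qed.

(** The existence of fundamental weights forces the Killing form to be
    nondegenerate on [H]: it makes the form on the dual nondegenerate. *)
Lemma weight_form_nondeg alpha : (forall beta, weight_form alpha beta = 0) -> alpha = 0.
Proof.
move=> a0; rewrite (sum_coord_simple alpha) big1 // => j _.
have := a0 (tnth fw j); rewrite {1}(sum_coord_simple alpha) weight_form_suml.
rewrite (bigD1 j) //= big1 ?addr0 => [|i nij]; last first.
  by rewrite weight_formZl weight_formC weight_form_fw eq_sym (negPf nij) !mul0r mulr0.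
rewrite weight_formZl weight_formC weight_form_fw eqxx mul1r => /eqP.
rewrite !mulf_eq0 invr_eq0 pnatr_eq0 (negPf (weight_form_simple_neq0 j)) !orbF => /eqP e.
by rewrite e scale0r.
Qed.

Lemma dim_dual : \dim {:dual} = \dim {:subvs_of H}.
Proof. by rewrite !dimvf /= /dim /= muln1. Qed.

Lemma killing_sharp_inj alpha : killing_sharp H alpha = 0 -> alpha = 0.
Proof.
move=> a0; apply: weight_form_nondeg => beta.
by rewrite /weight_form a0 linear0 killing0l.
Qed.

Lemma limg_killing_sharp : limg (killing_sharp H) = fullv.
Proof.
apply/eqP; rewrite eqEdim subvf /= -dim_dual -(limg_ker_dim (killing_sharp H) fullv).
rewrite (_ : (fullv :&: _)%VS = 0%VS) ?dimv0 //.
apply/eqP; rewrite -subv0; apply/subvP => alpha;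
  rewrite memv_cap memv_ker memv0 => /andP[_ /eqP].
by move/killing_sharp_inj->.
Qed.

Lemma killing_sharp_surj s : exists alpha, s = killing_sharp H alpha.
Proof. by have := memvf s; rewrite -limg_killing_sharp => /memv_imgP[alpha _ ->];
  exists alpha. Qed.

Lemma killing_H_nondeg s :
  (forall t, killing (vsval s) (vsval t) = 0) -> s = 0.
Proof.
have [alpha ->] := killing_sharp_surj s => s0.
by rewrite (@weight_form_nondeg alpha) ?linear0 // => beta; apply: s0.
Qed.

Lemma killing_sharpE alpha s : killing (vsval (killing_sharp H alpha)) (vsval s) = alpha s.
Proof.
rewrite -killing_flatE /killing_sharp limg_lfunVK //.
suff -> : limg (killing_flat H) = fullv by rewrite memvf.
apply/eqP; rewrite eqEdim subvf /= dim_dual -(limg_ker_dim (killing_flat H) fullv).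
rewrite (_ : (fullv :&: _)%VS = 0%VS) ?dimv0 //.
apply/eqP; rewrite -subv0; apply/subvP => t;
  rewrite memv_cap memv_ker memv0 => /andP[_ /eqP t0].
by apply/eqP/killing_H_nondeg => t'; rewrite -killing_flatE t0 lfunE.
Qed.

Lemma weight_formE alpha beta : weight_form alpha beta = alpha (killing_sharp H beta).
Proof. by rewrite -killing_sharpE. Qed.

End CartanForm.

Section Abelian.
Variables (F : numClosedFieldType) (g : lieAlgType F) (H : {vspace g}).
Hypotheses (H_cartan : cartan_subalgebra H)
  (killing_H : forall s : subvs_of H, (forall t : subvs_of H,
    killing (vsval s) (vsval t) = 0) -> s = 0).

Lemma ad_comm (x y : g) : bracket x y = 0 -> forall z, ad x (ad y z) = ad y (ad x z).
Proof. by move=> xy z; rewrite !adE bracket_der xy bracket0l add0r. Qed.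

(** The last nonzero term of the lower central series of [H] would be central
    in [H] and lie in [bracketv H H], so all powers of its adjoint action would
    be traceless; it would then be orthogonal to [H]. *)
Lemma cartan_abelian (x y : g) : x \in H -> y \in H -> bracket x y = 0.
Proof.
have [Hsub [n Hn] _] := H_cartan.
suff HH0 : bracketv H H = 0%VS.
  by move=> xH yH; apply/eqP; rewrite -memv0 -HH0 mem_bracketv.
apply/eqP/negPn/negP => HHn0.
pose C k := iter k (bracketv H) H.
have C0 k : C k = 0%VS -> C k.+1 = 0%VS.
  rewrite /C iterS => ->; apply/eqP; rewrite -subv0; apply: bracketv_sub => u v _.
  by rewrite memv0 => /eqP->; rewrite bracket0r mem0v.
have [m Cm Cm1] : exists2 m, C m.+1 != 0%VS & C m.+2 = 0%VS.
  have : C n.+2 = 0%VS by exact: (C0 _ (C0 _ Hn)).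
  elim: (n.+1) => [|k IHk] Ck; first by exists 0%N; rewrite ?Ck //; move: HHn0;
    rewrite -[bracketv H H]/(C 1%N) Ck eqxx.
  by have [/IHk //|] := eqVneq (C k.+1) 0%VS; exists k.
have CH k : (C k <= H)%VS.
  elim: k => [|k IHk]; first exact: subvv.
  apply: bracketv_sub => u v uH vC; apply: (subvP Hsub); apply: mem_bracketv => //.
  exact: (subvP IHk).
have [z zC zn0] : exists2 z, z \in C m.+1 & z != 0.
  have /subvPn[z zC] : ~~ (C m.+1 <= 0)%VS by rewrite subv0.
  by rewrite memv0 => zn0; exists z.
have zH : z \in H by apply: (subvP (CH _)) zC.
have zc h : h \in H -> bracket z h = 0.
  move=> hH; apply/eqP; rewrite bracketC oppr_eq0 -memv0 -Cm1.
  exact: mem_bracketv.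
have zHH : z \in bracketv H H.
  apply: (subvP _ _ zC); apply: bracketv_sub => u v uH vC; apply: mem_bracketv => //.
  exact: (subvP (CH m)).
have trz k : lfun_trace (lfpow (ad z) k.+1) = 0.
  have -> : lfpow (ad z) k.+1 = (lfpow (ad z) k \o ad z)%VF.
    by apply/lfunP => w; rewrite lfpowSr comp_lfunE.
  have tr_lin w : w \in bracketv H H -> lfun_trace (lfpow (ad z) k \o ad w)%VF = 0.
    rewrite /bracketv; set s := (X in <<X>>%VS).
    rewrite -[s]/(tval (in_tuple s)) => /coord_span ->.
    have trs (u v : g) a : lfun_trace (lfpow (ad z) k \o ad (a *: u + v))%VF
        = a * lfun_trace (lfpow (ad z) k \o ad u)%VF + lfun_trace (lfpow (ad z) k \o ad v)%VF.
      rewrite -lfun_traceP; congr lfun_trace; apply/lfunP => r.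
      by rewrite !(add_lfunE, scale_lfunE, comp_lfunE) !adE bracketDl bracketZl linearP.
    elim/big_rec: _ => [|i u _ IH].
      rewrite (_ : (_ \o _)%VF = 0) ?lfun_trace0 //; apply/lfunP => r.
      by rewrite comp_lfunE lfunE adE bracket0l linear0.
    rewrite trs IH addr0.
    have : s`_i \in s by apply: mem_nth.
    case/allpairsP => -[u' v'] /= [/vbasis_mem uH /vbasis_mem vH ->].
    rewrite trace_ad_inv.
    have -> : (lfpow (ad z) k \o ad u')%VF = (ad u' \o lfpow (ad z) k)%VF.
      by apply/lfunP => r; rewrite !comp_lfunE lfpow_comm //; apply/ad_comm/zc.
    by rewrite subrr mulr0.
  exact: tr_lin.
have z0 : vsproj H z = 0.
  apply: killing_H => t; rewrite vsprojK // killing_trace.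
  by apply: lfun_trace_powers0 => //; apply/ad_comm/zc/subvsP.
by move: zn0; rewrite -(vsprojK zH) z0 linear0 eqxx.
Qed.

End Abelian.

Lemma linfun_linear (F : fieldType) (U V : vectType F) (f : U -> V) :
  linear f -> linfun f =1 f.
Proof.
move=> f_lin; pose f' := HB.pack_for {linear U -> V} f
  (GRing.isLinear.Build F U V *:%R f f_lin).
exact: (lfunE f').
Qed.

Lemma eq_lfun_basis (F : fieldType) (U V : vectType F) n (X : n.-tuple U) (f h : 'Hom(U, V)) :
  basis_of fullv X -> (forall i, f (tnth X i) = h (tnth X i)) -> f = h.
Proof.
move=> Xb fh; apply/lfunP => x; rewrite (coord_basis Xb (memvf x)) !linear_sum.
by apply: eq_bigr => i _; rewrite !linearZ /=; have := fh i; rewrite (tnth_nth 0) => ->.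
Qed.

Lemma memv_bigcap (F : fieldType) (vT : vectType F) (I : Type) (r : seq I)
    (U : I -> {vspace vT}) v :
  (v \in (\bigcap_(i <- r) U i)%VS) = all (fun i => v \in U i) r.
Proof. by elim: r => [|i r IHr]; rewrite ?big_nil ?memvf // big_cons memv_cap IHr. Qed.

(** * Heights of roots *)
Section GeneralisedEigen.
Variables (F : numClosedFieldType).

(** A power of the shift by [b i] kills the term [y i] and is injective on the
    generalised eigenspace of [a]; so the terms can be removed one by one. *)
Lemma geig_indep (vT : vectType F) (f : 'End(vT)) a x (I : eqType) (s : seq I) (b : I ->
  F) (y : I -> vT) :
  geig f a x -> x = \sum_(i <- s) y i ->
  (forall i, i \in s -> geig f (b i) (y i) /\ b i != a) -> x = 0.
Proof.
elim: s x y => [|i s IHs] x y gx xE sP; first by rewrite xE big_nil.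
have [[k yk] nba] := sP i (mem_head _ _).
have shiftC c d z : shift f c (shift f d z) = shift f d (shift f c z).
  by apply: shift_comm => {}z; rewrite (shift_comm (f := f)).
have g_pow c j z : geig f c z -> geig f c (lfpow (shift f (b i)) j z).
  by move=> gz; elim: j => [|j IHj]; rewrite ?lfpow0 // lfpowS; apply: geig_shift.
have {IHs sP xE}x0 : lfpow (shift f (b i)) k x = 0.
  apply: (IHs _ (fun j => lfpow (shift f (b i)) k (y j))); first exact: g_pow.
    by rewrite xE linear_sum big_cons /= yk add0r.
  move=> j js; have [|gj nj] := sP j; first by rewrite inE js orbT.
  by split=> //; apply: g_pow.
elim: k {yk} x0 => [|k IHk]; first by rewrite lfpow0.
rewrite lfpowS shiftE => /eqP; rewrite subr_eq0 => /eqP x0; apply: IHk.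
by apply: (geig_inj _ _ x0); [rewrite eq_sym; exact: nba | exact: g_pow].
Qed.

(** The values [r + k a] are pairwise distinct, and an operator has only finitely
    many generalised eigenvalues.  Applied to strings of vectors moved by a root
    vector, this replaces an explicit count of dimensions. *)
Lemma geig_bounded (vT : vectType F) (f : 'End(vT)) (r a : F) (x : nat -> vT) :
  a != 0 -> (forall k, geig f (r + k%:R * a) (x k)) -> exists k, x k = 0.
Proof.
move=> an0 gx; have [rs rsP] := split_annihilator f.
have [k kP] : exists k : nat, r + k%:R * a \notin rs.
  pose vs := [seq r + k%:R * a | k <- iota 0 (size rs).+1].
  have uvs : uniq vs.
    rewrite map_inj_uniq ?iota_uniq // => j k /addrI/(mulIf an0)/eqP.
    by rewrite eqr_nat => /eqP.
  have /allPn[_ /mapP[k _ ->] kP] : ~~ all (fun v => v \in rs) vs.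
    apply/negP => /allP sub; have := uniq_leq_size uvs sub.
    by rewrite size_map size_iota ltnn.
  by exists k.
exists k; move: (rsP (x k)) => {rsP}; elim: rs (x k) (gx k) kP => // c rs IHrs z gz /=.
rewrite inE negb_or => /andP[nc nrs] /(IHrs _ (geig_shift c gz) nrs)/eqP.
by rewrite shiftE subr_eq0 => /eqP; exact: geig_inj gz.
Qed.

End GeneralisedEigen.

Section RootHeights.
Variables (F : numClosedFieldType) (g : lieAlgType F) (H : {vspace g}).
Variables (l : nat) (Pi fw : l.-tuple 'Hom(subvs_of H, F^o)).
Hypotheses (Pi_base : root_base Pi) (fw_fund : fundamental_weights Pi fw).
Local Notation dual := 'Hom(subvs_of H, F^o).
Implicit Types (alpha beta mu : dual) (s t : subvs_of H) (x y z : g).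

Let Pi_basis : basis_of fullv Pi. Proof. by case: Pi_base. Qed.

Definition weight_vec alpha x := forall t, bracket (vsval t) x = alpha t *: x.

Lemma weight_vecP alpha x : reflect (weight_vec alpha x) (x \in weight_space (adjoint g) alpha).
Proof.
apply: (iffP (weight_spaceP (V := adjoint g) alpha x)) => xP t; last by rewrite -xP;
  exact: ad_lfunE.
by rewrite -xP; apply: esym; exact: ad_lfunE.
Qed.

Lemma weight_vec_root alpha x : weight_vec alpha x -> x != 0 -> alpha != 0 -> is_root alpha.
Proof.
move=> /weight_vecP xa xn0 an0; rewrite /is_root an0; apply: contra xn0 => /eqP xa0.
by move: xa; rewrite xa0 memv0.
Qed.

Definition height beta : F := \sum_(i < l) coord Pi i beta.

Local Notation ht := height.

Lemma coord_simple i j : coord Pi i (tnth Pi j) = (i == j)%:R.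
Proof. by rewrite (tnth_nth 0) coord_free ?(basis_free Pi_basis) // eq_sym. Qed.

Lemma coord_comb i (k : 'I_l -> nat) : coord Pi i (\sum_(j < l) tnth Pi j *+ k j) = (k i)%:R.
Proof.
rewrite linear_sum (bigD1 i) //= big1 ?addr0 => [|j nji].
  by rewrite linearMn /= coord_simple eqxx.
by rewrite linearMn /= coord_simple eq_sym (negPf nji) mul0rn.
Qed.

Lemma htN beta : ht (- beta) = - ht beta.
Proof. by rewrite /height -sumrN; apply: eq_bigr => i _; rewrite linearN. Qed.

Lemma htD beta mu : ht (beta + mu) = ht beta + ht mu.
Proof. by rewrite /height -big_split; apply: eq_bigr => i _; rewrite linearD. Qed.

Lemma ht_nneg beta : nneg_combination Pi beta -> beta != 0 -> 0 < ht beta.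
Proof.
case=> k bE bn0; rewrite /height bE.
under eq_bigr => i _ do rewrite coord_comb.
rewrite -natr_sum ltr0n lt0n; apply: contra bn0 => /eqP k0.
rewrite bE big1 // => i _; suff -> : k i = 0%N by [].
by apply/eqP; move/eqP: k0; rewrite sum_nat_eq0 => /forallP/(_ i).
Qed.

Lemma ht_root beta : is_root beta -> ht beta != 0.
Proof.
move=> rb; have /andP[bn0 _] := rb; have [_ _ /(_ _ rb)[]] := Pi_base => /ht_nneg.
  by move/(_ bn0); rewrite lt0r => /andP[].
by rewrite oppr_eq0 => /(_ bn0); rewrite htN lt0r oppr_eq0 => /andP[].
Qed.

(** Grading by this element separates [H] from the roots. Through the form on
    the dual it is represented by a combination of the fundamental weights. *)
Lemma height_element : exists h0 : subvs_of H, forall beta, beta h0 = ht beta.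
Proof.
exists (killing_sharp H (\sum_j (2 / weight_form (tnth Pi j) (tnth Pi j)) *: tnth fw j)).
move=> beta; rewrite -(weight_formE Pi_basis fw_fund) weight_formC weight_form_suml.
rewrite /height [in LHS](sum_coord_simple Pi_basis beta).
under eq_bigr => j _ do rewrite weight_formZl weight_formC weight_form_suml.
apply: eq_bigr => j _; rewrite (bigD1 j) //= big1 ?addr0 => [|i nij]; last first.
  rewrite weight_formZl weight_formC (weight_form_fw fw_fund) eq_sym (negPf nij).
  by rewrite !mul0r mulr0.
rewrite weight_formZl weight_formC (weight_form_fw fw_fund) eqxx mul1r.
have n0 := weight_form_simple_neq0 fw_fund j.
set q := weight_form _ _ in n0 *.
by field; rewrite n0.
Qed.

End RootHeights.

(** * Nondegeneracy of the Killing form *)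
Section KillingFlat.
Variables (F : fieldType) (g : lieAlgType F).
Implicit Types (x y : g).

Definition killing_map : 'Hom(g, 'Hom(g, F^o)) :=
  linfun (fun x : g => (linfun (fun y => @killing F g x y : F^o) : 'Hom(g, F^o))).

Lemma killing_mapE x y : killing_map x y = killing x y.
Proof.
pose k (u v : g) : F^o := @killing F g u v.
have kr u : linear (k u) by move=> a v w; rewrite /k killingDr killingZr.
have kl : linear (fun u => linfun (k u)).
  move=> a u v; apply/lfunP => w.
  by rewrite add_lfunE scale_lfunE !linfun_linear // /k killingDl killingZl.
by rewrite /killing_map (linfun_linear kl) (linfun_linear (kr x)).
Qed.

Definition killing_radical := lker killing_map.

Lemma killing_radicalP x : reflect (forall y, killing x y = 0) (x \in killing_radical).
Proof.
apply: (iffP idP) => [|x0]; rewrite memv_ker.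
  by move=> /eqP x0 y; rewrite -killing_mapE x0 lfunE.
by apply/eqP/lfunP => y; rewrite killing_mapE x0 lfunE.
Qed.

Lemma killing_radical_ideal x y : y \in killing_radical -> bracket x y \in killing_radical.
Proof.
move=> /killing_radicalP y0; apply/killing_radicalP => z.
by rewrite bracketC -scaleN1r killingZl killing_inv y0 mulr0.
Qed.

End KillingFlat.

Section GeigBracket.
Variables (F : fieldType) (g : lieAlgType F).
Implicit Types (x y h : g).

(** The Leibniz rule for [ad h - (a + b)], by induction on the two exponents. *)
Lemma geig_bracket h a b x y : geig (ad h) a x -> geig (ad h) b y ->
  geig (ad h) (a + b) (bracket x y).
Proof.
case=> j xj [k yk].
have [n] := ubnP (j + k); elim: n j k x y xj yk => // n IHn [|j] k x y.
  by rewrite lfpow0 => ->; rewrite bracket0l; move=> *; apply: geig0.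
case: k => [|k]; first by rewrite lfpow0 => _ -> _; rewrite bracket0r; apply: geig0.
rewrite !lfpowSr => xj yk le_n.
have [i iE] : geig (ad h) (a + b) (shift (ad h) (a + b) (bracket x y)).
  have -> : shift (ad h) (a + b) (bracket x y)
      = bracket (shift (ad h) a x) y + bracket x (shift (ad h) b y).
    rewrite !shiftE !adE bracket_der bracketBl bracketBr bracketZl bracketZr scalerDl.
    by rewrite opprD addrACA.
  apply: geigD; first by apply: (IHn j k.+1); rewrite ?lfpowSr.
  by apply: (IHn j.+1 k); rewrite ?lfpowSr //; move: le_n; rewrite addnS.
by exists i.+1; rewrite lfpowSr.
Qed.

End GeigBracket.

Section Radical.
Variables (F : numClosedFieldType) (g : lieAlgType F) (H : {vspace g}).
Hypotheses (g_ss : semisimple g) (H_cartan : cartan_subalgebra H).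
Variables (l : nat) (Pi fw : l.-tuple 'Hom(subvs_of H, F^o)).
Hypotheses (Pi_base : root_base Pi) (fw_fund : fundamental_weights Pi fw).
Local Notation dual := 'Hom(subvs_of H, F^o).
Local Notation ht := (height Pi).
Implicit Types (alpha beta mu : dual) (x y z : g).

Let Pi_basis : basis_of fullv Pi. Proof. by case: Pi_base. Qed.
Let killing_H := killing_H_nondeg Pi_basis fw_fund.
Let H_abelian := cartan_abelian H_cartan killing_H.

(** [ad b] moves generalised eigenvalues of [ad h] by the nonzero [a]. *)
Lemma ad_nilpotent h b a x : a != 0 -> geig (ad h) a b -> geig (ad b) 0 x.
Proof.
move=> an0 gb; have [s sP ->] := geig_decomp (f := ad h) (fun y _ => memvf _) (memvf x).
apply: geig_sum => y /sP[_ [r gy]] _.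
have /(geig_bounded an0)[k k0] k :
    geig (ad h) (r + k%:R * a) (lfpow (shift (ad b) 0) k y).
  elim: k => [|k IHk]; first by rewrite lfpow0 mul0r addr0.
  rewrite lfpowS shiftE scale0r subr0 adE -natr1 mulrDl mul1r addrA [_ + a]addrC.
  exact: geig_bracket.
by exists k.
Qed.

Let adH := [seq ad (vsval t) | t <- vbasis {:subvs_of H}].

Lemma adH_comm f h : f \in adH -> h \in adH -> forall y, f (h y) = h (f y).
Proof. by move=> /mapP[s _ ->] /mapP[t _ ->]; apply/ad_comm/H_abelian; apply: subvsP. Qed.

Lemma joint_weight y : (forall f, f \in adH -> exists a, f y = a *: y) ->
  exists alpha : dual, weight_vec alpha y.
Proof.
move=> yP; pose B := vbasis {:subvs_of H}.
have /fin_all_exists[a aP] (i : 'I_(\dim {:subvs_of H})) :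
    exists a : F, bracket (vsval B`_i) y = a *: y.
  have [|a] := yP (ad (vsval B`_i)); last by rewrite adE; exists a.
  by apply/map_f/mem_nth; rewrite size_tuple.
pose alpha : dual := linfun (fun t => \sum_i coord B i t * a i : F^o).
exists alpha => t.
have -> : alpha t = \sum_i coord B i t * a i.
  rewrite /alpha linfun_linear // => c u v; rewrite scaler_sumr -big_split.
  by apply: eq_bigr => i _; rewrite linearP mulrDl -mulrA.
rewrite {1}(coord_vbasis (memvf t)) linear_sum bracket_suml scaler_suml.
by apply: eq_bigr => i _; rewrite linearZ /= bracketZl aP scalerA.
Qed.

Lemma weight_vec0_H y : weight_vec (0 : dual) y -> y \in H.
Proof.
move=> y0; have [_ _] := H_cartan; apply=> z zH.
have := y0 (vsproj H z); rewrite vsprojK // bracketC lfunE /= scale0r => /eqP.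
by rewrite oppr_eq0 => /eqP->; rewrite mem0v.
Qed.

Lemma killing_radical_H x : x \in H -> x \in killing_radical g -> x = 0.
Proof.
move=> xH /killing_radicalP x0.
by rewrite -(vsprojK xH) (killing_H (s := vsproj H x)) ?linear0 // => t; rewrite vsprojK.
Qed.

(** A joint eigenvector of [H] in the height zero part of the radical has weight
    zero, since roots have nonzero height.  So it lies in [H], which is its own
    normaliser, and there the Killing form is nondegenerate. *)
Lemma radical_no_zero_weight (h0 : subvs_of H) x :
  (forall beta, beta h0 = ht beta) -> x \in killing_radical g ->
  geig (ad (vsval h0)) 0 x -> x = 0.
Proof.
move=> h0E xS [k xk]; apply/eqP/negPn/negP => xn0.
pose K := (killing_radical g :&: lker (lfpow (shift (ad (vsval h0)) 0) k))%VS.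
have [|||y [yK yn0 /joint_weight[alpha ya]]] := @joint_eigenvector F g adH K x _ adH_comm.
- move=> _ /mapP[t _ ->] y; rewrite memv_cap [X in _ && X]memv_ker => /andP[yS /eqP y0].
  rewrite memv_cap [X in _ && X]memv_ker adE killing_radical_ideal //= -adE lfpow_comm ?y0
    ?linear0 //.
  by apply/shift_comm/ad_comm/H_abelian; apply: subvsP.
- by rewrite memv_cap xS memv_ker xk eqxx.
- by [].
move: yK; rewrite memv_cap [X in _ && X]memv_ker => /andP[yS /eqP yk].
have [a0|an0] := eqVneq alpha 0.
  by move: yn0; rewrite (killing_radical_H _ yS) ?eqxx // weight_vec0_H // -a0.
have htn0 := ht_root Pi_base (weight_vec_root ya yn0 an0).
move: yn0; rewrite (@geig_inj F g (ad (vsval h0)) 0 (ht alpha) y) ?eqxx //.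
- by rewrite eq_sym.
- by exists k.
- by rewrite adE ya h0E.
Qed.

(** The property that Engel's argument propagates from smaller to larger [T]: it
    is graded by [ad h], closed under brackets, and kills a nonzero vector in each
    of its modules [B / A].  Quantifying over pairs of subspaces of [g] avoids
    quotient modules. *)
Definition engel_sub (h : g) (T : {vspace g}) :=
  [/\ forall x, x \in T -> bracket h x \in T,
      forall x y, x \in T -> y \in T -> bracket x y \in T
    & forall A B : {vspace g},
        (forall t x, t \in T -> x \in A -> bracket t x \in A) ->
        (forall t x, t \in T -> x \in B -> bracket t x \in B) ->
        (A <= B)%VS -> A != B ->
        exists b, [/\ b \in B, b \notin A & forall t, t \in T -> bracket t b \in A]].

(** Engel's theorem for a graded subalgebra [S] without component of degree zero.
    A proper [T] with the property has a homogeneous element [b] in its normaliser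
    but outside [T]; its degree is not zero, so [ad b] is nilpotent, and [T + <b>]
    has the property again. *)
Lemma engel (h : g) (S : {vspace g}) :
  (forall x, x \in S -> bracket h x \in S) ->
  (forall x y, x \in S -> y \in S -> bracket x y \in S) ->
  (forall x, x \in S -> geig (ad h) 0 x -> x = 0) -> engel_sub h S.
Proof.
move=> hS SS S0; apply: (@vspace_grow _ _ (engel_sub h) 0%VS); rewrite ?sub0v //.
  split=> [x|x y|A B _ _ AB nAB]; rewrite ?memv0.
  - by move/eqP->; rewrite bracket0r.
  - by move=> /eqP->; rewrite bracket0l.
  have [b bB bA] := neqv_sub AB nAB; exists b; split=> // t.
  by rewrite memv0 => /eqP->; rewrite bracket0l mem0v.
move=> T [hT TT eT] TS nTS.
have [|b0 [b0S b0T b0P]] := eT T S TT _ TS nTS.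
  by move=> t x /(subvP TS); apply: SS.
(* The normaliser of [T] in [S]. *)
pose N := (S :&: \bigcap_(t <- vbasis T) (ad t @^-1: T))%VS.
have NP x : x \in N -> x \in S /\ forall t, t \in T -> bracket t x \in T.
  rewrite memv_cap memv_bigcap => /andP[xS /allP xT]; split=> // t tT.
  rewrite (coord_vbasis tT) bracket_suml rpred_sum // => i _.
  rewrite bracketZl rpredZ // -adE memv_preim; apply/xT/mem_nth.
  by rewrite size_tuple.
have NI x : x \in S -> (forall t, t \in T -> bracket t x \in T) -> x \in N.
  move=> xS xT; rewrite memv_cap xS memv_bigcap /=; apply/allP => t /vbasis_mem tT.
  by rewrite -memv_preim adE xT.
have hN x : x \in N -> ad h x \in N.
  move=> /NP[xS xT]; apply: NI; rewrite adE ?hS // => t tT.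
  by rewrite bracket_der rpredD ?hT ?xT // bracketC rpredN hT.
have [s sP b0E] := geig_decomp hN (NI _ b0S b0P).
have /allPn[b1 b1s b1T] : ~~ all (fun y => y \in T) s.
  apply: contra b0T => /allP sT; rewrite b0E big_seq rpred_sum // => y; exact: sT.
have [b1N [a gb1]] := sP _ b1s.
have an0 : a != 0.
  apply: contraNneq b1T => a0; rewrite a0 in gb1.
  by rewrite (S0 _ _ gb1) ?mem0v //; case: (NP _ b1N).
have [k []] := geig_last gb1 b1T; set b := lfpow _ _ _ => bT; rewrite shiftE adE => hb.
have bN : b \in N by apply: lfpow_stable b1N; apply: shift_stable.
have gb : geig (ad h) a b.
  by rewrite /b; elim: (k) => [|j IHj]; rewrite ?lfpow0 // lfpowS; apply: geig_shift.
have [bS bTT] := NP _ bN.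
exists (T + <[b]>)%VS; split; rewrite ?addvSl ?addv_line_neq ?subv_add ?TS //.
have addP (P : g -> Prop) : (forall t c, t \in T -> P (t + c *: b)) ->
    forall x, x \in (T + <[b]>)%VS -> P x.
  by move=> PP x /memv_addP[t tT [_ /vlineP[c ->] ->]]; apply: PP.
have memT t c : t \in T -> t + c *: b \in (T + <[b]>)%VS.
  by move=> tT; rewrite memv_add // rpredZ // memv_line.
split.
- apply: (addP _ _) => t c tT; rewrite bracketDr bracketZr.
  rewrite -(subrK (a *: b) (bracket h b)) scalerDr addrA scalerA.
  by apply: memT; rewrite rpredD ?rpredZ ?hT.
- move=> x y; move: x; apply: (addP _ _) => t c tT; move: y; apply: (addP _ _) => t' c' t'T.
  rewrite bracketDl !bracketDr bracketZl !bracketZr bracketZl bracketxx !scaler0 addr0.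
  rewrite (subvP (addvSl _ _)) // !rpredD ?TT ?rpredZ ?bTT //.
  by rewrite bracketC rpredN bTT.
move=> A B TA TB AB nAB.
have TW t : t \in T -> t \in (T + <[b]>)%VS by move=> tT; rewrite (subvP (addvSl _ _)).
have bW : b \in (T + <[b]>)%VS by rewrite (subvP (addvSr _ _)) ?memv_line.
have [||c0 [c0B c0A c0P]] := eT A B _ _ AB nAB.
- by move=> t x /TW; apply: TA.
- by move=> t x /TW; apply: TB.
have [j []] := geig_last (@ad_nilpotent h b a c0 an0 gb) c0A.
set c1 := lfpow _ _ _ => c1A; rewrite shiftE scale0r subr0 adE => bc1.
have [c1B c1P] : c1 \in B /\ forall t, t \in T -> bracket t c1 \in A.
  rewrite /c1; elim: (j) => [|i [iB iA]]; rewrite ?lfpow0 // lfpowS shiftE scale0r subr0 adE.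
  split=> [|t tT]; first by apply: TB.
  rewrite bracket_der rpredD //; first exact/iA/bTT.
  exact: TA bW (iA _ tT).
exists c1; split=> //; apply: (addP _ _) => t c tT.
by rewrite bracketDl bracketZl rpredD ?rpredZ ?(c1P _ tT) ?bc1.
Qed.

(** The radical of the Killing form, if nonzero, has by Engel's argument a nonzero
    centre, which would be an abelian ideal of [g]. *)
Theorem killing_nondegenerate x : (forall y, killing x y = 0) -> x = 0.
Proof.
move=> /killing_radicalP; set S := killing_radical g.
suff -> : S = 0%VS by rewrite memv0 => /eqP.
have Sid u v : v \in S -> bracket u v \in S by apply: killing_radical_ideal.
have [h0 h0E] := height_element Pi_base fw_fund.
have [_ _ eS] : engel_sub (vsval h0) S.
  by apply: engel => *; rewrite ?Sid //; apply: radical_no_zero_weight h0E _ _.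
apply/eqP/negPn/negP => Sn0.
have [||||b [bS]] := eS 0%VS S; rewrite ?sub0v //.
- by move=> t y _; rewrite memv0 => /eqP->; rewrite bracket0r mem0v.
- by move=> t y _ /Sid.
- by rewrite eq_sym.
rewrite memv0 => bn0 bc.
pose Z := (S :&: \bigcap_(t <- vbasis S) lker (ad t))%VS.
have ZP y : y \in Z -> y \in S /\ forall t, t \in S -> bracket t y = 0.
  rewrite memv_cap memv_bigcap => /andP[yS /allP yT]; split=> // t tS.
  rewrite (coord_vbasis tS) bracket_suml big1 // => i _.
  have /yT : (vbasis S)`_i \in vbasis S by apply: mem_nth; rewrite size_tuple.
  by rewrite memv_ker adE bracketZl => /eqP->; rewrite scaler0.
have ZI y : y \in S -> (forall t, t \in S -> bracket t y = 0) -> y \in Z.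
  move=> yS yT; rewrite memv_cap yS memv_bigcap /=; apply/allP => t /vbasis_mem tS.
  by rewrite memv_ker adE yT.
have Z0 : Z = 0%VS.
  apply: g_ss; last first.
    exists 1%N; apply/eqP; rewrite -subv0 /=; apply: bracketv_sub => u v /ZP[uS _] /ZP[_ ->] //.
    exact: mem0v.
  apply: bracketv_sub => u v _ /ZP[vS vT]; apply: ZI; rewrite ?Sid // => t tS.
  by rewrite bracket_der [bracket t v]vT // bracket0r addr0 vT // bracketC rpredN Sid.
move: bn0; rewrite -memv0 -Z0 ZI // => t /bc.
by rewrite memv0 => /eqP.
Qed.

End Radical.

(** * Diagonalisability of a Cartan subalgebra *)
Section Diagonal.
Variables (F : numClosedFieldType) (g : lieAlgType F) (H : {vspace g}).
Hypotheses (H_cartan : cartan_subalgebra H) (H_abelian : forall x y, x \in H -> y \in H ->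
  bracket x y = 0).
Hypothesis killing_nd : forall x : g, (forall y, killing x y = 0) -> x = 0.
Hypothesis killing_H : forall s : subvs_of H, (forall t : subvs_of H,
  killing (vsval s) (vsval t) = 0) -> s = 0.
Implicit Types (x y z : g).

Lemma killing_represents (phi : 'Hom(g, F^o)) : exists y, forall x, killing y x = phi x.
Proof.
have : phi \in limg (killing_map g).
  suff -> : limg (killing_map g) = fullv by rewrite memvf.
  have dE : \dim {:'Hom(g, F^o)} = \dim {:g} by rewrite !dimvf /dim /= muln1.
  apply/eqP; rewrite eqEdim subvf /= dE.
  rewrite -(limg_ker_dim (killing_map g) fullv) (_ : (fullv :&: _)%VS = 0%VS) ?dimv0 //.
  apply/eqP; rewrite -subv0; apply/subvP => x;
    rewrite memv_cap memv0 => /andP[_ /killing_radicalP x0].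
  exact/eqP/killing_nd.
by case/memv_imgP => y _ ->; exists y => x; rewrite killing_mapE.
Qed.

(** For a derivation [E] one has [ad (E x) = [E, ad x]], so invariance gives
    [killing (E x) z = tr (E (ad [x, z])) = 0]. *)
Lemma derivation_trace0 (E : 'End(g)) :
  (forall x y, E (bracket x y) = bracket (E x) y + bracket x (E y)) ->
  (forall x, lfun_trace (E \o ad x)%VF = 0) -> E = 0.
Proof.
move=> derE trE; apply/lfunP => x; rewrite lfunE; apply: killing_nd => z.
have adEx : ad (E x) = (E \o ad x)%VF - (ad x \o E)%VF.
  by apply/lfunP => w; rewrite !(add_lfunE, opp_lfunE, comp_lfunE) !adE derE addrK.
rewrite killing_trace adEx -(trE (bracket x z)) trace_ad_inv -lfun_traceB.
by congr lfun_trace; apply/lfunP => w; rewrite !(add_lfunE, opp_lfunE, comp_lfunE).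
Qed.

(** With a nondegenerate Killing form every derivation [D] is inner: if [y]
    represents the trace functional of [D], then [D - ad y] is a derivation
    whose values are orthogonal to everything. *)
Lemma derivation_inner (D : 'End(g)) :
  (forall x y, D (bracket x y) = bracket (D x) y + bracket x (D y)) ->
  exists y, D = ad y.
Proof.
move=> derD.
pose phi : 'Hom(g, F^o) := linfun (fun x => lfun_trace (D \o ad x)%VF : F^o).
have phiE x : phi x = lfun_trace (D \o ad x)%VF.
  rewrite /phi linfun_linear // => a u v.
  rewrite -[RHS]lfun_traceP; congr lfun_trace; apply/lfunP => w.
  by rewrite !(add_lfunE, scale_lfunE, comp_lfunE) !adE bracketDl bracketZl linearP.
have [y yP] := killing_represents phi; exists y.
apply/eqP; rewrite -subr_eq0; apply/eqP/derivation_trace0 => [x w|x].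
  rewrite !(add_lfunE, opp_lfunE) !adE derD bracket_der bracketBl bracketBr opprD.
  by rewrite addrACA.
rewrite (_ : (_ \o ad x)%VF = (D \o ad x)%VF - (ad y \o ad x)%VF).
  by rewrite lfun_traceB -phiE -yP killing_trace subrr.
by apply/lfunP => w; rewrite !(add_lfunE, opp_lfunE, comp_lfunE).
Qed.

(** The nilpotent part of [ad h] is a derivation, hence [ad y] with [y] in [H]
    orthogonal to [H]; so it vanishes. *)
Lemma ad_semisimple h a x : h \in H -> geig (ad h) a x -> bracket h x = a *: x.
Proof.
move=> hH.
have [Y Yb /fin_all_exists[r rP]] :
    exists2 Y : (\dim {:g}).-tuple g, basis_of fullv Y
      & forall i, exists a, geig (ad h) a (tnth Y i).
  apply: (@span_extract F g (fun y => exists a, geig (ad h) a y)) => z.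
  have [s sP ->] := geig_decomp (f := ad h) (fun y _ => memvf _) (memvf z).
  by exists s => // y /sP[].
(* The nilpotent part of [ad h]: on the generalised eigenspace of [b] it is
   [ad h - b]. *)
pose N : 'End(g) := linfun (fun z => \sum_i coord Y i z *: shift (ad h) (r i) (tnth Y i)).
have NE z : N z = \sum_i coord Y i z *: shift (ad h) (r i) (tnth Y i).
  rewrite /N linfun_linear // => c u v; rewrite scaler_sumr -big_split.
  by apply: eq_bigr => i _; rewrite linearP /= scalerDl scalerA.
have NY b z : geig (ad h) b z -> N z = shift (ad h) b z.
  move=> gz; pose k i := if r i != b then coord Y i z else 0.
  have zE : z = \sum_i coord Y i z *: tnth Y i.
    rewrite {1}(coord_basis Yb (memvf z)).
    by apply: eq_bigr => i _; rewrite (tnth_nth 0).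
  have k0 i : k i = 0.
    (* The components of [z] at the other eigenvalues vanish. *)
    have sum0 : \sum_i k i *: Y`_i = 0.
      have -> : \sum_i k i *: Y`_i = \sum_(i | r i != b) coord Y i z *: tnth Y i.
        rewrite [RHS]big_mkcond; apply: eq_bigr => j _; rewrite /k -tnth_nth.
        by case: eqP; rewrite ?scale0r.
      apply: (@geig_indep F g (ad h) b _ _ [seq i <- index_enum _ | r i != b] r
        (fun i => coord Y i z *: tnth Y i)); last 2 first.
      - by rewrite big_filter.
      - by move=> j; rewrite mem_filter => /andP[-> _]; split=> //; apply/geigZ/rP.
      have -> : \sum_(i | r i != b) coord Y i z *: tnth Y i
          = z - \sum_(i | r i == b) coord Y i z *: tnth Y i.
        apply/esym/eqP; rewrite subr_eq addrC; apply/eqP.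
        by rewrite {1}zE (bigID (fun i => r i == b)).
      apply: geigD => //; rewrite -scaleN1r; apply: geigZ.
      by apply: geig_sum => j _ /eqP <-; apply/geigZ/rP.
    by rewrite -(coord_sum_free k i (basis_free Yb)) sum0 linear0.
  rewrite NE {2}zE linear_sum; apply: eq_bigr => i _; rewrite linearZ /=.
  have [->//|nb] := eqVneq (r i) b.
  by have := k0 i; rewrite /k nb => ->; rewrite !scale0r.
have NgY i : N (tnth Y i) = shift (ad h) (r i) (tnth Y i) by apply: NY.
have Nder y z : N (bracket y z) = bracket (N y) z + bracket y (N z).
  have Nder1 u v b c : geig (ad h) b u -> geig (ad h) c v ->
      N (bracket u v) = bracket (N u) v + bracket u (N v).
    move=> gu gv; rewrite (NY _ _ gu) (NY _ _ gv) (NY _ _ (geig_bracket gu gv)).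
    rewrite !shiftE !adE bracket_der bracketBl bracketBr bracketZl bracketZr scalerDl.
    by rewrite opprD addrACA.
  have Nder2 i v : N (bracket (tnth Y i) v) = bracket (N (tnth Y i)) v + bracket (tnth Y i)
    (N v).
    suff /lfunP/(_ v) : (N \o ad (tnth Y i))%VF = ad (N (tnth Y i)) + (ad (tnth Y i) \o N)%VF.
      by rewrite !(add_lfunE, comp_lfunE) !adE.
    apply: (eq_lfun_basis Yb) => j; rewrite !(add_lfunE, comp_lfunE) !adE.
    exact: Nder1 (rP i) (rP j).
  suff /lfunP/(_ y) : - (N \o ad z)%VF = - ad (N z) - (ad z \o N)%VF.
    rewrite !(add_lfunE, opp_lfunE, comp_lfunE) !adE.
    rewrite [bracket y z]bracketC [bracket (N y) z]bracketC [bracket y (N z)]bracketC.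
    by rewrite [N (- _)]linearN /= addrC.
  apply: (eq_lfun_basis Yb) => j; rewrite !(add_lfunE, opp_lfunE, comp_lfunE) !adE.
  rewrite [bracket z (N (tnth Y j))]bracketC [bracket (N z) (tnth Y j)]bracketC.
  rewrite [bracket z (tnth Y j)]bracketC.
  by rewrite [N (- _)]linearN /= !opprK Nder2 addrC.
have NH k z : k \in H -> N (bracket k z) = bracket k (N z).
  move=> kH; suff /lfunP/(_ z) : (N \o ad k)%VF = (ad k \o N)%VF by rewrite !comp_lfunE !adE.
  apply: (eq_lfun_basis Yb) => j; rewrite !comp_lfunE.
  have kc u : ad h (ad k u) = ad k (ad h u) by apply/ad_comm/H_abelian.
  rewrite NgY -(shift_comm _ kc); apply: NY; have [m mE] := rP j.
  by exists m; rewrite lfpow_comm ?mE ?linear0 //; apply: shift_comm.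
have [m Nm] : exists m, forall z, lfpow N m z = 0.
  have /fin_all_exists[m mP] i : exists m, lfpow N m (tnth Y i) = 0.
    have [m mE] := rP i; exists m; rewrite -mE; elim: (m) => [|j IHj];
      rewrite ?lfpow0 // !lfpowS IHj.
    apply: NY; elim: (j) => [|j' IHj']; rewrite ?lfpow0 // lfpowS; exact: geig_shift.
  exists (\max_i m i) => z; suff -> : lfpow N (\max_i m i) = 0 by rewrite lfunE.
  apply: (eq_lfun_basis Yb) => i; rewrite lfunE /=.
  exact: lfpow_le0 (leq_bigmax i) (mP i).
have [y NadE] := derivation_inner Nder.
have yH : y \in H.
  have [_ _] := H_cartan; apply=> k kH.
  suff -> : bracket y k = 0 by apply: mem0v.
  apply: killing_nd => w; rewrite killing_trace (_ : ad _ = 0) ?comp_lfun0l ?lfun_trace0 //.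
  apply/lfunP => z; rewrite lfunE adE /=; have := NH k z kH; rewrite NadE !adE bracket_der.
  by move/(canRL (addrK _)); rewrite subrr.
have y0 : y = 0.
  rewrite -(vsprojK yH) (killing_H (s := vsproj H y)) ?linear0 // => t; rewrite vsprojK //.
  rewrite killing_trace -NadE; apply: (lfun_trace_nilp (k := m)) => // z.
  by rewrite !adE NH // subvsP.
move=> gx; have := NY a x gx; rewrite NadE y0 adE bracket0l shiftE adE.
by move/eqP; rewrite eq_sym subr_eq0 => /eqP.
Qed.

Theorem weight_basis : exists X : (\dim {:g}).-tuple g,
  basis_of fullv X /\ exists wt : 'I_(\dim {:g}) -> 'Hom(subvs_of H, F^o),
    forall i, weight_vec (wt i) (tnth X i).
Proof.
have [X Xb /fin_all_exists XP] : exists2 X : (\dim {:g}).-tuple g, basis_of fullv X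
    & forall i, exists alpha : 'Hom(subvs_of H, F^o), weight_vec alpha (tnth X i);
      last by exists X.
apply: (@span_extract F g (fun y =>
  exists alpha : 'Hom(subvs_of H, F^o), weight_vec alpha y)) => x.
pose adH := [seq ad (vsval t) | t <- vbasis {:subvs_of H}].
have [|||s sP ->] := @joint_decomp F g adH fullv x _ _ _ (memvf x).
- by move=> *; apply: memvf.
- by move=> _ _ /mapP[s _ ->] /mapP[t _ ->]; apply/ad_comm/H_abelian; apply: subvsP.
- by move=> _ a y /mapP[s _ ->] gy; rewrite adE; apply: ad_semisimple => //; apply: subvsP.
by exists s => // y /sP[_ /joint_weight].
Qed.

End Diagonal.

(** The structure of [g] reduced to a basis [X] of weight vectors, with weights
    [wt], and a nondegenerate Killing form. *)
Record split_setting (F : numClosedFieldType) (g : lieAlgType F) (H : {vspace g})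
    (l : nat) (Pi fw : l.-tuple 'Hom(subvs_of H, F^o))
    (X : (\dim {:g}).-tuple g) (wt : 'I_(\dim {:g}) -> 'Hom(subvs_of H, F^o)) : Prop :=
  SplitSetting {
    split_base : root_base Pi;
    split_fund : fundamental_weights Pi fw;
    split_killing : forall x : g, (forall y, killing x y = 0) -> x = 0;
    split_zero : forall x, x \in H <-> weight_vec (0 : 'Hom(subvs_of H, F^o)) x;
    split_basis : basis_of fullv X;
    split_wt : forall b, weight_vec (wt b) (tnth X b)
  }.

Lemma split_settingP (F : numClosedFieldType) (g : lieAlgType F) (H : {vspace g})
    (l : nat) (Pi fw : l.-tuple 'Hom(subvs_of H, F^o)) :
  semisimple g -> cartan_subalgebra H -> root_base Pi -> fundamental_weights Pi fw ->
  exists X wt, split_setting Pi fw X wt.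
Proof.
move=> g_ss H_cartan Pi_base fw_fund; have [Pi_basis _ _] := Pi_base.
have killing_H := killing_H_nondeg Pi_basis fw_fund.
have H_abelian := cartan_abelian H_cartan killing_H.
have killing_nd := killing_nondegenerate g_ss H_cartan Pi_base fw_fund.
have [X [Xb [wt Xwt]]] := weight_basis H_cartan H_abelian killing_nd killing_H.
exists X, wt; split=> // x; split; last exact: weight_vec0_H.
by move=> xH t; rewrite lfunE /= scale0r H_abelian // subvsP.
Qed.

(** * Copies of sl2 and roots *)
Section ModuleAct.
Variables (F : fieldType) (g : lieAlgType F) (M : lieModule g).
Implicit Types (x y : g) (v : M).

Lemma actDl x y v : act M (x + y) v = act M x v + act M y v.
Proof. by rewrite linearD add_lfunE. Qed.

Lemma actZl a x v : act M (a *: x) v = a *: act M x v.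
Proof. by rewrite linearZ scale_lfunE. Qed.

Lemma act0l v : act M 0 v = 0.
Proof. by rewrite linear0 lfunE. Qed.

Lemma actNl x v : act M (- x) v = - act M x v.
Proof. by rewrite -scaleN1r actZl scaleN1r. Qed.

Lemma act_suml (I : Type) (r : seq I) (P : pred I) (x : I -> g) v :
  act M (\sum_(i <- r | P i) x i) v = \sum_(i <- r | P i) act M (x i) v.
Proof.
by apply: (big_morph (fun x => act M x v)) => [u w|]; rewrite ?actDl ?act0l.
Qed.

Lemma act_comm x y v : act M x (act M y v) = act M y (act M x v) + act M (bracket x y) v.
Proof. by rewrite act_bracket addrC subrK. Qed.

End ModuleAct.

Section Sl2.
Variables (F : numClosedFieldType) (g : lieAlgType F) (M : lieModule g).
Implicit Types (x y : g) (v : M).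

Lemma sl2_vanish (h e : g) a c v : a != 0 -> bracket h e = a *: e -> act M h v = c *: v ->
  (forall k, act M h (lfpow (act M e) k v) = (c + k%:R * a) *: lfpow (act M e) k v) /\
  exists k, lfpow (act M e) k v = 0.
Proof.
move=> an0 he hv.
have hk k : act M h (lfpow (act M e) k v) = (c + k%:R * a) *: lfpow (act M e) k v.
  elim: k => [|k IHk]; first by rewrite lfpow0 mul0r addr0.
  rewrite lfpowS act_comm IHk he actZl linearZ /= -scalerDl -natr1 mulrDl mul1r.
  by rewrite addrA.
split=> //; apply: (geig_bounded (f := act M h) (r := c) an0) => k.
by exists 1%N; rewrite lfpowS lfpow0 shiftE hk subrr.
Qed.

(** The vectors [f^k v] have distinct weights, so there is a first [k] such that
    [f^(k+1) v = 0]; applying [e] gives [(k+1) (c - k) f^k v = 0]. *)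
Lemma sl2_highest (e f h : g) c v :
  bracket h f = (- 2) *: f -> bracket e f = h ->
  act M h v = c *: v -> act M e v = 0 -> v != 0 -> exists k : nat, c = k%:R.
Proof.
move=> hf ef hv ev vn0.
have n2 : (- 2 : F) != 0 by rewrite oppr_eq0 pnatr_eq0.
have [hk [k0 k0E]] := sl2_vanish n2 hf hv.
pose P k := lfpow (act M f) k v == 0.
have exP : exists k, P k by exists k0; rewrite /P k0E.
case: (ex_minnP exP) => -[|k] Pk kmin; first by move: vn0;
  rewrite -(lfpow0 (act M f) v) (eqP Pk) eqxx.
have vk : lfpow (act M f) k v != 0 by apply/negP => /kmin; rewrite ltnn.
have ek j : act M e (lfpow (act M f) j.+1 v) = (j.+1%:R * (c - j%:R)) *: lfpow (act M f) j v.
  elim: j => [|j IHj].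
    by rewrite lfpowS lfpow0 act_comm ev linear0 add0r ef hv mul1r subr0.
  rewrite lfpowS act_comm IHj linearZ /= ef hk -lfpowS -scalerDl; congr (_ *: _).
  rewrite -!natr1; ring.
exists k; move: (ek k); rewrite (eqP Pk) linear0 => /esym/eqP.
by rewrite scaler_eq0 (negPf vk) orbF mulf_eq0 pnatr_eq0 /= subr_eq0 => /eqP.
Qed.

Lemma sl2_lowest (e f h : g) c v :
  bracket h e = 2 *: e -> bracket e f = h ->
  act M h v = c *: v -> act M f v = 0 -> v != 0 -> exists k : nat, c = - k%:R.
Proof.
move=> he ef hv fv vn0.
have [|||||k kE] := @sl2_highest f e (- h) (- c) v; rewrite ?bracketNl ?he ?scaleNr //.
- by rewrite bracketC ef.
- by rewrite actNl hv.
by exists k; rewrite -kE opprK.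
Qed.

(** Raise [v] until it is killed by [e]. *)
Lemma sl2_integral (e f h : g) c v :
  bracket h e = 2 *: e -> bracket h f = (- 2) *: f -> bracket e f = h ->
  act M h v = c *: v -> v != 0 -> exists z : int, c = z%:~R.
Proof.
move=> he hf ef hv vn0.
have n2 : (2 : F) != 0 by rewrite pnatr_eq0.
have [hk [k0 k0E]] := sl2_vanish n2 he hv.
pose P k := lfpow (act M e) k v == 0.
have exP : exists k, P k by exists k0; rewrite /P k0E.
case: (ex_minnP exP) => -[|k] Pk kmin; first by move: vn0;
  rewrite -(lfpow0 (act M e) v) (eqP Pk) eqxx.
have vk : lfpow (act M e) k v != 0 by apply/negP => /kmin; rewrite ltnn.
move: Pk; rewrite /P lfpowS => /eqP ek.
have [j jE] := sl2_highest hf ef (hk k) ek vk.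
exists (j%:Z - (k * 2)%:Z); rewrite rmorphB /= -!pmulrn -jE natrM.
by rewrite addrK.
Qed.

End Sl2.

Section Roots.
Variables (F : numClosedFieldType) (g : lieAlgType F) (H : {vspace g}).
Variables (l : nat) (Pi fw : l.-tuple 'Hom(subvs_of H, F^o)).
Variables (X : (\dim {:g}).-tuple g) (wt : 'I_(\dim {:g}) -> 'Hom(subvs_of H, F^o)).
Hypothesis D : split_setting Pi fw X wt.
Local Notation dual := 'Hom(subvs_of H, F^o).
Local Notation I := 'I_(\dim {:g}).
Local Notation ht := (height Pi).
Local Notation co i beta := (coord Pi i beta).
Implicit Types (alpha beta gamma mu : dual) (x y z : g) (b c : I) (i j : 'I_l).

Let Pi_base := split_base D.
Let fw_fund := split_fund D.
Let Pi_basis : basis_of fullv Pi. Proof. by case: Pi_base. Qed.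
Let killing_nd := split_killing D.
Let Xb := split_basis D.

Lemma weight_vecZ alpha a x : weight_vec alpha x -> weight_vec alpha (a *: x).
Proof. by move=> xP t; rewrite bracketZr xP !scalerA mulrC. Qed.

Lemma weight_vec_bracket alpha beta x y : weight_vec alpha x -> weight_vec beta y ->
  weight_vec (alpha + beta) (bracket x y).
Proof.
move=> xP yP t; rewrite bracket_der xP yP bracketZl bracketZr -scalerDl.
by rewrite add_lfunE.
Qed.

Lemma killing_weight alpha beta x y : weight_vec alpha x -> weight_vec beta y ->
  alpha + beta != 0 -> killing x y = 0.
Proof.
move=> xP yP; apply: contraNeq => k0; apply/eqP/lfunP => t; rewrite add_lfunE [RHS]lfunE /=.
have := killing_inv x (vsval t) y; rewrite bracketC xP yP -scaleNr killingZl killingZr.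
move/eqP; rewrite -subr_eq0 -mulrBl mulf_eq0 (negPf k0) orbF -opprD oppr_eq0.
by move/eqP.
Qed.

Lemma coord_weight alpha x b : weight_vec alpha x -> coord X b x != 0 -> wt b = alpha.
Proof.
move=> xP cn0; apply/lfunP => t.
have := congr1 (coord X b) (xP t); rewrite linearZ /=.
rewrite {1}(coord_basis Xb (memvf x)) bracket_sumr.
under eq_bigr => c _ do rewrite bracketZr -tnth_nth (split_wt D) scalerA (tnth_nth 0).
by rewrite (coord_sum_free (fun c => coord X c x * wt c t) b (basis_free Xb)) mulrC =>
  /(mulIf cn0).
Qed.

Lemma coordX b c : coord X b (tnth X c) = (b == c)%:R.
Proof. by rewrite (tnth_nth 0) coord_free ?(basis_free Xb) // eq_sym. Qed.

Lemma sum_coordX x : x = \sum_b coord X b x *: tnth X b.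
Proof.
rewrite {1}(coord_basis Xb (memvf x)).
by apply: eq_bigr => i _; rewrite (tnth_nth 0).
Qed.

Lemma X_neq0 b : tnth X b != 0.
Proof.
apply/eqP => X0; have := coordX b b; rewrite X0 linear0 eqxx => /eqP.
by rewrite eq_sym oner_eq0.
Qed.

Lemma weight_vec_basis alpha x : weight_vec alpha x -> x != 0 -> exists b, wt b = alpha.
Proof.
move=> xP xn0; have /existsP[b bP] : [exists b, coord X b x != 0].
  apply: contraNT xn0; rewrite negb_exists => /forallP x0.
  by rewrite (sum_coordX x) big1 // => b _; have := x0 b; rewrite negbK => /eqP->;
    rewrite scale0r.
by exists b; apply: coord_weight bP.
Qed.

Lemma killing_pair alpha x : weight_vec alpha x -> x != 0 ->
  exists2 y, weight_vec (- alpha) y & killing x y = 1.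
Proof.
move=> xP xn0; have /existsP[b bP] : [exists b, killing x (tnth X b) != 0].
  apply: contraNT xn0; rewrite negb_exists => /forallP x0.
  apply/eqP/killing_nd => y; rewrite (sum_coordX y) killing_sumr big1 // => b _.
  by rewrite killingZr; have := x0 b; rewrite negbK => /eqP->; rewrite mulr0.
exists ((killing x (tnth X b))^-1 *: tnth X b); last by rewrite killingZr mulVf.
apply: weight_vecZ; suff -> : - alpha = wt b by apply: split_wt D b.
by apply/eqP; rewrite eq_sym -addr_eq0 addrC;
  apply: contraNT bP => /(killing_weight xP (split_wt D b))/eqP.
Qed.

(** The vector [t_alpha] representing [alpha] through the Killing form. *)
Definition tvec alpha : g := vsval (killing_sharp H alpha).

Lemma bracket_opposite alpha x y : weight_vec alpha x -> weight_vec (- alpha) y ->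
  bracket x y = killing x y *: tvec alpha.
Proof.
move=> xP yP; have xyH : bracket x y \in H.
  by apply/(split_zero D); rewrite -(subrr alpha); apply: weight_vec_bracket.
apply/eqP; rewrite -subr_eq0; apply/eqP.
have dH : bracket x y - killing x y *: tvec alpha \in H by rewrite rpredB ?rpredZ ?subvsP.
rewrite -(vsprojK dH) (killing_H_nondeg Pi_basis fw_fund (s := vsproj H _)) ?linear0 // => t.
rewrite vsprojK // -scaleN1r killingDl !killingZl (killing_sharpE Pi_basis fw_fund).
have -> : killing (bracket x y) (vsval t) = alpha t * killing x y.
  rewrite killing_inv [bracket y _]bracketC yP opp_lfunE scaleNr opprK killingZr //.
by rewrite mulN1r mulrC subrr.
Qed.

Lemma dual_vector b : exists y,
  weight_vec (- wt b) y /\ forall x, killing y x = coord X b x.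
Proof.
have [y yP] := killing_represents killing_nd (linfun (coord X b : g -> F^o)).
have yE x : killing y x = coord X b x by rewrite yP linfun_linear //; apply: linearP.
exists y; split=> // t; apply/eqP; rewrite -subr_eq0; apply/eqP/killing_nd => x.
rewrite -scaleN1r killingDl !killingZl bracketC -scaleN1r killingZl killing_inv !yE opp_lfunE.
rewrite (_ : coord X b (bracket (vsval t) x) = wt b t * coord X b x);
  first by rewrite !mulN1r mulNr opprK addNr.
rewrite {1}(coord_basis Xb (memvf x)) bracket_sumr.
under eq_bigr => c _ do rewrite bracketZr -tnth_nth (split_wt D) scalerA (tnth_nth 0).
by rewrite (coord_sum_free (fun c => coord X c x * wt c t) b (basis_free Xb)) mulrC.
Qed.

Definition coroot i : subvs_of H :=
  (2 / weight_form (tnth Pi i) (tnth Pi i)) *: killing_sharp H (tnth Pi i).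

Lemma corootE beta i : beta (coroot i) = pairing beta (tnth Pi i).
Proof.
rewrite /coroot linearZ /= /pairing (weight_formE Pi_basis fw_fund beta).
by rewrite -[_ *: _]/(_ * _) mulrAC.
Qed.

Lemma coroot_simple i : tnth Pi i (coroot i) = 2.
Proof. by rewrite corootE /pairing mulfK // (weight_form_simple_neq0 fw_fund). Qed.

Lemma sl2_triple i : exists e f : g,
  [/\ weight_vec (tnth Pi i) e, weight_vec (- tnth Pi i) f, bracket e f = vsval (coroot i),
      e != 0 & [/\ bracket (vsval (coroot i)) e = 2 *: e,
        bracket (vsval (coroot i)) f = (- 2) *: f & f != 0]].
Proof.
have [_ /(_ i)/andP[an0 wn0] _] := Pi_base.
have /subvPn[e ew en0] : ~~ (weight_space (adjoint g) (tnth Pi i) <= 0)%VS by rewrite subv0.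
move: ew en0 => /weight_vecP eP; rewrite memv0 => en0.
have [y yP exy] := killing_pair eP en0.
set q := 2 / weight_form (tnth Pi i) (tnth Pi i).
have qn0 : q != 0 by rewrite mulf_neq0 ?pnatr_eq0 // invr_eq0 (weight_form_simple_neq0 fw_fund).
have fP : weight_vec (- tnth Pi i) (q *: y) by apply: weight_vecZ.
exists e, (q *: y); split=> //.
  by rewrite bracketZr (bracket_opposite eP yP) exy scale1r /tvec /coroot linearZ.
split; first by rewrite eP coroot_simple.
  by rewrite fP opp_lfunE coroot_simple.
rewrite scaler_eq0 (negPf qn0) /=; apply: contraTneq (oner_neq0 F) => y0.
by rewrite -exy y0 killing0r eqxx.
Qed.

Definition pos gamma := nneg_combination Pi gamma /\ gamma != 0.

Lemma coord_nneg i gamma : nneg_combination Pi gamma -> exists k : nat, co i gamma = k%:R.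
Proof. by case=> k ->; exists (k i); rewrite (coord_comb Pi_base). Qed.

Lemma pos_coord i gamma : pos gamma -> 0 <= co i gamma.
Proof. by case=> /(coord_nneg i)[k ->] _; rewrite ler0n. Qed.

Lemma pos_ht gamma : pos gamma -> 0 < ht gamma.
Proof. by case=> *; apply: ht_nneg. Qed.

Lemma root_sign gamma x : weight_vec gamma x -> x != 0 ->
  [\/ gamma = 0, pos gamma | pos (- gamma)].
Proof.
move=> xP xn0; have [->|gn0] := eqVneq gamma 0; first by constructor 1.
have [_ _ /(_ _ (weight_vec_root xP xn0 gn0))[gP|gP]] := Pi_base.
  by constructor 2.
by constructor 3; split; rewrite // oppr_eq0.
Qed.

Lemma root_pos_coord gamma x i : weight_vec gamma x -> x != 0 -> 0 < co i gamma -> pos gamma.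
Proof.
move=> xP xn0 ci; have [g0|//|/(pos_coord i)] := root_sign xP xn0.
  by move: ci; rewrite g0 linear0 ltxx.
by rewrite linearN /= oppr_ge0 => /(lt_le_trans ci); rewrite ltxx.
Qed.

Lemma pos_exists_coord gamma : pos gamma -> exists i, 0 < co i gamma.
Proof.
move=> gp; have /existsP[i iP] : [exists i, co i gamma != 0].
  apply: contraPT gp; rewrite negb_exists => /forallP g0 [_ /eqP]; apply.
  rewrite (sum_coord_simple Pi_basis gamma) big1 // => i _.
  by have := g0 i; rewrite negbK => /eqP->; rewrite scale0r.
by exists i; rewrite lt0r iP pos_coord.
Qed.

(** [alpha_i - alpha_j] is not a root, so a root vector for [alpha_i] is a lowest
    weight vector for the [j]-th copy of [sl2]. *)
Lemma coroot_simple_le0 i j : i != j -> exists k : nat, tnth Pi i (coroot j) = - k%:R.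
Proof.
move=> nij; have [e [_ [eP _ _ en0 _]]] := sl2_triple i.
have [e' [f [_ fP ef _ [he _ _]]]] := sl2_triple j.
apply: (@sl2_lowest F g (adjoint g) e' f (vsval (coroot j)) _ (e : adjoint g) he ef) => //.
  by rewrite -eP; exact: ad_lfunE.
rewrite (_ : act (adjoint g) f e = bracket f e); last exact: ad_lfunE.
apply/eqP/negPn/negP => fen0.
have feP := weight_vec_bracket fP eP.
have := root_pos_coord (i := i) feP fen0.
rewrite linearD linearN /= !(coord_simple Pi_base) eqxx (negPf nij) oppr0 add0r ltr01 =>
  /(_ isT).
move/(pos_coord j); rewrite linearD linearN /= !(coord_simple Pi_base) eqxx eq_sym (negPf
  nij) addr0.
by rewrite oppr_ge0 ler10.
Qed.

Lemma wt_coroot_int b i : exists z : int, wt b (coroot i) = z%:~R.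
Proof.
have [e [f [_ _ ef _ [he hf _]]]] := sl2_triple i.
apply: (@sl2_integral F g (adjoint g) _ _ _ _ (tnth X b : adjoint g) he hf ef);
  last exact: X_neq0.
by rewrite -(split_wt D); exact: ad_lfunE.
Qed.

Lemma killing_H_sum s t : killing (vsval s) (vsval t) = \sum_b wt b s * wt b t.
Proof.
rewrite killing_trace (lfun_trace_basis _ Xb); apply: eq_bigr => b _.
by rewrite comp_lfunE !adE (split_wt D) bracketZr (split_wt D) scalerA linearZ /= coordX eqxx
  mulr1 mulrC.
Qed.

Lemma simple_basis i : exists b, wt b = tnth Pi i.
Proof. by have [e [_ [eP _ _ en0 _]]] := sl2_triple i; apply: weight_vec_basis eP en0. Qed.

(** The trace form of the coroot with itself is the sum of the squares of the
    integers [wt b (h_i)], and it is [4 / (alpha_i, alpha_i)]. *)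
Lemma weight_form_simple_gt0 i : 0 < weight_form (tnth Pi i) (tnth Pi i).
Proof.
set q := weight_form _ _.
have qn0 : q != 0 by apply: weight_form_simple_neq0 fw_fund i.
have kE : killing (vsval (coroot i)) (vsval (coroot i)) = 4 / q.
  rewrite /coroot !linearZ /= killingZl killingZr -/(weight_form _ _) -/q.
  by field.
have : 0 < 4 / q.
  rewrite -kE killing_H_sum; have [b bE] := simple_basis i.
  rewrite (bigD1 b) //= ltr_pwDl //.
    by rewrite bE coroot_simple mulr_gt0 ?ltr0n.
  apply: sumr_ge0 => c _; have [z ->] := wt_coroot_int c i.
  by rewrite -expr2 -rmorphXn /= ler0z sqr_ge0.
by rewrite pmulr_rgt0 ?ltr0n // invr_gt0.
Qed.

(** Both products can be computed on the stable coordinate subspace, where their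
    traces agree. *)
Lemma stable_trace0 (P : pred I) x y :
  (forall b c, P b -> coord X c (bracket x (tnth X b)) != 0 -> P c) ->
  (forall b c, P b -> coord X c (bracket y (tnth X b)) != 0 -> P c) ->
  \sum_(b | P b) coord X b (bracket (bracket x y) (tnth X b)) = 0.
Proof.
move=> xP yP.
pose A u b c := coord X c (bracket u (tnth X b)).
have compE u v b : (forall b c, P b -> A v b c != 0 -> P c) -> P b ->
    coord X b (bracket u (bracket v (tnth X b))) = \sum_(c | P c) A v b c * A u c b.
  move=> vP Pb; rewrite {1}[bracket v (tnth X b)]sum_coordX bracket_sumr linear_sum.
  rewrite (bigID P) /= [X in _ + X]big1 ?addr0 => [|c nPc].
    by apply: eq_bigr => c _; rewrite bracketZr linearZ.
  have /eqP-> : coord X c (bracket v (tnth X b)) == 0 by apply: contraNT nPc; apply: vP.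
  by rewrite scale0r bracket0r linear0.
transitivity (\sum_(b | P b) (\sum_(c | P c) A y b c * A x c b - \sum_(c | P c) A x b c * A y
  c b)).
  apply: eq_bigr => b Pb; rewrite -!compE // -linearB; congr (coord _ _ _).
  by have := ad_bracket x y (tnth X b); rewrite !ad_lfunE.
rewrite sumrB [X in X - _]exchange_big /= -sumrB big1 // => b _.
by rewrite -sumrB big1 // => c _; rewrite mulrC subrr.
Qed.

Lemma coroot_trace0 (P : pred I) i :
  (forall b c, P b -> wt c = wt b + tnth Pi i -> P c) ->
  (forall b c, P b -> wt c = wt b - tnth Pi i -> P c) ->
  \sum_(b | P b) wt b (coroot i) = 0.
Proof.
move=> PD PB; have [e [f [eP fP ef _ _]]] := sl2_triple i.
rewrite -[RHS](@stable_trace0 P e f) => [|b c Pb|b c Pb].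
- apply: eq_bigr => b _; rewrite ef (split_wt D) [coord X b (_ *: _)]linearZ /=.
  by rewrite coordX eqxx mulr1.
- move=> cn0; apply: PD Pb _; rewrite addrC.
  by apply: coord_weight cn0; apply: weight_vec_bracket eP (split_wt D b).
move=> cn0; apply: PB Pb _; rewrite addrC.
by apply: coord_weight cn0; apply: weight_vec_bracket fP (split_wt D b).
Qed.

(** [2 rho], the sum of the positive roots counted with multiplicity. *)
Definition rho2 : dual := \sum_(b | 0 < ht (wt b)) wt b.

Lemma wt_ht_pos b : reflect (pos (wt b)) (0 < ht (wt b)).
Proof.
apply: (iffP idP) => [hb|]; last exact: pos_ht.
have [g0|//|/pos_ht] := root_sign (split_wt D b) (X_neq0 b).
  by move: hb; rewrite g0 /height big1 ?ltxx // => i _; rewrite linear0.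
by rewrite htN oppr_gt0 => /(lt_trans hb); rewrite ltxx.
Qed.

Lemma wt_pos_coord b i : 0 < co i (wt b) -> 0 < ht (wt b).
Proof. by move=> ci; apply/wt_ht_pos; apply: root_pos_coord (split_wt D b) (X_neq0 b) ci. Qed.

(** The positive roots that are not multiples of [alpha_i] span a module for the
    [i]-th copy of [sl2], on which [h_i] has trace zero; on the multiples of
    [alpha_i] it is positive. *)
Lemma rho2_coroot i : 0 < rho2 (coroot i).
Proof.
rewrite /rho2 sum_lfunE (bigID (fun b => [exists j, (j != i) && (0 < co j (wt b))])) /=.
rewrite coroot_trace0 ?add0r.
- have [b0 b0E] := simple_basis i.
  have multE b : 0 < ht (wt b) -> ~~ [exists j, (j != i) && (0 < co j (wt b))] ->
      0 < wt b (coroot i).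
    move=> hb nb; have cj j : j != i -> co j (wt b) = 0.
      move=> nji; apply/eqP; have := pos_coord j (elimT (wt_ht_pos b) hb).
      rewrite le0r => /orP[//|cj]; case/negP: nb; apply/existsP; exists j.
      by rewrite nji.
    have wE : wt b = co i (wt b) *: tnth Pi i.
      rewrite {1}(sum_coord_simple Pi_basis (wt b)) (bigD1 i) //= big1 ?addr0 // => j nji.
      by rewrite cj ?scale0r.
    have hE : ht (wt b) = co i (wt b).
      by rewrite /height (bigD1 i) //= big1 ?addr0 // => j /cj.
    by rewrite wE scale_lfunE coroot_simple mulr_gt0 ?ltr0n // -hE.
  have b0P : (0 < ht (wt b0)) && ~~ [exists j, (j != i) && (0 < co j (wt b0))].
    apply/andP; split.
      by apply: (wt_pos_coord (i := i)); rewrite b0E (coord_simple Pi_base) eqxx ltr01.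
    apply/existsP => -[j /andP[nji]].
    by rewrite b0E (coord_simple Pi_base) (negPf nji) ltxx.
  rewrite (bigD1 b0) //= ltr_pwDl //; first by case/andP: b0P => *; apply: multE.
  by apply: sumr_ge0 => b /andP[/andP[hb nb] _]; apply/ltW/multE.
- move=> b c /andP[hb /existsP[j /andP[nji cj]]] cE.
  have cj' : 0 < co j (wt c).
    by rewrite cE linearD /= (coord_simple Pi_base) (negPf nji) addr0.
  by rewrite (wt_pos_coord cj') /=; apply/existsP; exists j; rewrite nji.
move=> b c /andP[hb /existsP[j /andP[nji cj]]] cE.
have cj' : 0 < co j (wt c).
  by rewrite cE linearB /= (coord_simple Pi_base) (negPf nji) subr0.
by rewrite (wt_pos_coord cj') /=; apply/existsP; exists j; rewrite nji.
Qed.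

End Roots.

(** * Tensor products and wedges of modules *)
Section MkModule.
Variables (F : fieldType) (g : lieAlgType F) (T : vectType F) (a : g -> T -> T).
Hypotheses (a_linl : forall v, linear (a^~ v)) (a_linr : forall x, linear (a x)).
Hypothesis a_bracket : forall x y v, a (bracket x y) v = a x (a y v) - a y (a x v).

Definition mk_act : 'Hom(g, 'End(T)) := linfun (fun x => linfun (a x)).

Lemma mk_actE x v : mk_act x v = a x v.
Proof.
rewrite /mk_act linfun_linear ?(linfun_linear (a_linr x)) // => c y z.
apply/lfunP => w; rewrite add_lfunE scale_lfunE !(linfun_linear (a_linr _)).
exact: a_linl.
Qed.

Lemma mk_act_bracket x y v :
  mk_act (bracket x y) v = mk_act x (mk_act y v) - mk_act y (mk_act x v).
Proof. by rewrite !mk_actE. Qed.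

Definition mk_module : lieModule g := LieModule mk_act_bracket.

End MkModule.

Section Tensor.
Variables (F : fieldType) (g : lieAlgType F) (M Z : lieModule g).
Local Notation d := (\dim {:Z}).
Local Notation e := (vbasis {:Z}).
Local Notation T := {ffun 'I_d -> M}.

Let sum_e (z : Z) : z = \sum_(k < d) coord e k z *: e`_k.
Proof. exact: coord_vbasis (memvf z). Qed.

(** [A] stands for the tensor [\sum_(k < d) A k (x) e_k]. *)
Definition tensor_act (x : g) (A : T) : T :=
  [ffun k => act M x (A k) + \sum_(j < d) coord e k (act Z x e`_j) *: A j].

Lemma tensor_act_linl A : linear (tensor_act^~ A).
Proof.
move=> c x y; apply/ffunP => k; rewrite !ffunE actDl actZl scalerDr addrACA; congr (_ + _).
rewrite scaler_sumr -big_split; apply: eq_bigr => j _ /=.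
by rewrite actDl actZl linearP /= scalerDl scalerA.
Qed.

Lemma tensor_act_linr x : linear (tensor_act x).
Proof.
move=> c A B; apply/ffunP => k; rewrite !ffunE linearP /= scalerDr addrACA; congr (_ + _).
rewrite scaler_sumr -big_split; apply: eq_bigr => j _ /=.
by rewrite !ffunE scalerDr !scalerA mulrC.
Qed.

Lemma tensor_act_bracket x y A :
  tensor_act (bracket x y) A = tensor_act x (tensor_act y A) - tensor_act y (tensor_act x A).
Proof.
have comp u v k : tensor_act u (tensor_act v A) k
    = act M u (act M v (A k)) + (\sum_(j < d) coord e k (act Z v e`_j) *: act M u (A j)
        + \sum_(j < d) coord e k (act Z u e`_j) *: act M v (A j))
      + \sum_(j < d) coord e k (act Z u (act Z v e`_j)) *: A j.
  rewrite !ffunE linearD linear_sum /= -!addrA; congr (_ + _).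
  under eq_bigr => j _ do rewrite linearZ /=.
  congr (_ + _); under eq_bigr => j _ do rewrite ffunE scalerDr.
  rewrite big_split; congr (_ + _) => /=.
  under eq_bigr => j _ do rewrite scaler_sumr.
  rewrite exchange_big; apply: eq_bigr => i _ /=.
  rewrite [act Z v e`_i in RHS]sum_e !linear_sum scaler_suml; apply: eq_bigr => j _.
  by rewrite !linearZ /= scalerA mulrC.
apply/ffunP => k; rewrite ffunE [RHS]ffunE [X in _ = _ + X]ffunE !comp act_bracket.
have cancel (p q r s t u : M) :
    (p + (q + r) + s) - (t + (r + q) + u) = (p - t) + (s - u).
  by rewrite [r + q]addrC; move: (q + r) => w;
    rewrite !opprD addrACA [p + w + _]addrACA subrr addr0.
rewrite cancel.
congr (_ + _); rewrite -sumrB; apply: eq_bigr => j _.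
by rewrite act_bracket linearB scalerBl.
Qed.

Definition tensor : lieModule g :=
  mk_module tensor_act_linl tensor_act_linr tensor_act_bracket.

Lemma act_tensorE x (A : tensor) : act tensor x A = tensor_act x A.
Proof. exact: mk_actE tensor_act_linl tensor_act_linr x A. Qed.

Lemma tensor_ext (A B : T) : (forall k, A k = B k) -> A = B.
Proof. by move=> AB; apply/ffunP. Qed.

Definition pure_tensor (m : M) (z : Z) : tensor := [ffun k => coord e k z *: m].

Lemma act_pure_tensor x m z :
  act tensor x (pure_tensor m z) = pure_tensor (act M x m) z + pure_tensor m (act Z x z).
Proof.
rewrite act_tensorE; apply: tensor_ext => k; rewrite !ffunE linearZ; congr (_ + _).
rewrite [in RHS](sum_e z) !linear_sum scaler_suml; apply: eq_bigr => j _.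
by rewrite ffunE scalerA !linearZ mulrC.
Qed.

Lemma pure_tensorZl c m z : pure_tensor (c *: m) z = c *: pure_tensor m z.
Proof. by apply: tensor_ext => k; rewrite !ffunE !scalerA mulrC. Qed.

Lemma pure_tensorZr c m z : pure_tensor m (c *: z) = c *: pure_tensor m z.
Proof. by apply: tensor_ext => k; rewrite !ffunE linearZ scalerA. Qed.

Lemma pure_tensor0l z : pure_tensor 0 z = 0.
Proof. by apply: tensor_ext => k; rewrite !ffunE scaler0. Qed.

Lemma pure_tensor0r m : pure_tensor m 0 = 0.
Proof. by apply: tensor_ext => k; rewrite !ffunE linear0 scale0r. Qed.

Definition contract (zeta : 'Hom(Z, F^o)) (A : tensor) : M :=
  \sum_(k < d) zeta e`_k *: (A : {ffun 'I_d -> M}) k.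

Lemma contract_linear zeta : linear (contract zeta).
Proof.
move=> c A B; rewrite /contract scaler_sumr -big_split; apply: eq_bigr => k _.
by rewrite !ffunE scalerDr !scalerA mulrC.
Qed.

Lemma contract_pure zeta m z : contract zeta (pure_tensor m z) = zeta z *: m.
Proof.
rewrite /contract [in RHS](sum_e z) linear_sum scaler_suml; apply: eq_bigr => k _.
by rewrite ffunE scalerA linearZ mulrC.
Qed.

(** The action on the second factor disappears under a functional that kills
    [x Z]. *)
Lemma contract_act (zeta : 'Hom(Z, F^o)) x : (forall z, zeta (act Z x z) = 0) ->
  forall A, contract zeta (act tensor x A) = act M x (contract zeta A).
Proof.
move=> zx A; rewrite /contract linear_sum.
rewrite act_tensorE.
under eq_bigr => k _ do rewrite ffunE scalerDr.
rewrite big_split /= [X in _ + X](_ : _ = 0) ?addr0.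
  by apply: eq_bigr => k _; rewrite linearZ.
under eq_bigr => k _ do rewrite scaler_sumr.
rewrite exchange_big big1 // => j _ /=.
under eq_bigr => k _ do rewrite scalerA.
rewrite -scaler_suml.
transitivity (zeta (act Z x e`_j) *: A j); last by rewrite zx scale0r.
congr (_ *: _); rewrite [in RHS](sum_e (act Z x e`_j)) linear_sum; apply: eq_bigr => k _.
by rewrite linearZ mulrC.
Qed.

End Tensor.

Section WedgeDet.
Variables (F : comNzRingType) (n d : nat) (W : 'I_d -> 'I_n).
Local Notation S := {ffun 'I_d -> 'I_n}.
Implicit Types (s : S) (k : 'I_d) (p q : 'I_n).

Definition upd s k p : S := [ffun i => if i == k then p else s i].

Lemma upd_id s k : upd s k (s k) = s.
Proof. by apply/ffunP => i; rewrite ffunE; case: eqP => [->|]. Qed.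

Lemma updE s k p : upd s k p k = p.
Proof. by rewrite ffunE eqxx. Qed.

Lemma upd_neq s k i p : i != k -> upd s k p i = s i.
Proof. by rewrite ffunE => /negPf->. Qed.

Lemma upd_upd s k p q : upd (upd s k p) k q = upd s k q.
Proof. by apply/ffunP => i; rewrite !ffunE; case: eqP. Qed.

Lemma updC s k i p q : k != i -> upd (upd s k p) i q = upd (upd s i q) k p.
Proof.
move=> nki; apply/ffunP => j; rewrite !ffunE.
by have [->|//] := eqVneq j i; rewrite eq_sym (negPf nki).
Qed.

Definition wedge_mx s : 'M[F]_d := \matrix_(i, k) (W i == s k)%:R.

(** The coordinates of the wedge of the basis vectors listed by [W]. *)
Definition wedge s : F := \det (wedge_mx s).

Lemma wedge_upd s k p :
  wedge (upd s k p) = \sum_i (W i == p)%:R * cofactor (wedge_mx s) i k.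
Proof.
rewrite /wedge (expand_det_col _ k); apply: eq_bigr => i _.
rewrite mxE updE; congr (_ * (_ * \det _)).
apply/matrixP => i' j'; rewrite !mxE upd_neq //.
by rewrite eq_sym neq_lift.
Qed.

(** A derivation multiplies the top wedge of a stable subspace by its trace: in
    the matrix [B] of coordinates, replace one column at a time and expand along
    it; the sum is the trace of [Y (B adj B)], where [Y] is the restriction. *)
Lemma wedge_trace (m : 'I_n -> 'I_n -> F) s : injective W ->
  (forall i q, m (W i) q != 0 -> exists j, q = W j) ->
  \sum_k \sum_p m p (s k) * wedge (upd s k p) = (\sum_i m (W i) (W i)) * wedge s.
Proof.
move=> W_inj mW; pose B := wedge_mx s.
have mE i q : m (W i) q = \sum_j m (W i) (W j) * (W j == q)%:R.
  have [m0|/mW[j ->]] := eqVneq (m (W i) q) 0.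
    rewrite m0 big1 // => j _; have [->|_] := eqVneq (W j) q; rewrite ?mulr0 //.
    by rewrite m0 mul0r.
  rewrite (bigD1 j) //= eqxx mulr1 big1 ?addr0 // => j' nj.
  by rewrite (inj_eq W_inj) (negPf nj) mulr0.
have -> : \sum_k \sum_p m p (s k) * wedge (upd s k p)
    = \sum_k \sum_i m (W i) (s k) * cofactor B i k.
  apply: eq_bigr => k _.
  under eq_bigr => p _ do rewrite wedge_upd mulr_sumr.
  rewrite exchange_big; apply: eq_bigr => i _ /=.
  rewrite (bigD1 (W i)) //= eqxx mul1r big1 ?addr0 // => p np.
  by rewrite eq_sym (negPf np) mul0r mulr0.
have -> : \sum_k \sum_i m (W i) (s k) * cofactor B i k
    = \sum_i \sum_j m (W i) (W j) * (B *m \adj B) j i.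
  rewrite exchange_big; apply: eq_bigr => i _ /=.
  under eq_bigr => k _ do rewrite mE mulr_suml.
  rewrite exchange_big; apply: eq_bigr => j _ /=.
  by rewrite mxE mulr_sumr; apply: eq_bigr => k _; rewrite !mxE mulrA.
rewrite mul_mx_adj mulr_suml; apply: eq_bigr => i _.
rewrite (bigD1 i) //= big1 ?addr0 => [|j nji]; first by rewrite mxE eqxx mulr1n.
by rewrite mxE (negPf nji) mulr0n mulr0.
Qed.

Lemma wedge_self : injective W -> wedge [ffun i => W i] = 1.
Proof.
move=> W_inj; rewrite /wedge (_ : wedge_mx _ = 1%:M) ?det1 //.
by apply/matrixP => i k; rewrite !mxE ffunE (inj_eq W_inj).
Qed.

End WedgeDet.

Section TensorPower.
Variables (F : fieldType) (g : lieAlgType F) (n : nat) (m : g -> 'I_n -> 'I_n -> F) (d : nat).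
Hypotheses (m_lin : forall p q, linear (fun x => m x p q : F^o)).
Hypothesis m_bracket : forall x y p q,
  m (bracket x y) p q = \sum_r (m y p r * m x r q - m x p r * m y r q).
Local Notation S := {ffun 'I_d -> 'I_n}.
Local Notation T := {ffun S -> F^o}.

(** The derivation action on the [d]-th tensor power of the representation with
    matrices [m], on coordinates. *)
Definition power_act (x : g) (A : T) : T :=
  [ffun s : S => \sum_k \sum_p m x p (s k) * A (upd s k p)].

Lemma power_act_linl A : linear (power_act^~ A).
Proof.
move=> c x y; apply/ffunP => s; rewrite !ffunE scaler_sumr -big_split.
apply: eq_bigr => k _; rewrite scaler_sumr -big_split; apply: eq_bigr => p _ /=.
by rewrite m_lin mulrDl -mulrA.
Qed.

Lemma power_act_linr x : linear (power_act x).
Proof.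
move=> c A B; apply/ffunP => s; rewrite !ffunE scaler_sumr -big_split.
apply: eq_bigr => k _; rewrite scaler_sumr -big_split; apply: eq_bigr => p _ /=.
by rewrite !ffunE mulrDr -[_ *: _]/(_ * _) mulrCA.
Qed.

Lemma power_act_bracket x y A :
  power_act (bracket x y) A = power_act x (power_act y A) - power_act y (power_act x A).
Proof.
(* The terms where the two letters act on different factors are symmetric. *)
pose off u v (s : S) := \sum_k \sum_(l | l != k) \sum_p \sum_r
  m u p (s k) * m v r (s l) * A (upd (upd s k p) l r).
have comp u v s : power_act u (power_act v A) s
    = \sum_k \sum_r (\sum_p m v r p * m u p (s k)) * A (upd s k r) + off u v s.
  rewrite ffunE -big_split; apply: eq_bigr => k _ /=.
  under eq_bigr => p _ do rewrite ffunE mulr_sumr (bigD1 k) //=.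
  rewrite big_split; congr (_ + _) => /=.
    under eq_bigr => p _ do rewrite mulr_sumr.
    rewrite exchange_big; apply: eq_bigr => r _ /=; rewrite mulr_suml.
    by apply: eq_bigr => p _; rewrite updE upd_upd mulrA [m u p _ * _]mulrC.
  rewrite exchange_big; apply: eq_bigr => l nlk /=; apply: eq_bigr => p _.
  by rewrite mulr_sumr; apply: eq_bigr => r _; rewrite upd_neq // mulrA.
have offC s : off x y s = off y x s.
  rewrite /off pair_big_dep [RHS]pair_big_dep /=.
  rewrite (reindex_inj (h := fun u : 'I_d * 'I_d => (u.2, u.1))) /=;
    last by case=> a b [? ?] [-> ->].
  apply: eq_big => [[k l]|[k l] nkl] /=; first by rewrite eq_sym.
  rewrite exchange_big; apply: eq_bigr => p _; apply: eq_bigr => r _ /=.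
  by rewrite updC 1?eq_sym // [m x _ _ * _]mulrC.
apply/ffunP => s; rewrite ffunE [RHS]ffunE [X in _ = _ + X]ffunE !comp offC.
rewrite opprD addrACA subrr addr0 -sumrB; apply: eq_bigr => k _.
rewrite -sumrB; apply: eq_bigr => r _.
by rewrite m_bracket -mulrBl sumrB.
Qed.

Definition tensor_power : lieModule g :=
  mk_module power_act_linl power_act_linr power_act_bracket.

Lemma act_powerE x (A : tensor_power) :
  act tensor_power x A = power_act x A.
Proof. exact: mk_actE power_act_linl power_act_linr x A. Qed.

(** The substitution [(s, p) -> (upd s k p, s k)] is an involution. *)
Lemma power_act_transpose x (A B : S -> F) :
  \sum_(s : S) B s * (\sum_k \sum_p m x p (s k) * A (upd s k p))
  = \sum_(s : S) A s * (\sum_k \sum_p m x (s k) p * B (upd s k p)).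
Proof.
under eq_bigr => s _ do rewrite mulr_sumr.
rewrite exchange_big; under [RHS]eq_bigr => s _ do rewrite mulr_sumr.
rewrite [RHS]exchange_big; apply: eq_bigr => k _ /=.
under eq_bigr => s _ do rewrite mulr_sumr.
under [RHS]eq_bigr => s _ do rewrite mulr_sumr.
rewrite pair_big [RHS]pair_big /=.
rewrite (reindex_inj (h := fun u : S * 'I_n => (upd u.1 k u.2, u.1 k))) /=.
  by apply: eq_bigr => -[s p] _ /=;
    rewrite updE upd_upd upd_id mulrCA [RHS]mulrCA [A s * _]mulrC.
apply: can_inj (fun u : S * 'I_n => (upd u.1 k u.2, u.1 k)) _ => -[s p] /=.
by rewrite updE upd_upd upd_id.
Qed.

End TensorPower.

(** * Highest weights realised by finite-dimensional modules *)
Section HighestWeights.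
Variables (F : numClosedFieldType) (g : lieAlgType F) (H : {vspace g}).
Variables (l : nat) (Pi fw : l.-tuple 'Hom(subvs_of H, F^o)).
Variables (X : (\dim {:g}).-tuple g) (wt : 'I_(\dim {:g}) -> 'Hom(subvs_of H, F^o)).
Hypothesis D : split_setting Pi fw X wt.
Local Notation dual := 'Hom(subvs_of H, F^o).
Local Notation I := 'I_(\dim {:g}).
Local Notation pos := (pos Pi).
Local Notation co i beta := (coord Pi i beta).
Implicit Types (alpha beta gamma mu tau : dual) (x y z : g) (b c : I) (i j : 'I_l).
Implicit Types (M Z : lieModule g).

Let Pi_base := split_base D.
Let fw_fund := split_fund D.
Let Pi_basis : basis_of fullv Pi. Proof. by case: Pi_base. Qed.

Definition mod_weight M mu (v : M) := forall t : subvs_of H, act M (vsval t) v = mu t *: v.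

Definition highest M mu (v : M) :=
  mod_weight mu v /\ forall gamma x, pos gamma -> weight_vec gamma x -> act M x v = 0.

Lemma mod_weight_act M mu gamma (v : M) x : mod_weight mu v -> weight_vec gamma x ->
  mod_weight (gamma + mu) (act M x v).
Proof.
move=> vP xP t; rewrite act_comm vP xP actZl linearZ /= -scalerDl add_lfunE addrC.
by rewrite [in LHS]addrC addrC.
Qed.

(** These weights can be added to a highest weight by tensoring with [Z] and
    removed again by contracting with [zeta], which kills [n^- Z]. *)
Definition admissible tau := exists (Z : lieModule g) (z : Z) (zeta : 'Hom(Z, F^o)),
  [/\ highest tau z, zeta z = 1
    & forall gamma y, pos gamma -> weight_vec (- gamma) y -> forall u, zeta (act Z y u) = 0].

Lemma admissible0 : admissible 0.
Proof.
pose a (x : g) (v : F^o) : F^o := 0.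
have al v : linear (a^~ v) by move=> c x y; rewrite /a scaler0 addr0.
have ar x : linear (a x) by move=> c u v; rewrite /a scaler0 addr0.
have ab x y v : a (bracket x y) v = a x (a y v) - a y (a x v) by rewrite /a subrr.
have aE x (v : mk_module al ar ab) : act (mk_module al ar ab) x v = 0.
  exact: (mk_actE al ar x v).
exists (mk_module al ar ab), (1 : F^o), (\1%VF : 'Hom(F^o, F^o)); split.
- by split=> [t|gamma x _ _]; rewrite aE // lfunE /= scale0r.
- by rewrite lfunE.
by move=> gamma y _ _ u; rewrite aE linear0.
Qed.

Lemma highest_tensor M Z mu tau (v : M) (z : Z) : highest mu v -> highest tau z ->
  highest (mu + tau) (pure_tensor v z).
Proof.
move=> [vw v0] [zw z0]; split=> [t|gamma x gp xP].
  by rewrite act_pure_tensor vw zw pure_tensorZl pure_tensorZr -scalerDl add_lfunE.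
by rewrite act_pure_tensor (v0 gamma) // (z0 gamma) // pure_tensor0l pure_tensor0r addr0.
Qed.

Lemma admissibleD tau sigma : admissible tau -> admissible sigma -> admissible (tau + sigma).
Proof.
move=> [Z1 [z1 [zeta1 [h1 e1 n1]]]] [Z2 [z2 [zeta2 [h2 e2 n2]]]].
pose zf (A : tensor Z1 Z2) : F^o := zeta1 (contract zeta2 A).
have zf_lin : linear zf by move=> c A B; rewrite /zf contract_linear linearP.
exists (tensor Z1 Z2), (pure_tensor z1 z2), (linfun zf).
split; first exact: highest_tensor.
  by rewrite (linfun_linear zf_lin) /zf contract_pure e2 scale1r.
move=> gamma y gp yP u; rewrite (linfun_linear zf_lin) /zf contract_act ?(n1 gamma) //.
exact: n2 gp yP.
Qed.

Lemma admissibleMn tau k : admissible tau -> admissible (tau *+ k).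
Proof.
move=> tP; elim: k => [|k IHk]; first exact: admissible0.
by rewrite mulrS; apply: admissibleD.
Qed.

Definition ad_coef x b c : F := coord X c (bracket x (tnth X b)).

Lemma ad_coef_lin b c : linear (fun x => ad_coef x b c : F^o).
Proof. by move=> a x y; rewrite /ad_coef bracketDl bracketZl linearP. Qed.

Lemma ad_coef_bracket x y b c :
  ad_coef (bracket x y) b c = \sum_r (ad_coef y b r * ad_coef x r c - ad_coef x b r * ad_coef
    y r c).
Proof.
have compE u v : coord X c (bracket u (bracket v (tnth X b))) = \sum_r ad_coef v b r *
  ad_coef u r c.
  rewrite {1}[bracket v _](sum_coordX D) bracket_sumr linear_sum; apply: eq_bigr => r _.
  by rewrite bracketZr linearZ.
rewrite sumrB -!compE -linearB; congr (coord _ _ _).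
by have := ad_bracket x y (tnth X b); rewrite !ad_lfunE.
Qed.

Lemma ad_coef_weight gamma x b c : weight_vec gamma x -> ad_coef x b c != 0 ->
  wt c = gamma + wt b.
Proof. by move=> xP /(coord_weight D); apply; apply: weight_vec_bracket (split_wt D b). Qed.

Lemma wedge_int n d (W : 'I_d -> 'I_n) s : wedge F W s = (wedge int W s)%:~R.
Proof.
rewrite /wedge -(det_map_mx (intr : int -> F)); congr (\det _); apply/matrixP => i k.
by rewrite !mxE rmorph_nat.
Qed.

(** The span of the weight vectors indexed by [P] is stable under [n^+], so [n^+]
    kills its top wedge [omega], the traces being zero.  Dually the coordinates
    outside [P] are stable under [n^-], so pairing with [omega] kills the image of
    [n^-].  The pairing of [omega] with itself is a sum of squares of integers. *)
Lemma admissible_wedge (P : pred I) :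
  (forall b c gamma, P b -> pos gamma -> wt c = gamma + wt b -> P c) ->
  admissible (\sum_(b | P b) wt b).
Proof.
move=> Pup; pose W (k : 'I_#|P|) : I := enum_val k.
have W_inj : injective W by apply: enum_val_inj.
have WP k : P (W k) by have := enum_valP k.
have PW b : P b -> exists k, b = W k.
  by move=> Pb; exists (enum_rank_in Pb b); rewrite /W enum_rankK_in.
pose Z := tensor_power #|P| ad_coef_lin ad_coef_bracket.
pose omega : Z := [ffun s => wedge F W s].
have trE (f : I -> F) : \sum_k f (W k) = \sum_(b | P b) f b.
  by rewrite [RHS](big_enum_val f).
have trace0 gamma x : gamma != 0 -> weight_vec gamma x -> \sum_(b | P b) ad_coef x b b = 0.
  move=> gn0 xP; rewrite big1 // => b _; apply/eqP;
    apply: contraNT gn0 => /(ad_coef_weight xP)/eqP.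
  by rewrite -subr_eq subrr eq_sym.
have wedge_act (m : I -> I -> F) (s : {ffun 'I_#|P| -> I}) : (forall b c, P b ->
  m b c != 0 -> P c) ->
    \sum_k \sum_p m p (s k) * wedge F W (upd s k p) = (\sum_(b | P b) m b b) * wedge F W s.
  move=> mP; rewrite (wedge_trace s W_inj) => [|k q /(mP _ _ (WP k))/PW //].
  by rewrite (trE (fun b => m b b)).
pose N := \sum_s wedge F W s ^+ 2.
have N_neq0 : N != 0.
  rewrite gt_eqF // /N (bigD1 [ffun k => W k]) //= wedge_self // expr1n ltr_pwDl ?ltr01 //.
  by apply: sumr_ge0 => s _; rewrite wedge_int -rmorphXn /= ler0z sqr_ge0.
pose zf0 (A : {ffun {ffun 'I_#|P| -> I} -> F^o}) : F :=
  N^-1 * \sum_(s : {ffun 'I_#|P| -> I}) wedge F W s * (A s : F).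
have zf0P (a : F) A B : zf0 (a *: A + B) = a * zf0 A + zf0 B.
  rewrite /zf0 mulrCA -mulrDr; congr (_ * _).
  rewrite mulr_sumr -big_split; apply: eq_bigr => s _ /=; rewrite !ffunE mulrDr.
  by rewrite mulrCA.
pose zf A : F^o := zf0 A.
have zf_lin : linear zf by move=> c A B; exact: zf0P.
have actE x : (forall b c, P b -> ad_coef x b c != 0 -> P c) ->
    act Z x omega = (\sum_(b | P b) ad_coef x b b) *: omega.
  move=> xP; rewrite act_powerE.
  suff E : power_act ad_coef x omega = (\sum_(b | P b) ad_coef x b b) *: (omega : {ffun {ffun
    'I_#|P| -> I} -> F^o}) by [].
  apply/ffunP => s; rewrite !ffunE -[RHS](wedge_act _ s xP).
  by apply: eq_bigr => k _; apply: eq_bigr => p _; rewrite ffunE.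
exists Z, omega, (linfun zf); split.
- split=> [t|gamma x gp xP]; last first.
    rewrite actE ?(trace0 gamma) ?scale0r //; first by case: gp.
    by move=> b c Pb /(ad_coef_weight xP); apply: Pup.
  have tP b c : ad_coef (vsval t) b c = wt b t * (c == b)%:R.
    by rewrite /ad_coef (split_wt D) linearZ /= (coordX D).
  rewrite actE => [|b c Pb]; last first.
    by rewrite tP; have [->//|_] := eqVneq c b; rewrite mulr0 eqxx.
  rewrite sum_lfunE; congr (_ *: _).
  by apply: eq_bigr => b _; rewrite tP eqxx mulr1.
- rewrite (linfun_linear zf_lin) /zf /zf0.
  rewrite (eq_bigr (fun s => wedge F W s ^+ 2)) ?mulVf // => s _.
  by rewrite ffunE expr2.
move=> gamma y gp yP u; rewrite (linfun_linear zf_lin) /zf /zf0 act_powerE.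
under eq_bigr => s _ do rewrite ffunE.
rewrite power_act_transpose big1 ?mulr0 // => s _.
rewrite (wedge_act (fun b c => ad_coef y c b)).
  by rewrite (trace0 (- gamma)) // ?oppr_eq0 ?mul0r ?mulr0 //; case: gp.
move=> b c Pb /(ad_coef_weight yP) bE; apply: (Pup b c gamma) => //.
by rewrite bE addrA subrr add0r.
Qed.

Lemma eq_coroot alpha beta : (forall i, alpha (coroot Pi i) = beta (coroot Pi i)) ->
  alpha = beta.
Proof.
move=> ab; apply/eqP; rewrite -subr_eq0; apply/eqP/(weight_form_nondeg Pi_basis fw_fund) => mu.
rewrite (sum_coord_simple Pi_basis mu) weight_formC weight_form_suml big1 // => i _.
rewrite weight_formZl weight_formC;
  suff -> : weight_form (alpha - beta) (tnth Pi i) = 0 by rewrite mulr0.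
have := corootE D (alpha - beta) i; rewrite add_lfunE opp_lfunE ab subrr /pairing => /esym/eqP.
rewrite !mulf_eq0 invr_eq0 pnatr_eq0 /= (negPf (weight_form_simple_neq0 fw_fund i)) orbF.
by move/eqP.
Qed.

Lemma fw_coroot i j : tnth fw i (coroot Pi j) = (i == j)%:R.
Proof. by rewrite (corootE D) fw_fund. Qed.

(** Take the wedge of the nilradical of the [j]-th maximal parabolic subalgebra.
    For [i != j] it is stable under the [i]-th copy of [sl2], so the trace of [h_i]
    is zero, while the trace of [h_j] is at least that on all of [n^+]. *)
Lemma admissible_fw j : exists2 k : nat, (0 < k)%N & admissible (tnth fw j *+ k).
Proof.
pose P b := 0 < co j (wt b).
have wP : admissible (\sum_(b | P b) wt b).
  apply: admissible_wedge => b c gamma; rewrite /P => cb gp ->.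
  by rewrite linearD /= ltr_wpDl // (pos_coord D).
set tau := \sum_(b | P b) wt b in wP.
have tau0 i : i != j -> tau (coroot Pi i) = 0.
  move=> nij; rewrite /tau sum_lfunE; apply: (coroot_trace0 D) => b c; rewrite /P => cb ->.
    by rewrite linearD /= (coord_simple Pi_base) eq_sym (negPf nij) addr0.
  by rewrite linearB /= (coord_simple Pi_base) eq_sym (negPf nij) subr0.
have tau_gt0 : 0 < tau (coroot Pi j).
  apply: lt_le_trans (rho2_coroot D j) _; rewrite /rho2 !sum_lfunE.
  rewrite (bigID P) /= -[leRHS]addr0; apply: lerD.
    rewrite (eq_bigl P) // => b; rewrite andb_idl //; exact: (wt_pos_coord D).
  rewrite -oppr_ge0 -sumrN; apply: sumr_ge0 => b /andP[hb nb].
  have cj : co j (wt b) = 0.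
    have := pos_coord D j (elimT (wt_ht_pos D b) hb).
    by rewrite le0r => /orP[/eqP//|cj]; rewrite /P cj in nb.
  rewrite {1}(sum_coord_simple Pi_basis (wt b)) sum_lfunE -sumrN; apply: sumr_ge0 => i _.
  have [->|nij] := eqVneq i j; first by rewrite cj scale0r lfunE oppr0.
  have [k kE] := coroot_simple_le0 D nij.
  by rewrite scale_lfunE kE -[_ *: _]/(_ * _) mulrN opprK mulr_ge0 ?ler0n ?(pos_coord D) //;
    apply/(wt_ht_pos D).
have [k kE] : exists k : nat, tau (coroot Pi j) = k%:R.
  have [z zE] : exists z : int, tau (coroot Pi j) = z%:~R.
    have /fin_all_exists[zb zbE] := fun b => wt_coroot_int D b j.
    exists (\sum_(b | P b) zb b); rewrite /tau sum_lfunE rmorph_sum /=.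
    by apply: eq_bigr => b _; rewrite zbE.
  case: z zE => [k|k] zE; first by exists k.
  by move: tau_gt0; rewrite zE ltr0z.
exists k; first by move: tau_gt0; rewrite kE ltr0n.
suff -> : tnth fw j *+ k = tau by [].
apply: eq_coroot => i; rewrite -scaler_nat scale_lfunE fw_coroot eq_sym.
have [->|nij] := eqVneq i j; first by rewrite kE -[_ *: _]/(_ * _) mulr1.
by rewrite tau0 // scaler0.
Qed.

End HighestWeights.

Lemma poly_eq0_nat (F : numClosedFieldType) (p : {poly F}) m :
  (forall n, (m <= n)%N -> p.[n%:R] = 0) -> p = 0.
Proof.
move=> p0; apply/eqP/negPn/negP => pn0.
pose rs : seq F := [seq n%:R | n <- iota m (size p)].
have urs : uniq rs by rewrite map_inj_uniq ?iota_uniq // => i j /eqP; rewrite eqr_nat => /eqP.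
have prs : all (root p) rs.
  by apply/allP => x /mapP[n]; rewrite mem_iota => /andP[mn _] ->; rewrite rootE p0.
by have := max_poly_roots pn0 prs urs; rewrite size_map size_iota ltnn.
Qed.

(** * Words in lowering operators *)
Section Words.
Variables (F : numClosedFieldType) (g : lieAlgType F) (H : {vspace g}).
Variables (l : nat) (Pi fw : l.-tuple 'Hom(subvs_of H, F^o)).
Variables (X : (\dim {:g}).-tuple g) (wt : 'I_(\dim {:g}) -> 'Hom(subvs_of H, F^o)).
Hypothesis D : split_setting Pi fw X wt.
Local Notation dual := 'Hom(subvs_of H, F^o).
Local Notation pos := (pos Pi).
Local Notation co i beta := (coord Pi i beta).
Local Notation highest := (highest Pi).
Implicit Types (alpha beta gamma delta mu tau : dual) (x y z : g) (i j : 'I_l).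
Implicit Types (M Z : lieModule g) (s : F).

Let Pi_base := split_base D.
Let Pi_basis : basis_of fullv Pi. Proof. by case: Pi_base. Qed.

(** Formal elements of [F[s] (x) U(n^-)]: combinations of words in weight
    vectors of [n^-] whose coefficients are polynomials in a parameter [s]. *)
Inductive expr :=
  | One
  | Zero
  | Act of dual & g & expr
  | Lin of {poly F} & expr & expr.
Implicit Types e : expr.

Fixpoint eval s M (v : M) e : M :=
  match e with
  | One => v
  | Zero => 0
  | Act _ y e1 => act M y (eval s v e1)
  | Lin q e1 e2 => q.[s] *: eval s v e1 + eval s v e2
  end.

Fixpoint deg delta e : Prop :=
  match e with
  | One => delta = 0
  | Zero => True
  | Act gamma y e1 => [/\ pos (- gamma), weight_vec gamma y & deg (delta - gamma) e1]
  | Lin _ e1 e2 => deg delta e1 /\ deg delta e2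
  end.

Fixpoint freeze s e : expr :=
  match e with
  | One => One
  | Zero => Zero
  | Act gamma y e1 => Act gamma y (freeze s e1)
  | Lin q e1 e2 => Lin (q.[s])%:P (freeze s e1) (freeze s e2)
  end.

Fixpoint param_free e : Prop :=
  match e with
  | Act _ _ e1 => param_free e1
  | Lin q e1 e2 => [/\ exists a, q = a%:P, param_free e1 & param_free e2]
  | _ => True
  end.

Lemma eval_freeze s s' M (v : M) e : eval s' v (freeze s e) = eval s v e.
Proof. by elim: e => //= [gamma y e ->|q e1 -> e2 ->]; rewrite ?hornerC. Qed.

Lemma deg_freeze s delta e : deg delta e -> deg delta (freeze s e).
Proof.
elim: e delta => //= [gamma y e IHe|q e1 IH1 e2 IH2] delta; first by case=> *; split; auto.
by case=> *; split; auto.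
Qed.

Lemma param_free_freeze s e : param_free (freeze s e).
Proof. by elim: e => //= q e1 IH1 e2 IH2; split=> //; exists q.[s]. Qed.

Lemma eval_param_free s s' M (v : M) e : param_free e -> eval s v e = eval s' v e.
Proof.
elim: e => //= [gamma y e IHe /IHe->|q e1 IH1 e2 IH2 [[a ->] /IH1-> /IH2->]] //.
by rewrite !hornerC.
Qed.

Lemma eval_weight s M mu delta (v : M) e : deg delta e -> mod_weight mu v ->
  mod_weight (delta + mu) (eval s v e).
Proof.
move=> + vP; elim: e delta => //= [delta ->|delta _ t|gamma y e IHe delta [_ yP /IHe eP]|q e1
  IH1 e2 IH2 delta [/IH1 d1 /IH2 d2] t].
- by rewrite add0r.
- by rewrite linear0 scaler0.
- by have := mod_weight_act eP yP; rewrite addrA [gamma + _]addrC subrK.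
by rewrite linearD linearZ /= d1 d2 scalerDr !scalerA mulrC.
Qed.

(** The raising operators act on highest weight modules along the line
    [lam + s tau] by formal operations: commute the operator to the right. *)
Lemma normal_form lam tau e delta gamma x : deg delta e -> weight_vec gamma x ->
  exists e', deg (delta + gamma) e' /\ forall s M (v : M),
    highest (lam + s *: tau) v -> act M x (eval s v e) = eval s v e'.
Proof.
elim: e delta gamma x => /= [|||] .
- move=> _ gamma x -> xP; rewrite add0r.
  have [->|xn0] := eqVneq x 0.
    by exists Zero; split=> //= s M v _; rewrite act0l.
  have [g0|gp|gp] := root_sign D xP xn0.
  + pose t := vsproj H x; have tE : vsval t = x.
      by apply/vsprojK/(split_zero D); rewrite -g0.
    exists (Lin (lam t)%:P One (Lin ((tau t) *: 'X) One Zero)); split=> /= [|s M v [vP _]];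
      first by rewrite g0.
    rewrite -tE vP add_lfunE scale_lfunE hornerC hornerZ hornerX addr0 -scalerDl;
      congr (_ *: _).
    by congr (_ + _); rewrite -[_ *: _]/(_ * _) mulrC.
  + by exists Zero; split=> //= s M v [_ v0]; apply: v0 gp xP.
  by exists (Act gamma x One); split=> //=; rewrite subrr.
- by move=> delta gamma x _ _; exists Zero; split=> //= s M v _; rewrite linear0.
- move=> gamma y e IHe delta gamma' x [gp yP eP] xP.
  have [e1 [d1 E1]] := IHe _ _ _ eP xP.
  have [e2 [d2 E2]] := IHe _ _ _ eP (weight_vec_bracket xP yP).
  exists (Lin 1 (Act gamma y e1) e2); split=> /= [|s M v vP].
    split; first by split; rewrite // addrAC.
    by move: d2; rewrite addrA addrAC subrK.
  by rewrite hornerC scale1r act_comm (E1 s) // (E2 s).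
move=> q e1 IH1 e2 IH2 delta gamma x [d1 d2] xP.
have [e1' [d1' E1]] := IH1 _ _ _ d1 xP; have [e2' [d2' E2]] := IH2 _ _ _ d2 xP.
exists (Lin q e1' e2'); split=> //= s M v vP.
by rewrite linearD linearZ /= E1 // E2.
Qed.

(** A simple raising operator [e_i] only sees the value of the highest weight
    on the coroot of [i], so no parameter appears when that value is fixed. *)
Lemma normal_form_simple lam tau i e delta x :
  tau (coroot Pi i) = 0 -> param_free e -> deg delta e -> weight_vec (tnth Pi i) x ->
  exists e', [/\ deg (delta + tnth Pi i) e', param_free e' & forall s M (v : M),
    highest (lam + s *: tau) v -> act M x (eval s v e) = eval s v e'].
Proof.
move=> tau0 + + xP.
have ip : pos (tnth Pi i).
  split; last by rewrite -subr_eq0 subr0; have [_ /(_ i)/andP[]] := Pi_base.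
  exists (fun j => (j == i) : nat); rewrite (bigD1 i) //= eqxx big1 ?addr0 // => j /negPf->.
  by rewrite mulr0n.
elim: e delta => /= [|||] .
- move=> delta _ ->; exists Zero; split=> //= s M v [_ v0].
  exact: v0 ip xP.
- by move=> delta _ _; exists Zero; split=> //= s M v _; rewrite linear0.
- move=> gamma y e IHe delta ce [gp yP eP].
  have [e1 [d1 c1 E1]] := IHe _ ce eP.
  have xyP := weight_vec_bracket xP yP.
  suff [e2 [d2 c2 E2]] : exists e2, [/\ deg (delta + tnth Pi i) e2, param_free e2
      & forall s M (v : M), highest (lam + s *: tau) v ->
          act M (bracket x y) (eval s v e) = eval s v e2].
    exists (Lin 1 (Act gamma y e1) e2); split=> /= [||s M v vP].
    - by split=> //; split; rewrite // addrAC.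
    - by split=> //; exists 1; rewrite polyC1.
    by rewrite hornerC scale1r act_comm (E1 s) // (E2 s).
  have [->|xyn0] := eqVneq (bracket x y) 0.
    by exists Zero; split=> //= s M v _; rewrite act0l.
  have deg_e : delta + tnth Pi i - (tnth Pi i + gamma) = delta - gamma.
    by rewrite opprD addrA addrK.
  have [g0|gp'|gp'] := root_sign D xyP xyn0.
  + have gE : gamma = - tnth Pi i by apply/eqP; rewrite -addr_eq0 addrC g0.
    pose q := 2 / weight_form (tnth Pi i) (tnth Pi i).
    have qn0 : q != 0 by rewrite mulf_neq0 ?pnatr_eq0 // invr_eq0 (weight_form_simple_neq0
      (split_fund D)).
    have bE : bracket x y = (killing x y / q) *: vsval (coroot Pi i).
      have -> : vsval (coroot Pi i) = q *: tvec (tnth Pi i) by rewrite /coroot linearZ.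
      by rewrite (bracket_opposite D xP (y := y)) -?gE // scalerA divfK.
    exists (Lin (killing x y / q * (delta - gamma + lam) (coroot Pi i))%:P e Zero).
    split=> /= [||s M v vP].
    - by split=> //; move: eP; rewrite gE opprK.
    - by split=> //; exists (killing x y / q * (delta - gamma + lam) (coroot Pi i)).
    rewrite bE actZl (eval_weight s eP vP.1) hornerC addr0 scalerA; congr (_ * _ *: _).
    by rewrite addrA [LHS]add_lfunE scale_lfunE tau0 scaler0 addr0.
  + (* A positive [alpha_i + gamma] with [- gamma] positive would make [- gamma]
       a proper part of [alpha_i]. *)
    exfalso; case: gp => gn gn0; case: gp' => gn' gn0'.
    have gco j : co j gamma = 0 \/ (j = i /\ co j gamma = - 1).
      have [k] := coord_nneg D j gn; have [k'] := coord_nneg D j gn'.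
      rewrite linearD linearN /= (coord_simple Pi_base) => kE' /(canRL opprK) kE.
      have : ((j == i) = k + k' :> nat)%N.
        by apply/eqP; rewrite -(eqr_nat F) natrD -kE' kE addrCA subrr addr0.
      case: eqVneq => [ji|_]; case: k kE => [|[|k]] // -> _; try by left; rewrite oppr0.
      by right.
    have gE : gamma = co i gamma *: tnth Pi i.
      rewrite {1}(sum_coord_simple Pi_basis gamma) (bigD1 i) //= big1 ?addr0 // => j nji.
      by case: (gco j) => [->|[ji]]; rewrite ?scale0r // ji eqxx in nji *.
    case: (gco i) => [c0|[_ cN1]].
      by move/negP: gn0; apply; rewrite gE c0 scale0r oppr0.
    by move/negP: gn0'; apply; rewrite gE cN1 scaleN1r subrr.
  exists (Act (tnth Pi i + gamma) (bracket x y) e).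
  by split=> //; split=> //; rewrite deg_e.
move=> q e1 IH1 e2 IH2 delta [[a qE] c1 c2] [d1 d2].
have [e1' [d1' c1' E1]] := IH1 _ c1 d1; have [e2' [d2' c2' E2]] := IH2 _ c2 d2.
exists (Lin q e1' e2'); split=> //= [|s M v vP]; first by split=> //; exists a.
by rewrite linearD linearZ /= E1 // E2.
Qed.

Lemma nneg_combinationD alpha beta : nneg_combination Pi alpha -> nneg_combination Pi beta ->
  nneg_combination Pi (alpha + beta).
Proof.
move=> [k ->] [k' ->]; exists (fun i => k i + k' i)%N; rewrite -big_split.
by apply: eq_bigr => i _; rewrite mulrnDr.
Qed.

Lemma nneg_combination0 : nneg_combination Pi 0.
Proof. by exists (fun _ => 0%N); rewrite big1. Qed.

Lemma posD alpha beta : nneg_combination Pi alpha -> pos beta -> pos (alpha + beta).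
Proof.
move=> an [bn bn0]; split; first exact: nneg_combinationD.
have := pos_ht D (conj bn bn0).
have [->|an0] := eqVneq alpha 0; first by rewrite add0r.
move=> hb; apply: contraTneq (addr_gt0 (pos_ht D (conj an an0)) hb) => ab0.
by rewrite -htD ab0 /height big1 ?ltxx // => i _; rewrite linear0.
Qed.

(** Lowering words have degree in the negative cone, and only combinations of the
    empty word have degree zero. *)
Lemma deg_trivial delta e : deg delta e ->
  (forall s M (v : M), eval s v e = 0) \/
  (nneg_combination Pi (- delta) /\
   (delta = 0 -> exists q : {poly F}, forall s M (v : M), eval s v e = q.[s] *: v)).
Proof.
elim: e delta => /= [|||] .
- move=> delta ->; right; split; first by rewrite oppr0; exact: nneg_combination0.
  by move=> _; exists 1 => s M v; rewrite hornerC scale1r.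
- by left.
- move=> gamma y e IHe delta [gp yP /IHe[e0|[en _]]].
    by left=> s M v; rewrite e0 linear0.
  have [dn dn0] : pos (- delta).
    rewrite (_ : - delta = - (delta - gamma) + - gamma); first exact: posD.
    by rewrite opprB addrC addrA addNr add0r.
  by right; split=> // d0; rewrite d0 oppr0 eqxx in dn0.
move=> q e1 IH1 e2 IH2 delta [/IH1 d1 /IH2 d2].
case: d1 => [d1|[n1 d1]]; case: d2 => [d2|[n2 d2]].
- by left=> s M v; rewrite d1 d2 scaler0 addr0.
- right; split=> // /d2[p pE]; exists p => s M v.
  by rewrite d1 scaler0 add0r pE.
- right; split=> // /d1[p pE]; exists (q * p) => s M v.
  by rewrite d2 addr0 pE scalerA hornerM.
right; split=> // d0; have [p1 E1] := d1 d0; have [p2 E2] := d2 d0.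
exists (q * p1 + p2) => s M v.
by rewrite E1 E2 scalerA hornerD hornerM scalerDl.
Qed.

Lemma eval_poly M (v : M) e : exists p : 'I_(\dim {:M}) -> {poly F},
  forall s k, coord (vbasis {:M}) k (eval s v e) = (p k).[s].
Proof.
elim: e => /= [|||].
- by exists (fun k => (coord (vbasis {:M}) k v)%:P) => s k; rewrite hornerC.
- by exists (fun _ => 0) => s k; rewrite linear0 horner0.
- move=> gamma y e [p pE].
  exists (fun k => \sum_(r < \dim {:M}) (coord (vbasis {:M}) k (act M y (vbasis {:M})`_r)) *:
    p r) => s k.
  rewrite (coord_vbasis (memvf (eval s v e))) !linear_sum horner_sum; apply: eq_bigr => r _.
  by rewrite !linearZ /= hornerZ pE mulrC.
move=> q e1 [p1 E1] e2 [p2 E2]; exists (fun k => q * p1 k + p2 k) => s k.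
by rewrite linearD linearZ /= E1 E2 hornerD hornerM.
Qed.

(** The coordinates of the value are polynomials in the parameter. *)
Lemma eval_vanish M (v : M) e m :
  (forall n, (m <= n)%N -> eval n%:R v e = 0) -> forall s, eval s v e = 0.
Proof.
have [p pE] := eval_poly v e; move=> e0 s.
rewrite (coord_vbasis (memvf (eval s v e))) big1 // => k _; rewrite pE.
rewrite (@poly_eq0_nat _ (p k) m) ?horner0 ?scale0r // => n mn.
by rewrite -pE e0 // linear0.
Qed.

(** Contraction commutes with every letter, each of them lying in [n^-]. *)
Lemma eval_contract M (v : M) Z (z : Z) (zeta : 'Hom(Z, F^o)) delta e s :
  (forall gamma y, pos gamma -> weight_vec (- gamma) y -> forall u, zeta (act Z y u) = 0) ->
  zeta z = 1 -> deg delta e ->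
  contract zeta (eval s (pure_tensor v z) e) = eval s v e.
Proof.
move=> n0 z1; elim: e delta => /= [delta _|delta _|gamma y e IHe delta [gp yP /IHe eP]|q e1
  IH1 e2 IH2 delta [/IH1 d1 /IH2 d2]].
- by rewrite contract_pure z1 scale1r.
- by rewrite /contract big1 // => k _; rewrite ffunE scaler0.
- rewrite contract_act ?eP // => u; apply: (n0 (- gamma)) => //.
  by rewrite opprK.
by rewrite contract_linear d1 d2.
Qed.

End Words.

(** * The Casimir operator *)
Section Casimir.
Variables (F : numClosedFieldType) (g : lieAlgType F) (H : {vspace g}).
Variables (l : nat) (Pi fw : l.-tuple 'Hom(subvs_of H, F^o)).
Variables (X : (\dim {:g}).-tuple g) (wt : 'I_(\dim {:g}) -> 'Hom(subvs_of H, F^o)).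
Hypothesis D : split_setting Pi fw X wt.
Local Notation dual := 'Hom(subvs_of H, F^o).
Local Notation I := 'I_(\dim {:g}).
Local Notation ht := (height Pi).
Local Notation pos := (pos Pi).
Local Notation highest := (highest Pi).
Implicit Types (alpha beta gamma delta mu tau : dual) (x y z : g) (b c : I) (i j : 'I_l).
Implicit Types (M Z : lieModule g) (s : F).

Let Pi_base := split_base D.
Let fw_fund := split_fund D.
Let Pi_basis : basis_of fullv Pi. Proof. by case: Pi_base. Qed.

(** The scalar by which the Casimir operator acts on a highest weight vector. *)
Definition casimir_scalar mu : F := weight_form mu mu + weight_form mu (rho2 Pi wt).

(** With [X_b] and [Xd_b] dual bases of weight vectors, [Omega] is the sum of the
    [X_b Xd_b].  In each term the raising factor is moved to the right, which
    produces [2 rho] from the commutators. *)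
Lemma casimir : exists (P : pred I) (x y : I -> g) (gamma : I -> dual),
  (forall b, P b -> [/\ pos (gamma b),
    weight_vec (gamma b) (x b) & weight_vec (- gamma b) (y b)]) /\
  forall M, exists Omega : 'End(M),
    (forall z w, Omega (act M z w) = act M z (Omega w)) /\
    forall mu (w : M), mod_weight mu w ->
      Omega w = casimir_scalar mu *: w + \sum_(b | P b) act M (y b) (act M (x b) w).
Proof.
have /fin_all_exists[Xd XdP] := dual_vector D.
have XdE b x : killing (Xd b) x = coord X b x by case: (XdP b).
have XdW b : weight_vec (- wt b) (Xd b) by case: (XdP b).
have sumX x : x = \sum_b killing (Xd b) x *: tnth X b.
  by rewrite {1}(sum_coordX D x); apply: eq_bigr => b _; rewrite XdE.
have sumXd x : x = \sum_b killing (tnth X b) x *: Xd b.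
  apply/eqP; rewrite -subr_eq0; apply/eqP/(split_killing D) => y.
  rewrite killingDl -scaleN1r killingZl killing_suml mulN1r.
  rewrite [in X in X - _](sumX y) killing_sumr -sumrB big1 // => b _.
  by rewrite killingZl killingZr [killing x _]killingC mulrC subrr.
pose hi b := 0 < ht (wt b).
(* In each dual pair, [x b] is the raising factor and [y b] the lowering one. *)
pose x b := if hi b then tnth X b else Xd b.
pose y b := if hi b then Xd b else tnth X b.
pose gamma b := if hi b then wt b else - wt b.
exists (fun b => wt b != 0), x, y, gamma; split=> [b bn0|M].
  rewrite /x /y /gamma /hi; case: ifP => [hb|nb].
    by split; [exact/(wt_ht_pos D) | exact: split_wt D b | exact: XdW].
  split; [|exact: XdW | by rewrite opprK; exact: split_wt D b].
  have [b0|bp|//] := root_sign D (split_wt D b) (X_neq0 D b); first by rewrite b0 eqxx in bn0.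
  by rewrite (pos_ht D bp) in nb.
pose om (w : M) := \sum_b act M (tnth X b) (act M (Xd b) w).
have om_lin : linear om.
  move=> a u v; rewrite /om scaler_sumr -big_split; apply: eq_bigr => b _ /=.
  by rewrite !linearP.
exists (linfun om); split=> [z w|mu w wP]; rewrite !(linfun_linear om_lin).
  have -> : act M z (om w) = om (act M z w) + \sum_b
      (act M (tnth X b) (act M (bracket z (Xd b)) w)
       + act M (bracket z (tnth X b)) (act M (Xd b) w)).
    rewrite /om linear_sum -big_split; apply: eq_bigr => b _ /=.
    by rewrite act_comm [act M z (act M (Xd b) w)]act_comm linearD /= -addrA.
  rewrite big_split /= -[LHS]addr0; congr (_ + _).
  have -> : \sum_b act M (tnth X b) (act M (bracket z (Xd b)) w)
      = \sum_b \sum_c killing (tnth X c) (bracket z (Xd b)) *: act M (tnth X b) (act M (Xd c)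
        w).
    apply: eq_bigr => b _; rewrite {1}(sumXd (bracket z (Xd b))) act_suml linear_sum.
    by apply: eq_bigr => c _; rewrite actZl linearZ.
  have -> : \sum_b act M (bracket z (tnth X b)) (act M (Xd b) w)
      = \sum_b \sum_c killing (Xd c) (bracket z (tnth X b)) *: act M (tnth X c) (act M (Xd b)
        w).
    apply: eq_bigr => b _; rewrite {1}(sumX (bracket z (tnth X b))) act_suml.
    by apply: eq_bigr => c _; rewrite actZl.
  rewrite [X in _ + X]exchange_big -big_split big1 // => b _ /=.
  rewrite -big_split big1 // => c _ /=; rewrite -scalerDl.
  rewrite -killing_inv [bracket (tnth X c) z]bracketC -scaleN1r killingZl mulN1r.
  by rewrite killingC addNr scale0r.
rewrite /om (bigID (fun b => wt b != 0)) /= addrC.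
have zero_part : \sum_(b | ~~ (wt b != 0)) act M (tnth X b) (act M (Xd b) w) = weight_form mu
  mu *: w.
  have HX b : wt b = 0 -> exists t : subvs_of H, tnth X b = vsval t.
    move=> b0; exists (vsproj H (tnth X b)); rewrite vsprojK //.
    by apply/(split_zero D); rewrite -b0; apply: split_wt D b.
  have HXd b : wt b = 0 -> exists t : subvs_of H, Xd b = vsval t.
    move=> b0; exists (vsproj H (Xd b)); rewrite vsprojK //.
    by apply/(split_zero D); have := XdW b; rewrite b0 oppr0.
  have -> : weight_form mu mu = \sum_(b | ~~ (wt b != 0)) killing (Xd b) (tvec mu) * killing
    (tvec mu) (tnth X b).
    rewrite /weight_form -/(tvec mu) {2}(sumX (tvec mu)) killing_sumr (bigID (fun b =>
      wt b != 0)) /=.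
    rewrite big1 ?add0r => [|b bn0]; last first.
      have t0 : weight_vec (0 : dual) (tvec mu) by apply/(split_zero D)/subvsP.
      by rewrite (killing_weight (XdW b) t0) ?scale0r ?killing0r // addr0 oppr_eq0.
    by apply: eq_bigr => b _; rewrite killingZr.
  rewrite scaler_suml; apply: eq_bigr => b; rewrite negbK => /eqP b0.
  have [t tE] := HX b b0; have [t' t'E] := HXd b b0.
  rewrite tE t'E wP linearZ /= wP scalerA; congr (_ *: _); rewrite /tvec.
  by rewrite [killing (vsval t') _]killingC !(killing_sharpE Pi_basis fw_fund).
rewrite zero_part /casimir_scalar scalerDl -addrA; congr (_ + _).
have -> : weight_form mu (rho2 Pi wt) *: w = \sum_(b | wt b != 0) (if hi b then weight_form
  mu (wt b) else 0) *: w.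
  rewrite /rho2 weight_formC weight_form_suml scaler_suml.
  rewrite big_mkcond [RHS]big_mkcond; apply: eq_bigr => b _ /=; rewrite weight_formC -/(hi b).
  case: eqVneq => [b0|_] /=; last by case: ifP; rewrite ?scale0r.
  by rewrite /hi b0 /height big1 ?ltxx // => i _; rewrite linear0.
rewrite -big_split; apply: eq_bigr => b bn0 /=; rewrite /x /y; case: ifP => hb;
  last by rewrite scale0r add0r.
rewrite act_comm addrC; congr (_ + _).
rewrite (bracket_opposite D (split_wt D b) (XdW b)) killingC XdE (coordX D) eqxx scale1r.
by rewrite /tvec wP (weight_formE Pi_basis fw_fund).
Qed.

(** [Omega] acts on all values of words on a highest weight vector by the same
    scalar, which is compared with its expression on the weight [delta + mu]. *)
Lemma casimir_relation : exists (P : pred I) (x y : I -> g) (gamma : I -> dual),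
  (forall b, P b -> [/\ pos (gamma b),
    weight_vec (gamma b) (x b) & weight_vec (- gamma b) (y b)]) /\
  forall M mu (v : M) delta (e : expr H) s, highest mu v -> deg Pi delta e ->
    (casimir_scalar mu - casimir_scalar (delta + mu)) *: eval s v e
    = \sum_(b | P b) act M (y b) (act M (x b) (eval s v e)).
Proof.
have [P [x [y [gamma [Pxy cas]]]]] := casimir; exists P, x, y, gamma;
  split=> // M mu v delta e s [vP v0] eP.
have [Omega [Oact Ow]] := cas M.
have Oeval e' : Omega (eval s v e') = casimir_scalar mu *: eval s v e'.
  elim: e' => /= [||gamma' y' e' IHe|q e1 IH1 e2 IH2].
  - rewrite (Ow mu) // big1 ?addr0 // => b /Pxy[gp xP _].
    by rewrite (v0 _ _ gp xP) linear0.
  - by rewrite linear0 scaler0.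
  - by rewrite Oact IHe linearZ.
  by rewrite linearD linearZ /= IH1 IH2 scalerDr !scalerA mulrC.
rewrite scalerBl -Oeval (Ow _ _ (eval_weight s eP vP)).
by rewrite addrC addKr.
Qed.

End Casimir.

(** * Persistence of relations *)
Section Relations.
Variables (F : numClosedFieldType) (g : lieAlgType F) (H : {vspace g}).
Variables (l : nat) (Pi fw : l.-tuple 'Hom(subvs_of H, F^o)).
Variables (X : (\dim {:g}).-tuple g) (wt : 'I_(\dim {:g}) -> 'Hom(subvs_of H, F^o)).
Hypothesis D : split_setting Pi fw X wt.
Local Notation dual := 'Hom(subvs_of H, F^o).
Local Notation I := 'I_(\dim {:g}).
Local Notation ht := (height Pi).
Local Notation pos := (pos Pi).
Local Notation co i beta := (coord Pi i beta).
Local Notation highest := (highest Pi).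
Local Notation deg := (deg Pi).
Local Notation expr := (expr H).
Implicit Types (alpha beta gamma delta mu tau : dual) (x y z : g) (b c : I) (i j : 'I_l).
Implicit Types (M Z : lieModule g) (s : F) (e : expr).

Let Pi_base := split_base D.
Let fw_fund := split_fund D.
Let Pi_basis : basis_of fullv Pi. Proof. by case: Pi_base. Qed.

Lemma weight_form_simpleE mu i :
  weight_form mu (tnth Pi i) = mu (coroot Pi i) * (weight_form (tnth Pi i) (tnth Pi i) / 2).
Proof.
rewrite (corootE D) /pairing; have n0 := weight_form_simple_neq0 fw_fund i.
move: (weight_form mu _) n0 => p; move: (weight_form _ _) => q n0.
by field; rewrite n0.
Qed.

Lemma casimir_scalarB mu delta :
  casimir_scalar Pi wt mu - casimir_scalar Pi wt (delta + mu)
  = - (2 * weight_form mu delta + weight_form delta delta + weight_form (rho2 Pi wt) delta).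
Proof.
rewrite /casimir_scalar !weight_formDl !weight_formDr [weight_form delta mu]weight_formC.
by rewrite [weight_form delta (rho2 _ _)]weight_formC; ring.
Qed.

(** With [- delta = sum_i k_i alpha_i] the difference is
    [sum_i k_i (2 mu(h_i) + delta(h_i) + 2 rho(h_i)) (alpha_i, alpha_i) / 2].
    Outside [J], the first two terms are [mu(h_i) + (mu + delta)(h_i)]; in [J],
    one has [delta(h_j) >= - 2 k_j >= - 2 mu(h_j)]. *)
Lemma casimir_scalar_gt0 (J : {set 'I_l}) mu delta :
  nneg_combination Pi (- delta) -> delta != 0 ->
  (forall i, i \notin J -> 0 <= mu (coroot Pi i)) ->
  (forall i, i \notin J -> 0 <= (delta + mu) (coroot Pi i)) ->
  (forall j, j \in J -> - co j delta <= mu (coroot Pi j)) ->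
  0 < casimir_scalar Pi wt mu - casimir_scalar Pi wt (delta + mu).
Proof.
move=> dn dn0 muJ' dmuJ' muJ.
have kP i : 0 <= - co i delta by have [k] := coord_nneg D i dn; rewrite linearN => ->;
  rewrite ler0n.
pose q i := weight_form (tnth Pi i) (tnth Pi i) / 2.
pose B i := 2 * mu (coroot Pi i) + delta (coroot Pi i) + rho2 Pi wt (coroot Pi i).
have -> : casimir_scalar Pi wt mu - casimir_scalar Pi wt (delta + mu)
    = \sum_i (- co i delta) * (B i * q i).
  have E nu : weight_form nu delta = \sum_i co i delta * (nu (coroot Pi i) * q i).
    rewrite {1}(sum_coord_simple Pi_basis delta) weight_formC weight_form_suml.
    by apply: eq_bigr => i _; rewrite weight_formZl weight_formC weight_form_simpleE.
  rewrite casimir_scalarB !E mulr_sumr -!big_split -sumrN; apply: eq_bigr => i _ /=.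
  rewrite /B; move: (co i delta) (mu _) (delta _) (rho2 _ _ _) (q i) => a1 a2 a3 a4 a5.
  by ring.
have BP i : 0 < B i.
  have r0 := rho2_coroot D i; rewrite /B.
  have [iJ|niJ] := boolP (i \in J); last first.
    rewrite ltr_wpDl // mulr2n mulrDl mul1r -addrA addr_ge0 ?muJ' //.
    by have := dmuJ' i niJ; rewrite add_lfunE addrC.
  rewrite ltr_wpDl //.
  have : 0 <= 2 * (mu (coroot Pi i) + co i delta).
    by rewrite mulr_ge0 ?ler0n // -(opprK (co i delta)) subr_ge0 muJ.
  rewrite mulrDr => /le_trans; apply; rewrite lerD2l.
  rewrite {2}(sum_coord_simple Pi_basis delta) sum_lfunE (bigD1 i) //=.
  rewrite scale_lfunE (coroot_simple D) -[_ *: _]/(_ * _) mulrC lerDl; apply: sumr_ge0 => j nji.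
  have [k kE] := coroot_simple_le0 D nji.
  by rewrite scale_lfunE kE -[_ *: _]/(_ * _) mulrN -mulNr mulr_ge0 ?ler0n ?kP.
have qP i : 0 < q i by rewrite divr_gt0 ?ltr0n // (weight_form_simple_gt0 D).
have dp : pos (- delta) by split; rewrite // oppr_eq0.
have [i iP] := pos_exists_coord D dp.
rewrite (bigD1 i) //= ltr_pwDl //.
  by apply: mulr_gt0; [move: iP; rewrite linearN | apply: mulr_gt0].
by apply: sumr_ge0 => j _; apply: mulr_ge0 => //; apply/ltW/mulr_gt0.
Qed.

Lemma pos_ht_ge1 gamma : pos gamma -> 1 <= ht gamma.
Proof.
move=> gp; have /fin_all_exists[k kE] : forall i, exists k : nat, co i gamma = k%:R.
  by move=> i; case: gp => /(coord_nneg D i).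
have hE : ht gamma = (\sum_i k i)%:R.
  by rewrite natr_sum; apply: eq_bigr => i _; rewrite kE.
by have := pos_ht D gp; rewrite hE ltr0n ler1n.
Qed.

Definition sum_expr (r : seq (dual * g * expr)) : expr :=
  foldr (fun p e => Lin 1 (Act p.1.1 p.1.2 p.2) e) (Zero H) r.

Lemma eval_sum_expr s M (v : M) r :
  eval s v (sum_expr r) = \sum_(p <- r) act M p.1.2 (eval s v p.2).
Proof.
elim: r => [|p r IHr] /=; first by rewrite big_nil.
by rewrite big_cons IHr hornerC scale1r.
Qed.

(** Relations of the highest weight vector of [V] of weight [lam], in degrees
    bounded on [J] by [lam], persist for every highest weight vector of weight
    [lam + m tau], for [tau] supported on [J].

    Let [u] be such a relation.  Raising it gives relations in smaller degree,
    which persist by induction.  The Casimir relation makes [c(n) u] a sum of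
    lowered raisings of [u] in weight [lam + n tau]; by contraction this holds
    in the given module for all large [n], hence at [n = 0], where the raisings
    vanish.  So [c(0) u = 0], and [c(0) > 0] by dominance. *)
Lemma relations_persist (V : lieModule g) lam tau (J : {set 'I_l}) (v0 : V) :
  highest lam v0 -> v0 != 0 -> admissible Pi tau ->
  (forall i, i \notin J -> tau (coroot Pi i) = 0) ->
  (forall i, i \notin J -> 0 <= lam (coroot Pi i)) ->
  forall e delta, param_free e -> deg delta e ->
    (forall j, j \in J -> - co j delta <= lam (coroot Pi j)) ->
    eval 0 v0 e = 0 ->
    forall m M (w : M), highest (lam + m%:R *: tau) w -> eval 0 w e = 0.
Proof.
move=> v0P v0n0 tauA tauJ lamJ e delta.
have [P [x [y [gamma [Pxy cas]]]]] := casimir_relation D.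
have v0P' : highest (lam + 0 *: tau) v0 by rewrite scale0r addr0.
suff main k : forall e delta, param_free e -> deg delta e -> - ht delta < k%:R ->
    (forall j, j \in J -> - co j delta <= lam (coroot Pi j)) ->
    eval 0 v0 e = 0 ->
    forall m M (w : M), highest (lam + m%:R *: tau) w -> eval 0 w e = 0.
  move=> ce de dJ e0 m M w wP.
  have [tr|[dn _]] := deg_trivial D de; first exact: tr.
  have [k kE] : exists k : nat, - ht delta = k%:R.
    have /fin_all_exists[k kE] : forall i, exists k : nat, co i (- delta) = k%:R.
      by move=> i; exact: (coord_nneg D i dn).
    exists (\sum_i k i)%N; rewrite -htN natr_sum.
    by apply: eq_bigr => i _; rewrite kE.
  by apply: (main k.+1 e delta _ _ _ _ _ m) => //; rewrite kE ltr_nat.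
elim: k => [|k IHk] {}e {}delta ce de hk dJ e0 m M w wP.
  have [tr|[dn _]] := deg_trivial D de; first exact: tr.
  have [d0|dn0] := eqVneq delta 0.
    by move: hk; rewrite d0 /height big1 ?oppr0 ?ltxx // => i _; rewrite linear0.
  have dp : pos (- delta) by split; rewrite // oppr_eq0.
  by have := pos_ht D dp; rewrite htN => /(lt_trans hk); rewrite ltxx.
have [tr|[dn scal]] := deg_trivial D de; first exact: tr.
have [d0|dn0] := eqVneq delta 0.
  have [q qE] := scal d0; move: e0; rewrite !qE => /eqP.
  by rewrite scaler_eq0 (negPf v0n0) orbF => /eqP->; rewrite scale0r.
(* Raising decreases the height of [- delta] by at least one and no
   coordinate of [- delta] increases. *)
have raise_ht gam : pos gam -> - ht (delta + gam) < k%:R.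
  move=> gp; rewrite htD opprD.
  have h1 := pos_ht_ge1 gp.
  rewrite -(ltrD2r 1) natr1; apply: le_lt_trans hk.
  by rewrite -addrA gerDl addrC subr_le0.
have raise_J gam j : pos gam -> j \in J -> - co j (delta + gam) <= lam (coroot Pi j).
  move=> gp jJ; apply: le_trans (dJ j jJ); rewrite linearD opprD /= gerDl oppr_le0.
  exact: (pos_coord D j gp).
have /fin_all_exists[eb ebP] b : exists eb, P b -> deg (delta + gamma b) eb /\
    forall s M (v : M), highest (lam + s *: tau) v -> act M (x b) (eval s v e) = eval s v eb.
  have [Pb|nPb] := boolP (P b); last by exists (Zero H).
  have [_ xP _] := Pxy b Pb.
  by have [e' e'P] := normal_form D lam tau de xP; exists e'.
have eb0 b : P b -> eval 0 w (eb b) = 0.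
  move=> Pb; have [gp xP _] := Pxy b Pb; have [db Eb] := ebP b Pb.
  rewrite -(eval_freeze 0 0); apply: (IHk _ (delta + gamma b) _ _ _ _ _ m) => //.
  - exact: param_free_freeze.
  - exact: deg_freeze.
  - exact: raise_ht.
  - by move=> j; apply: raise_J.
  by rewrite eval_freeze -Eb // e0 linear0.
apply/eqP/negPn/negP => u0.
(* If [u] is nonzero, then for [i] outside [J] it is killed by the raising
   operator of [i] and [sl2] theory bounds its weight. *)
have c_gt0 : 0 < casimir_scalar Pi wt lam - casimir_scalar Pi wt (delta + lam).
  apply: (casimir_scalar_gt0 (J := J)) => // i niJ.
  have [ei [fi [eP fP ef _ [he hf _]]]] := sl2_triple D i.
  have ip : pos (tnth Pi i).
    split; last by have [_ /(_ i)/andP[]] := Pi_base.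
    exists (fun j => (j == i) : nat); rewrite (bigD1 i) //= eqxx big1 ?addr0 // => j /negPf->.
    by rewrite mulr0n.
  have [e' [d' c' E']] := normal_form_simple D lam (tauJ i niJ) ce de eP.
  have ew0 : act M ei (eval 0 w e) = 0.
    rewrite (eval_param_free 0 m%:R) // E' // (eval_param_free m%:R 0) //.
    apply: (IHk _ (delta + tnth Pi i) _ _ _ _ _ m) => //.
    - exact: raise_ht.
    - by move=> j; apply: raise_J.
    by rewrite -E' // e0 linear0.
  have [n nE] := sl2_highest hf ef (eval_weight 0 de wP.1 (coroot Pi i)) ew0 u0.
  have : (delta + (lam + m%:R *: tau)) (coroot Pi i) = n%:R by exact: nE.
  rewrite !add_lfunE scale_lfunE tauJ // scaler0 addr0 => ->; exact: ler0n.
pose c (s : F) := casimir_scalar Pi wt (lam + s *: tau) - casimir_scalar Pi wt (delta + (lam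
  + s *: tau)).
have [cp cpE] : exists cp : {poly F}, forall s, c s = cp.[s].
  exists ((c 0)%:P + (- (2 * weight_form tau delta)) *: 'X) => s.
  rewrite hornerD hornerZ hornerX hornerC /c !casimir_scalarB !weight_formDl !weight_formZl.
  by ring.
(* The Casimir relation, with the parameter as a variable. *)
pose R := Lin cp e (Lin (- 1) (sum_expr [seq (- gamma b, y b, eb b) | b <- enum P]) (Zero H)).
have dR : deg delta R.
  split=> //; split=> //.
  have : forall b, b \in enum P -> P b by move=> b; rewrite mem_enum.
  elim: (enum P) => //= b r IHr rP; split; last first.
    by apply: IHr => b' b'r; apply: rP; rewrite inE b'r orbT.
  have /rP Pb : b \in b :: r by apply: mem_head.
  have [gp _ yP] := Pxy b Pb; have [db _] := ebP b Pb.
  by split; rewrite ?opprK.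
have evalR s M' (v : M') : eval s v R = c s *: eval s v e - \sum_(b | P b) act M' (y b) (eval
  s v (eb b)).
  by rewrite /= eval_sum_expr big_map big_enum /= hornerN hornerC scaleN1r addr0 cpE.
have R0 s M' (v : M') : highest (lam + s *: tau) v -> eval s v R = 0.
  move=> vP; rewrite evalR /c (cas M' _ v delta e s vP de) -sumrB big1 // => b Pb.
  by have [_ ->] := ebP b Pb; rewrite ?subrr.
(* Pass to weight [lam + n tau] by a tensor product and contract. *)
have Rn n : (m <= n)%N -> eval n%:R w R = 0.
  move=> mn; have [Z [z [zeta [zP z1 zn]]]] := admissibleMn (n - m) tauA.
  have hn : highest (lam + n%:R *: tau) (pure_tensor w z).
    have := highest_tensor wP zP.
    by rewrite -addrA -scaler_nat -scalerDl -natrD subnKC.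
  rewrite -(eval_contract w n%:R zn z1 dR) (R0 n%:R (tensor M Z) (pure_tensor w z) hn).
  by rewrite /contract big1 // => k' _; rewrite ffunE scaler0.
have /eqP := eval_vanish Rn 0; rewrite evalR big1 ?subr0 => [|b Pb];
  last by rewrite eb0 ?linear0.
rewrite scaler_eq0 (negPf u0) orbF /c scale0r addr0 => /eqP c0.
by move: c_gt0; rewrite c0 ltxx.
Qed.

End Relations.

(** * Relations in irreducible modules *)
Section Irreducible.
Variables (F : numClosedFieldType) (g : lieAlgType F) (H : {vspace g}).
Variables (l : nat) (Pi fw : l.-tuple 'Hom(subvs_of H, F^o)).
Variables (X : (\dim {:g}).-tuple g) (wt : 'I_(\dim {:g}) -> 'Hom(subvs_of H, F^o)).
Hypothesis D : split_setting Pi fw X wt.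
Local Notation dual := 'Hom(subvs_of H, F^o).
Local Notation I := 'I_(\dim {:g}).
Local Notation pos := (pos Pi).
Local Notation highest := (highest Pi).
Local Notation deg := (deg Pi).
Local Notation expr := (expr H).
Implicit Types (alpha beta gamma delta mu tau lam : dual) (x y z : g) (b c : I) (i j : 'I_l).
Implicit Types (M Z V : lieModule g) (s : F) (e : expr).

(** Tells the weight [mu] apart from the finitely many other weights occurring
    in [n].  As [p] is scalar on every weight space, two such operators can be
    composed; this does the work of a direct sum decomposition. *)
Definition separated V mu (n : V) := exists p : 'End(V),
  [/\ forall (nu : dual) (w : V), mod_weight nu w -> exists a, p w = a *: w,
      forall w : V, mod_weight mu w -> p w = w & p n = 0].

Lemma separated0 V mu : separated mu (0 : V).
Proof.
by exists \1%VF; split=> [nu w _|w _|]; rewrite ?id_lfunE //; exists 1; rewrite scale1r.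
Qed.

Lemma separatedD V mu nu (n w : V) : separated mu n -> mod_weight nu w -> nu != mu ->
  separated mu (n + w).
Proof.
move=> [p [pw pmu pn]] wP nmu.
have [t nt] : exists t, nu t != mu t.
  have /subvPn[t _ tP] : ~~ (fullv <= lker (nu - mu))%VS.
    apply: contra nmu => /subvP ker; rewrite -subr_eq0; apply/eqP/lfunP => t.
    by rewrite [RHS]lfunE; apply/eqP; rewrite -memv_ker ker ?memvf.
  by exists t; move: tP; rewrite memv_ker add_lfunE opp_lfunE subr_eq0.
pose q : 'End(V) := (mu t - nu t)^-1 *: shift (act V (vsval t)) (nu t).
have qE nu' (u : V) : mod_weight nu' u -> q u = ((mu t - nu t)^-1 * (nu' t - nu t)) *: u.
  by move=> uP; rewrite scale_lfunE shiftE uP -scalerBl scalerA.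
exists (q \o p)%VF; split=> [nu' u uP|u uP|].
- have [a pE] := pw _ _ uP.
  by exists (a * ((mu t - nu t)^-1 * (nu' t - nu t)));
    rewrite comp_lfunE pE linearZ /= (qE _ _ uP) scalerA.
- by rewrite comp_lfunE pmu // (qE _ _ uP) mulVf ?scale1r // subr_eq0 eq_sym.
have [a pE] := pw _ _ wP.
by rewrite comp_lfunE linearD /= pn add0r pE linearZ /= (qE _ _ wP) subrr mulr0 scale0r scaler0.
Qed.

Inductive spanned V s (v : V) (K : dual -> expr -> Prop) : V -> Prop :=
  | spanned0 : spanned s v K 0
  | spannedS delta e (m : V) : K delta e -> spanned s v K m ->
      spanned s v K (eval s v e + m).

(** The span of the values is a nonzero submodule, hence everything.  An element
    of one weight is the sum of the values of that weight, by [separated]. *)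
Lemma irreducible_words V mu s (v : V) (K : dual -> expr -> Prop) :
  irreducible V -> mod_weight mu v ->
  (forall delta e, K delta e -> deg delta e) ->
  (forall delta, K delta (Zero H)) ->
  (forall a delta e1 e2, K delta e1 -> K delta e2 -> K delta (Lin a%:P e1 e2)) ->
  (forall gamma x delta e, weight_vec gamma x -> K delta e ->
     exists e', K (delta + gamma) e' /\ act V x (eval s v e) = eval s v e') ->
  (exists delta e, K delta e /\ eval s v e != 0) ->
  forall delta (m : V), mod_weight (delta + mu) m -> exists2 e, K delta e & m = eval s v e.
Proof.
move=> [_ irr] vP Kdeg K0 KL Kact [d0 [e0 [Ke0 e0n0]]].
pose Sp := spanned s v K.
have SpD m n : Sp m -> Sp n -> Sp (m + n).
  by elim=> [|delta e m' Ke _ IH Sn]; rewrite ?add0r // -addrA; apply: spannedS Ke (IH Sn).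
have SpZ a m : Sp m -> Sp (a *: m).
  elim=> [|delta e m' Ke _ IH]; rewrite ?scaler0; first exact: spanned0.
  rewrite scalerDr (_ : a *: eval s v e = eval s v (Lin a%:P e (Zero H))); last first.
    by rewrite /= hornerC addr0.
  by apply: (spannedS (delta := delta)) => //; apply: KL.
have SpA b m : Sp m -> Sp (act V (tnth X b) m).
  elim=> [|delta e m' Ke _ IH]; rewrite ?linear0; first exact: spanned0.
  by rewrite linearD /=; have [e2 [K2 ->]] := Kact _ _ _ _ (split_wt D b) Ke;
    apply: spannedS K2 IH.
have Sp_line (U : {vspace V}) (u : V) : (forall m, m \in U -> Sp m) -> Sp u ->
  forall m, m \in (U + <[u]>)%VS -> Sp m.
  move=> US uS m /memv_addP[m1 m1U [_ /vlineP[a ->] ->]].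
  by apply: SpD; [exact: US | exact: SpZ].
have Spfull m : Sp m.
  suff /(_ m (memvf m)) : forall m : V, m \in fullv -> Sp m by [].
  apply: (@vspace_grow _ _ (fun U : {vspace V} => forall m, m \in U -> Sp m) 0%VS);
    rewrite ?sub0v //.
    by move=> n; rewrite memv0 => /eqP->; apply: spanned0.
  move=> U US _ UnT.
  have [eU|eU] := boolP (eval s v e0 \in U); last first.
    exists (U + <[eval s v e0]>)%VS; rewrite addvSl subvf addv_line_neq //; split=> //.
    apply: Sp_line => //; rewrite -[eval s v e0]addr0; apply: spannedS Ke0 _; exact: spanned0.
  have [/forallP stab|] := boolP [forall b, (act V (tnth X b) @: U <= U)%VS].
    have [|U0|Uf] := irr U; last by rewrite Uf eqxx in UnT.
      move=> x; apply/subvP => _ /memv_imgP[u uU ->].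
      rewrite (sum_coordX D x) act_suml rpred_sum // => b _.
      by rewrite actZl rpredZ // (subvP (stab b)) // memv_img.
    by move: eU e0n0; rewrite U0 memv0 => ->.
  rewrite negb_forall => /existsP[b /subvPn[_ /memv_imgP[u uU ->] uN]].
  exists (U + <[act V (tnth X b) u]>)%VS; rewrite addvSl subvf addv_line_neq //; split=> //.
  by apply: Sp_line => //; apply/SpA/US.
move=> delta m mP.
have [e [n [Ke mE [p [_ pmu pn]]]]] : exists e n,
    [/\ K delta e, m = eval s v e + n & separated (delta + mu) n].
  elim: {mP}(Spfull m) => [|d e m' Ke _ [e' [n [Ke' m'E nS]]]].
    by exists (Zero H), 0; split; [exact: K0 | rewrite /= addr0 | exact: separated0].
  have [dE|nd] := eqVneq d delta.
    rewrite dE in Ke; exists (Lin 1 e e'), n; split=> //; first by rewrite -polyC1; apply: KL.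
    by rewrite /= hornerC scale1r m'E addrA.
  exists e', (n + eval s v e); split=> //; first by rewrite m'E addrC -addrA.
  apply: separatedD nS (eval_weight s (Kdeg _ _ Ke) vP) _.
  by rewrite (inj_eq (addIr mu)).
exists e => //; rewrite mE; suff -> : n = 0 by rewrite addr0.
rewrite -pn -[LHS]pmu // => t.
have -> : n = m - eval s v e by rewrite mE [_ + n]addrC addrK.
by rewrite linearB /= mP (eval_weight s (Kdeg _ _ Ke) vP) scalerBr.
Qed.

(** Words killing the highest weight vectors of weight [lam + n tau] for all
    natural numbers [n] kill those of irreducible modules for all values of [n]:
    otherwise raising them back would give the constant 1, while the scalar
    obtained is a polynomial in [n] with infinitely many zeros. *)
Lemma relations_interpolate V lam tau s (v : V) e delta :
  irreducible V -> highest (lam + s *: tau) v -> v != 0 ->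
  (forall n : nat, exists M (w : M), highest (lam + n%:R *: tau) w /\ w != 0) ->
  deg delta e ->
  (forall n M (w : M), highest (lam + n%:R *: tau) w -> eval n%:R w e = 0) ->
  eval s v e = 0.
Proof.
move=> Virr vP vn0 exM de rel; apply/eqP/negPn/negP => en0.
pose K delta e := deg delta e /\
  forall n M (w : M), highest (lam + n%:R *: tau) w -> eval n%:R w e = 0.
have [||||||e1 [d1 r1] vE] := @irreducible_words V (lam + s *: tau) s v K Virr vP.1 _ _ _ _ _
  0 v.
- by move=> d e' [].
- by [].
- by move=> a d e1 e2 [d1 r1] [d2 r2]; split=> //= n M w wP; rewrite r1 // r2 // scaler0 addr0.
- move=> gamma x d e' xP [d' r'].
  have [e2 [d2 E2]] := normal_form D lam tau d' xP.
  exists e2; split; last exact: E2.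
  by split=> // n M w wP; rewrite -E2 // r' // linear0.
- by exists delta, e.
- by rewrite add0r; exact: vP.1.
have [e10|[_ /(_ erefl)[q qE]]] := deg_trivial D d1.
  by rewrite vE e10 eqxx in vn0.
have q0 : q = 0.
  apply: (@poly_eq0_nat _ q 0) => n _; have [M [w [wP wn0]]] := exM n.
  by have /eqP := r1 n M w wP; rewrite qE scaler_eq0 (negPf wn0) orbF => /eqP.
by move: vn0; rewrite vE qE q0 horner0 scale0r eqxx.
Qed.

Lemma mem_weight_space V mu (m : V) : m \in weight_space V mu <-> mod_weight mu m.
Proof.
by split=> [/weight_spaceP|mP]; last exact/weight_spaceP.
Qed.

(** Weight spaces are quotients of a common space of words by the relations. *)
Lemma weight_mult_le V V' lam lam' (v : V) (v' : V') delta :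
  irreducible V -> highest lam v -> v != 0 -> highest lam' v' ->
  (forall e, param_free e -> deg delta e -> eval 0 v' e = 0 -> eval 0 v e = 0) ->
  (weight_mult V (delta + lam)%R <= weight_mult V' (delta + lam')%R)%N.
Proof.
move=> Virr vP vn0 v'P rel; rewrite /weight_mult.
set W := weight_space V _; set W' := weight_space V' _.
pose K delta e := param_free e /\ deg delta e.
have words (m : V) : mod_weight (delta + lam) m -> exists2 e, K delta e & m = eval 0 v e.
  apply: (@irreducible_words V lam 0 v K Virr vP.1).
  - by move=> d e [].
  - by [].
  - by move=> a d e1 e2 [c1 d1] [c2 d2]; split=> //=; split=> //; exists a.
  - move=> gamma x d e xP [_ de].
    have [e' [d' E']] := normal_form D lam 0 de xP; exists (freeze 0 e'); split.
      by split; [exact: param_free_freeze | exact: deg_freeze].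
    by rewrite eval_freeze E' // scaler0 addr0.
  by exists 0, (One H); split.
have /fin_all_exists[e eP] (k : 'I_(\dim W)) : exists e,
  K delta e /\ (vbasis W)`_k = eval 0 v e.
  have [|e Ke eE] := words ((vbasis W)`_k); last by exists e.
  by apply/mem_weight_space/vbasis_mem/mem_nth; rewrite size_tuple.
pose Y := [tuple eval 0 v' (e k) | k < \dim W].
have Yfree : free Y.
  apply/freeP => a aY.
  have [E [cE dE EE]] : exists E, [/\ param_free E, deg delta E & forall M (m : M),
      eval 0 m E = \sum_k a k *: eval 0 m (e k)].
    rewrite -[index_enum _]/(index_enum _); elim: (index_enum _) => [|k r [E [cE dE EE]]].
      by exists (Zero H); split=> // M m; rewrite big_nil.
    have [[ck dk] _] := eP k.
    exists (Lin (a k)%:P (e k) E); split=> //=; first by split=> //; exists (a k).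
    by move=> M m; rewrite big_cons EE hornerC.
  have E0 : eval 0 v E = 0.
    apply: rel => //; rewrite EE -[RHS]aY; apply: eq_bigr => k _.
    by rewrite -tnth_nth tnth_mktuple.
  have := EE V v; rewrite E0 => /esym sum0.
  have /freeP := basis_free (vbasisP W); apply; rewrite -[RHS]sum0.
  by apply: eq_bigr => k _; case: (eP k) => _ ->.
have YW : (<<Y>> <= W')%VS.
  apply/span_subvP => _ /mapP[k _ ->]; apply/mem_weight_space.
  by have [[_ dk] _] := eP k; exact: (eval_weight 0 dk v'P.1).
by have := dimvS YW; rewrite (eqP Yfree) size_tuple.
Qed.

End Irreducible.

(** * Comparison of weight multiplicities *)
Section Comparison.
Variables (F : numClosedFieldType) (g : lieAlgType F) (H : {vspace g}).
Variables (l : nat) (Pi fw : l.-tuple 'Hom(subvs_of H, F^o)).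
Variables (X : (\dim {:g}).-tuple g) (wt : 'I_(\dim {:g}) -> 'Hom(subvs_of H, F^o)).
Hypothesis D : split_setting Pi fw X wt.
Local Notation dual := 'Hom(subvs_of H, F^o).
Local Notation highest := (highest Pi).
Local Notation deg := (deg Pi).
Implicit Types (delta mu tau lam : dual) (i j : 'I_l) (V M : lieModule g).

(** Persistence to all [lam + n tau], then interpolation at [lam + s tau]. *)
Lemma relations_transfer V V' lam tau s (J : {set 'I_l}) (v : V) (v' : V') delta e :
  highest lam v -> v != 0 ->
  irreducible V' -> highest (lam + s *: tau) v' -> v' != 0 ->
  admissible Pi tau -> (forall i, i \notin J -> tau (coroot Pi i) = 0) ->
  (forall i, i \notin J -> 0 <= lam (coroot Pi i)) ->
  (forall j, j \in J -> - coord Pi j delta <= lam (coroot Pi j)) ->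
  param_free e -> deg delta e -> eval 0 v e = 0 -> eval 0 v' e = 0.
Proof.
move=> vP vn0 irr' v'P v'n0 tauA tauJ lamJ' lamJ ce de e0.
rewrite (eval_param_free 0 s) //.
apply: (relations_interpolate D irr' v'P v'n0 _ de) => [n|n M w wP].
  have [Z [z [zeta [zP z1 _]]]] := admissibleMn n tauA.
  exists (tensor V Z), (pure_tensor v z); split.
    by have := highest_tensor vP zP; rewrite scaler_nat.
  apply: contraNneq vn0 => vz0; have := contract_pure zeta v z.
  rewrite vz0 z1 scale1r => <-.
  by rewrite /contract big1 // => k _; rewrite ffunE scaler0.
rewrite (eval_param_free n%:R 0) //.
exact: (relations_persist D vP vn0 tauA tauJ lamJ' ce de lamJ e0) wP.
Qed.

Lemma has_highest V mu : has_highest_weight Pi V mu -> exists2 v : V, highest mu v & v != 0.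
Proof.
case=> v [vn0 vw v0]; exists v => //; split; first exact/mem_weight_space.
move=> gamma x [gn gn0] xP; have [->|xn0] := eqVneq x 0; first by rewrite act0l.
apply: (v0 gamma); last exact/weight_vecP.
by split=> //; apply: weight_vec_root xP xn0 gn0.
Qed.

(** [N] is a common multiple of the factors needed for the fundamental weights. *)
Lemma admissible_sum (J : {set 'I_l}) (p : 'I_l -> nat) : exists2 N : nat, (0 < N)%N &
  admissible Pi (N%:R *: \sum_(j in J) (p j)%:R *: tnth fw j).
Proof.
have /fin_all_exists[k kP] : forall j, exists k : nat,
  (0 < k)%N /\ admissible Pi (tnth fw j *+ k).
  by move=> j; have [k k0 kA] := admissible_fw D j; exists k.
exists (\prod_j k j)%N; first by rewrite prodn_gt0 // => j; case: (kP j).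
rewrite scaler_sumr; apply: (big_rec (fun mu => admissible Pi mu)) => [|j mu _ muA].
  exact: admissible0.
apply: admissibleD => //; have [_ kA] := kP j.
have -> : (\prod_j k j)%:R *: ((p j)%:R *: tnth fw j)
    = tnth fw j *+ k j *+ ((\prod_(i | i != j) k i) * p j)%N.
  rewrite (bigD1 j) //= scalerA -natrM -mulrnA -scaler_nat; congr (_%:R *: _).
  by rewrite mulnA.
exact: admissibleMn.
Qed.

(** The comparison in one direction: [lam] and [lam'] differ by a combination of
    the fundamental weights in [J], a positive multiple [tau] of which is
    admissible; [lam'] lies on the line [lam + s tau]. *)
Lemma weight_mult_compare V V' lam lam' (J : {set 'I_l}) (p : 'I_l -> nat) (q : bool)
    (v : V) (v' : V') delta :
  irreducible V -> irreducible V' -> highest lam v -> v != 0 -> highest lam' v' -> v' != 0 ->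
  lam' = lam + (-1) ^+ q *: \sum_(j in J) (p j)%:R *: tnth fw j ->
  (forall i, i \notin J -> 0 <= lam (coroot Pi i)) ->
  (forall j, j \in J -> - coord Pi j delta <= lam (coroot Pi j)) ->
  (weight_mult V' (delta + lam')%R <= weight_mult V (delta + lam)%R)%N.
Proof.
move=> irr irr' vP vn0 v'P v'n0 lamE lamJ' lamJ.
have [N N_gt0 NA] := admissible_sum J p.
set kap := \sum_(j in J) _ in lamE NA.
have Nn0 : N%:R != 0 :> F by rewrite pnatr_eq0 -lt0n.
apply: (weight_mult_le D irr' v'P v'n0 vP) => e ce de.
apply: (relations_transfer (tau := N%:R *: kap) (s := (-1) ^+ q / N%:R) (J := J)
  vP vn0 irr' _ v'n0 NA _ lamJ' lamJ ce de).
  by rewrite scalerA divfK // -lamE.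
move=> i niJ; rewrite scale_lfunE sum_lfunE big1 ?scaler0 // => j jJ.
rewrite scale_lfunE (fw_coroot D); case: eqP => [ji|_]; last by rewrite scaler0.
by rewrite -ji jJ in niJ.
Qed.

End Comparison.

Theorem proposition1
  (R : realType) (g : lieAlgType R[i]) (g_ss : semisimple g)
  (H : {vspace g}) (H_cartan : cartan_subalgebra H)
  (l : nat) (Pi : l.-tuple 'Hom(subvs_of H, (R[i])^o)) (Pi_base : root_base Pi)
  (fw : l.-tuple 'Hom(subvs_of H, (R[i])^o))
  (fw_fund : fundamental_weights Pi fw)
  (lambda mu : 'Hom(subvs_of H, (R[i])^o))
  (a : 'I_l -> int) (c : 'I_l -> nat) (J : {set 'I_l})
  (lambda_def : lambda = \sum_(r < l) (a r)%:~R *: tnth fw r)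
  (lambda_dom : dominant_integral Pi fw lambda)
  (mu_int : integral_weight fw mu)
  (mu_def : mu = lambda - \sum_(r < l) tnth Pi r *+ c r)
  (J_neq0 : J != set0)
  (c_le_a : forall j, j \in J -> (c j)%:Z <= a j) :
  let lambda' := lambda + \sum_(j in J) ((c j)%:Z - a j)%:~R *: tnth fw j in
  let mu' := lambda' - (lambda - mu) in
  forall V V' : lieModule g,
    irreducible_highest Pi V lambda ->
    irreducible_highest Pi V' lambda' ->
    weight_mult V mu = weight_mult V' mu'.
Proof.
move=> lambda' mu' V V' [irr /has_highest[v vP vn0]] [irr' /has_highest[v' v'P v'n0]].
have [X [wt D]] := split_settingP g_ss H_cartan Pi_base fw_fund.
pose delta := - \sum_(r < l) tnth Pi r *+ c r.
have muE : mu = delta + lambda by rewrite mu_def addrC.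
have mu'E : mu' = delta + lambda' by rewrite /mu' mu_def subKr addrC.
have cE j : - coord Pi j delta = (c j)%:R.
  rewrite /delta linearN opprK; exact: (coord_comb Pi_base).
pose p j := `|a j - (c j)%:Z|%N.
have pE j : j \in J -> (p j)%:R = (a j)%:~R - (c j)%:R :> R[i].
  move=> /c_le_a cj; rewrite -[(p j)%:R]/((p j)%:Z%:~R) /p gez0_abs ?subr_ge0 //.
  by rewrite rmorphB.
(* [lambda'] and [lambda] differ by the combination with coefficients [p]. *)
have lamE : lambda' = lambda + (-1) ^+ true *: \sum_(j in J) (p j)%:R *: tnth fw j.
  congr (_ + _); rewrite expr1 scaleN1r -sumrN; apply: eq_bigr => j jJ.
  by rewrite pE // -scaleNr opprB rmorphB.
have lamE' : lambda = lambda' + (-1) ^+ false *: \sum_(j in J) (p j)%:R *: tnth fw j.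
  by rewrite lamE expr0 expr1 scale1r scaleN1r subrK.
have lam_a i : lambda (coroot Pi i) = (a i)%:~R.
  rewrite lambda_def sum_lfunE (bigD1 i) //= big1 ?addr0 => [|j nji].
    by rewrite scale_lfunE (fw_coroot D) eqxx -[_ *: _]/(_ * _) mulr1.
  by rewrite scale_lfunE (fw_coroot D) (negPf nji) scaler0.
have sumJ i : (\sum_(j in J) (p j)%:R *: tnth fw j) (coroot Pi i) = if i \in J then (p i)%:R
  else 0.
  rewrite sum_lfunE; case: ifP => [iJ|niJ].
    rewrite (bigD1 i) //= big1 ?addr0 => [|j /andP[_ nji]].
      by rewrite scale_lfunE (fw_coroot D) eqxx -[_ *: _]/(_ * _) mulr1.
    by rewrite scale_lfunE (fw_coroot D) (negPf nji) scaler0.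
  rewrite big1 // => j jJ; rewrite scale_lfunE (fw_coroot D).
  by case: eqP => [ji|_]; rewrite ?scaler0 // -ji jJ in niJ *.
have lam_ge0 i : 0 <= lambda (coroot Pi i).
  by rewrite (corootE D); case: lambda_dom.
have lam'E i : lambda' (coroot Pi i) = if i \in J then (c i)%:R else lambda (coroot Pi i).
  rewrite lamE add_lfunE scale_lfunE sumJ expr1; case: ifP => iJ; last by rewrite scaler0 addr0.
  by rewrite pE // lam_a -[_ *: _]/(_ * _) mulN1r opprB addrC subrK.
rewrite muE mu'E; apply/eqP; rewrite eqn_leq; apply/andP; split.
  apply: (weight_mult_compare D irr' irr v'P v'n0 vP vn0 lamE') => i iJ.
    by rewrite lam'E (negPf iJ).
  by rewrite lam'E iJ cE.
apply: (weight_mult_compare D irr irr' vP vn0 v'P v'n0 lamE) => i iJ; first exact: lam_ge0.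
by rewrite cE lam_a -[(c i)%:R]/((c i)%:Z%:~R) ler_int c_le_a.
Qed.
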